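(* Let $f:\mathbb{R}^{n_1\times\cdots\times n_d}\to\mathbb{R}$ be of the form $f(\mathcal{X})=g(\mathcal{A}(\mathcal{X}))+\langle\mathcal{C},\mathcal{X}\rangle$, where $g:\mathbb{R}^p\to\mathbb{R}$ is $\alpha$-strongly convex ($\alpha>0$) and $\beta$-smooth, $\mathcal{A}:\mathbb{R}^{n_1\times\cdots\times n_d}\to\mathbb{R}^p$ is a linear map, and $f$ is $\beta$-smooth ($\nabla f$ is $\beta$-Lipschitz with respect to $\|\cdot\|_F$), $\beta>0$. Let $\mathcal{B}=\{\mathcal{X}\in\mathbb{R}^{n_1\times\cdots\times n_d}:\|\mathcal{X}\|_*\le1\}$ and assume $\min_{\mathcal{X}\in\mathcal{B}}f(\mathcal{X})$ has a unique optimal solution $\mathcal{X}^*$, which satisfies strict complementarity. Let $\gamma>0$ be the quadratic growth constant described in the context. Let $\{\mathcal{X}_t\}_{t\ge1}$ be the sequence of iterates produced by Nesterov's restarted fast gradient method (see context) with $K=\lceil\sqrt{2\beta}\,e/\sqrt\gamma\,\rceil$. Denote $m:=\max_{i_3\in[n_3],\dots,i_d\in[n_d]}\#\sigma_1(\overline{\nabla f(\mathcal{X}^* )}^{(i_3,\dots,i_d)})$, $s:=\#\sigma_1(\overline{\nabla f(\mathcal{X}^* )})$, $q:=\#\{(i_3,\dots,i_d):\overline{\nabla f(\mathcal{X}^* )}^{(i_3,\dots,i_d)}\neq0\}$, and let $r$ be an integer with $m\le r<\min\{n_1,n_2\}$. If the initialization $\mathcal{X}_1\in\mathcal{B}$ satisfies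 $\|\mathcal{X}_1-\mathcal{X}^*\|_F\le\frac{\sqrt2\min\{\gamma,\sqrt\gamma\}}{3\sqrt\beta}R_0(r)$, where $$R_0(r):=\frac{1}{2\beta\sqrt N}\max\left\{\frac{\delta(r)}{1+\frac{\sqrt{mq}}{s}},\ \frac{\delta(r-m+1)}{\frac1{\sqrt m}+\frac{\sqrt{mq}}{s}}\right\},$$ then for all $t\ge1$ the projections $\Pi_{\mathcal{B}}[\cdot]$ can be replaced by their rank-$r$ truncated counterparts without changing the sequence $\{\mathcal{X}_t\}_{t\ge1}$, and for all $t\ge1$, $$f(\mathcal{X}_t)-f(\mathcal{X}^* )\le\exp\left(-\frac{\sqrt{2\gamma}}{\sqrt\beta\,e}(t-1)\right)\big(f(\mathcal{X}_1)-f(\mathcal{X}^* )\big).$$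
   Context: Fix $d\ge 3$ and positive integers $n_1,\dots,n_d$, and let $N=n_3\cdots n_d$, $[n]=\{1,\dots,n\}$. $\langle\cdot,\cdot\rangle$, $\|\cdot\|_F$ are the entrywise Euclidean inner product and norm; $e$ is Euler's number. For a tensor $\mathcal{X}$ of size $n_1\times\cdots\times n_d$, its Fourier transform $\overline{\mathcal{X}}$ is the complex tensor $\overline{\mathcal{X}}(i_1,i_2,k_3,\dots,k_d)=\sum_{i_3,\dots,i_d}\prod_{j=3}^d\omega_j^{(i_j-1)(k_j-1)}\mathcal{X}(i_1,i_2,i_3,\dots,i_d)$, $\omega_j=e^{-2\pi\mathrm{i}/n_j}$, and $\mathrm{ifft}$ is the inverse transform. Its frontal slices are $\overline{\mathbf{X}}^{(i_3,\dots,i_d)}=\overline{\mathcal{X}}(:,:,i_3,\dots,i_d)\in\mathbb{C}^{n_1\times n_2}$, and $\overline{\mathbf{X}}\in\mathbb{C}^{n_1N\times n_2N}$ is the block-diagonal matrix with these slices on the diagonal in colexicographic order; $\mathrm{bdiag}^{-1}$ recovers the tensor $\overline{\mathcal{X}}$ from $\overline{\mathbf{X}}$. $\overline{\nabla f(\mathcal{X}^* )}$ denotes this block-diagonal matrix for the tensor $\nabla f(\mathcal{X}^* )$, with diagonal blocks indexed by the superscript. The tensor nuclear norm is $\|\mathcal{X}\|_*=\frac1N\|\overline{\mathbf{X}}\|_*$ ($\frac1N$ times the sum of singular values of $\overline{\mathbf X}$). $\Pi_S$ is Euclidean (Frobenius) projection onto $S$. $\sigma_i(\cdot)$ is the $i$-th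 largest singular value of a matrix, $\#\sigma_1(\cdot)$ the multiplicity of its largest singular value. For integer $1\le k<\min\{n_1,n_2\}$, $\delta(k)=\sigma_1(\overline{\nabla f(\mathcal{X}^* )})-\max_{i_3,\dots,i_d}\sigma_{k+1}(\overline{\nabla f(\mathcal{X}^* )}^{(i_3,\dots,i_d)})$. ''$\beta$-smooth'' means having a $\beta$-Lipschitz gradient. Nesterov's restarted fast gradient method with parameter $K\in\mathbb{N}$: given $\mathcal{X}_1\in\mathcal{B}$, for $t=1,2,\dots$: set $\mathcal{X}_{t,1}=\mathcal{Y}_{t,1}=\mathcal{X}_t$, $\theta_1=1$; for $l=1,\dots,K$ set $\mathcal{X}_{t,l+1}=\Pi_{\mathcal{B}}[\mathcal{Y}_{t,l}-\frac1\beta\nabla f(\mathcal{Y}_{t,l})]$, $\theta_{l+1}=\frac{1+\sqrt{1+4\theta_l^2}}2$, $\mathcal{Y}_{t,l+1}=\mathcal{X}_{t,l+1}+\frac{\theta_l-1}{\theta_{l+1}}(\mathcal{X}_{t,l+1}-\mathcal{X}_{t,l})$; then set $\mathcal{X}_{t+1}=\mathcal{X}_{t,K+1}$. Rank-$r$ truncated projection of $\mathcal{P}$ onto $\{\|\cdot\|_*\le\tau\}$ (here $\tau=1$): for each $(i_3,\dots,i_d)$ compute only the leading $r$ components $\sigma_i,\mathbf{u}_i,\mathbf{v}_i$ ($i\le r$) of an SVD of the slice $\overline{\mathbf{P}}^{(i_3,\dots,i_d)}$ (SVDs chosen so that slices that are complex conjugates of each other have conjugate SVDs); find $\sigma\ge0$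 with $\frac1N\sum_{i_3,\dots,i_d}\sum_{i=1}^r\max\{0,\sigma_i(\overline{\mathbf{P}}^{(i_3,\dots,i_d)})-\sigma\}=\tau$; the output is the inverse Fourier transform of the tensor with frontal slices $\sum_{i=1}^r\max\{0,\sigma_i-\sigma\}\mathbf{u}_i\mathbf{v}_i^{\mathrm H}$. Strict complementarity of an optimal solution $\mathcal{X}^*$: $\mathbf{0}\in\nabla f(\mathcal{X}^* )+\mathrm{ri}(\mathcal{N}_{\mathcal{B}}(\mathcal{X}^* ))$, where $\mathrm{ri}$ is relative interior and $\mathcal{N}_{\mathcal{B}}(\mathcal{X}^* )=\{\mathcal{Y}:\langle\mathcal{Y},\mathcal{Z}-\mathcal{X}^*\rangle\le0\ \forall\mathcal{Z}\in\mathcal{B}\}$ the normal cone. With $\rho=\mathrm{rank}(\overline{\mathbf{X}^*})$, its complementarity measure is $\delta^*=\sigma_1(\overline{\nabla f(\mathcal{X}^* )})-\sigma_{\rho+1}(\overline{\nabla f(\mathcal{X}^* )})$. Quadratic growth constant: $\gamma$ is a constant for which $f(\mathcal{X})-f(\mathcal{X}^* )\ge\gamma\|\mathcal{X}-\mathcal{X}^*\|_F^2$ for all $\mathcal{X}\in\mathcal{B}$, and it can be written as $$\gamma=\min\left\{\frac{\delta^*}{8N}\left(1+\frac{2\sigma_{\max}^2(\mathcal{P})}{\sigma_{\min}^2(\mathcal{P}_V)}\right)^{-1},\ \frac{\sigma_{\min}^2(\mathcal{P}_V)N\alpha}{8}\right\}.$$ Here $D=(n_1+n_2)N$ and $\mathbb{S}^k$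 is the space of real symmetric $k\times k$ matrices. For a $D\times D$ matrix $\mathbf{W}$, $\mathbf{W}_\flat$ is twice its upper-right $n_1N\times n_2N$ block. For $\mathbf{X}=\begin{bmatrix}\mathbf{A}&-\mathbf{B}\\ \mathbf{B}&\mathbf{A}\end{bmatrix}\in\mathbb{S}^{2D}$ ($\mathbf{A}$ symmetric, $\mathbf{B}$ antisymmetric), $\mathbf{X}_\triangledown=\mathbf{A}+\mathrm{i}\mathbf{B}$. The linear operator $\mathcal{Q}$ on $\mathbb{S}^{2D}$ is such that $\mathcal{Q}(\mathbf{X})=\mathbf{0}$ is the set of linear constraints that all entries of $\mathbf{A}_\flat,\mathbf{B}_\flat$ off the $n_1\times n_2$ main diagonal blocks vanish and that the diagonal blocks satisfy $\mathbf{A}_\flat^{(i_3,\dots,i_d)}=\mathbf{A}_\flat^{(i_3',\dots,i_d')}$, $\mathbf{B}_\flat^{(i_3,\dots,i_d)}=-\mathbf{B}_\flat^{(i_3',\dots,i_d')}$ for all indices, where $i_j'=1$ if $i_j=1$ and $i_j'=n_j-i_j+2$ otherwise. The linear operator $\mathcal{E}$ on $\mathbb{S}^{2D}$ is such that $\mathcal{E}(\mathbf{X})=\mathbf{0}$ is the set of equalities $\left\langle\begin{bmatrix}\mathbf{E}_{ij}&\mathbf{0}\\ \mathbf{0}&-\mathbf{E}_{ij}\end{bmatrix},\mathbf{X}\right\rangle=0$ and $\left\langle\begin{bmatrix}\mathbf{0}&\mathbf{E}_{ij}\\ \mathbf{E}_{ij}&\mathbf{0}\end{bmatrix},\mathbf{X}\right\rangle=0$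 for $1\le i<j\le D$, $\mathbf{E}_{ij}=\mathbf{e}_i\mathbf{e}_j^\top+\mathbf{e}_j\mathbf{e}_i^\top$ with $\mathbf{e}_i$ the $i$-th unit vector. Then $\mathcal{P}(\mathbf{X})=[\mathrm{Tr}(\mathbf{X}),\mathcal{Q}(\mathbf{X})^\top,\mathcal{E}(\mathbf{X})^\top,\mathcal{B}'(\mathbf{X})^\top]^\top$ with $\mathcal{B}'(\mathbf{X})=\mathcal{A}(\mathrm{ifft}(\mathrm{bdiag}^{-1}((\mathbf{X}_\triangledown)_\flat)))$. With the SVD $\overline{\mathbf{X}^*}=\overline{\mathbf{U}^*}\,\overline{\mathbf{S}^*}\,\overline{\mathbf{V}^*}^{\mathrm H}$ ($\rho$ components) and $\widetilde{\mathbf{V}}=\frac1{\sqrt2}\begin{bmatrix}\overline{\mathbf{U}^*}\\-\overline{\mathbf{V}^*}\end{bmatrix}$, $\mathbf{T}=\begin{bmatrix}\mathrm{Re}\,\widetilde{\mathbf{V}}&\mathrm{Im}\,\widetilde{\mathbf{V}}\\ \mathrm{Im}\,\widetilde{\mathbf{V}}&-\mathrm{Re}\,\widetilde{\mathbf{V}}\end{bmatrix}$, one sets $\mathcal{P}_V(\mathbf{S})=\mathcal{P}(\mathbf{T}\mathbf{S}\mathbf{T}^\top)$ for $\mathbf{S}\in\mathbb{S}^{2\rho}$, $\sigma_{\min}(\mathcal{P}_V)=\min_{\|\mathbf{S}\|_F=1}\|\mathcal{P}_V(\mathbf{S})\|_2$ and $\sigma_{\max}(\mathcal{P})=\max_{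\|\mathbf{S}\|_F=1}\|\mathcal{P}(\mathbf{S})\|_2$.
   Formalization: The convergence bound is stated only when √(2β)e/√γ ≥ 1 (i.e. γ ≤ 2e²β); without this it is false, e.g. for a linear f with N very large, where K=1 and the true rate is only polynomial in γ/β. The claim on truncated projections keeps all the original hypotheses. *)

(* Defs.v *)
From HB Require Import structures.
From mathcomp Require Import all_boot all_order all_algebra.
From mathcomp Require Import spectral sesquilinear complex.
From mathcomp Require Import zify.
From mathcomp Require Import all_classical all_reals all_analysis.

Set Implicit Arguments.
Unset Strict Implicit.
Unset Printing Implicit Defensive.

Import Order.TTheory GRing.Theory Num.Theory.
Local Open Scope classical_set_scope.
Local Open Scope ring_scope.
Local Open Scope sesquilinear_scope.
Local Open Scope complex_scope.

Section Euclidean.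
Variables (R : realType) (V : lmodType R) (dot : V -> V -> R).
Implicit Types (x y z : V) (S : set V).

Definition enorm x : R := Num.sqrt (dot x x).

(* Frechet gradient with respect to [dot]. *)
Definition is_gradient (f : V -> R) (gf : V -> V) : Prop :=
  forall x (eps : R), 0 < eps -> exists2 eta : R, 0 < eta &
    forall h, enorm h < eta ->
      `|f (x + h) - f x - dot (gf x) h| <= eps * enorm h.

Definition lipschitz_map (L : R) (F : V -> V) : Prop :=
  forall x y, enorm (F x - F y) <= L * enorm (x - y).

Definition smooth (L : R) (f : V -> R) (gf : V -> V) : Prop :=
  is_gradient f gf /\ lipschitz_map L gf.

Definition strongly_convex (a : R) (f : V -> R) : Prop :=
  forall x y (t : R), 0 <= t <= 1 ->
    f (t *: x + (1 - t) *: y) <=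
      t * f x + (1 - t) * f y - a / 2 * (t * (1 - t)) * enorm (x - y) ^+ 2.

Definition is_minimizer (f : V -> R) S x : Prop :=
  S x /\ forall z, S z -> f x <= f z.

Definition is_proj S x y : Prop :=
  S y /\ forall z, S z -> enorm (x - y) <= enorm (x - z).

Definition normal_cone S x : set V :=
  [set y | forall z, S z -> dot y (z - x) <= 0].

Definition affine_hull S : set V :=
  [set x | exists (k : nat) (c : 'I_k -> R) (v : 'I_k -> V),
     [/\ forall i, S (v i), \sum_i c i = 1 & x = \sum_i c i *: v i]].

Definition rel_interior S : set V :=
  [set x | S x /\ exists2 eps : R, 0 < eps &
     forall y, affine_hull S y -> enorm (y - x) < eps -> S y].

Definition strict_complementarity (gf : V -> V) S x : Prop :=
  exists2 y, rel_interior (normal_cone S x) y & gf x + y = 0.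

Definition quadratic_growth (f : V -> R) S x (gamma : R) : Prop :=
  forall z, S z -> gamma * enorm (z - x) ^+ 2 <= f z - f x.

Definition fgm_theta (l : nat) : R :=
  iter l.-1 (fun th => (1 + Num.sqrt (1 + 4 * th ^+ 2)) / 2) 1.

(* [Xo t] are the outer iterates and [X t l], [Y t l] the inner ones; all
   indices start at 1.  The projection is a relation: [proj P Q] reads
   "Q is an admissible output on input P". *)
Definition restarted_fgm (proj : V -> V -> Prop) (gf : V -> V) (beta : R)
    (K : nat) (Xo : nat -> V) (X Y : nat -> nat -> V) : Prop :=
  forall t, (1 <= t)%N ->
    [/\ X t 1%N = Xo t,
        Y t 1%N = Xo t,
        forall l, (1 <= l <= K)%N ->
          proj (Y t l - beta^-1 *: gf (Y t l)) (X t l.+1) /\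
          Y t l.+1 = X t l.+1 +
            ((fgm_theta l - 1) / fgm_theta l.+1) *: (X t l.+1 - X t l)
      & Xo t.+1 = X t K.+1].

End Euclidean.

Definition mxdot (R : realType) m n (A B : 'M[R]_(m, n)) : R :=
  \sum_i \sum_j A i j * B i j.

Section SingularValues.
Variable R : realType.
Local Notation C := R[i].

(* The min(m,n) singular values, with multiplicity and in decreasing order:
   square roots of the min(m,n) largest eigenvalues of A^H A. *)
Definition singular_values m n (A : 'M[C]_(m, n)) : seq R :=
  take (minn m n) (sort >=%R
    [seq Num.sqrt (complex.Re (spectral_diag (A ^t* *m A) 0 j)) | j : 'I_n]).

(* Numbered from 1, as usual; 0 past the last one. *)
Definition sigma m n (A : 'M[C]_(m, n)) (i : nat) : R :=
  nth 0 (singular_values A) i.-1.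

Definition mult_sigma1 m n (A : 'M[C]_(m, n)) : nat :=
  count_mem (sigma A 1) (singular_values A).

Definition nuclear_norm m n (A : 'M[C]_(m, n)) : R :=
  \sum_(s <- singular_values A) s.

(* A = sum_(i <= k) sigma_i u_i v_i^H with orthonormal u_i and v_i: a thin SVD
   for k = min(m,n), and a compact one for k = rank A. *)
Definition is_svd m n k (A : 'M[C]_(m, n)) (U : 'M[C]_(m, k))
    (W : 'M[C]_(n, k)) : Prop :=
  [/\ U ^t* *m U = 1%:M, W ^t* *m W = 1%:M
    & A = U *m diag_mx (\row_(i < k) (sigma A i.+1)%:C) *m W ^t*].

End SingularValues.

Section Colex.
Local Open Scope nat_scope.

(* Weight of the j-th index in the colexicographic numbering, in which the
   first index varies fastest. *)
Definition colex_weight k (ns : 'I_k -> nat) (j : 'I_k) : nat := \prod_(l < k | (l < j)%N) ns l.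

Lemma colex_weight_widen k (ns : 'I_k.+1 -> nat) (j : 'I_k) :
  colex_weight ns (widen_ord (leqnSn k) j) = colex_weight (fun l => ns (widen_ord (leqnSn k) l)) j.
Proof.
rewrite /colex_weight big_mkcond big_ord_recr /= ltnNge ltnW //= muln1.
by rewrite -big_mkcond.
Qed.

Lemma colex_weight_max k (ns : 'I_k.+1 -> nat) :
  colex_weight ns ord_max = \prod_(l < k) ns (widen_ord (leqnSn k) l).
Proof.
rewrite /colex_weight big_mkcond big_ord_recr /= ltnn muln1.
by apply: eq_bigr => l _; rewrite ltn_ord.
Qed.

Lemma colex_bound k (ns c : 'I_k -> nat) : (forall j, c j < ns j) ->
  \sum_j c j * colex_weight ns j < \prod_j ns j.
Proof.
elim: k ns c => [|k IH] ns c cns; first by rewrite !big_ord0.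
rewrite !big_ord_recr /= colex_weight_max.
under eq_bigr do rewrite colex_weight_widen.
have := IH _ _ (fun j => cns (widen_ord (leqnSn k) j)).
move: (\sum_(i < k) _) (\prod_(i < k) _) => s w sw.
have := cns ord_max; move: (c ord_max) (ns ord_max) => a b ab.
nia.
Qed.

Lemma colex_digit k (ns c : 'I_k -> nat) : (forall j, c j < ns j) ->
  forall j, (\sum_l c l * colex_weight ns l) %/ colex_weight ns j %% ns j = c j.
Proof.
elim: k ns c => [|k IH] ns c cns; first by case.
have bnd := colex_bound (fun j => cns (widen_ord (leqnSn k) j)).
move=> j; rewrite big_ord_recr /= colex_weight_max.
under eq_bigr do rewrite colex_weight_widen.
have [jk|jk] := ltnP j k.
  have -> : j = widen_ord (leqnSn k) (Ordinal jk) by apply: val_inj.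
  rewrite colex_weight_widen -[RHS](IH _ _ (fun j => cns (widen_ord (leqnSn k) j)) (Ordinal jk)).
  set ns' := fun l => ns _; set s := bigop _ _ _; set j' := Ordinal jk.
  have wpos : 0 < colex_weight ns' j'.
    by apply: prodn_gt0 => l; apply: leq_ltn_trans (cns _).
  have /dvdnP[q ->] : colex_weight ns' j' * ns' j' %| \prod_(l < k) ns' l.
    rewrite (bigID (fun l : 'I_k => l < j')) /= dvdn_mul //.
    by rewrite (bigD1 j') ?ltnn //= dvdn_mulr.
  have -> : c ord_max * (q * (colex_weight ns' j' * ns' j')) = (c ord_max * q * ns' j') * colex_weight ns' j'.
    by lia.
  by rewrite divnDMl // addnC modnMDl.
have -> : j = ord_max.
  by apply: val_inj => /=; apply/eqP; rewrite eqn_leq jk -ltnS ltn_ord.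
rewrite colex_weight_max.
by rewrite addnC divnMDl ?(leq_ltn_trans _ bnd) // divn_small // addn0 modn_small.
Qed.

Variables (k : nat) (ns : 'I_k -> nat).

Definition mindex : finType := {dffun forall j : 'I_k, 'I_(ns j)}.

Definition num_slices : nat := \prod_(j < k) ns j.

Lemma ns_gt0 (b : 'I_num_slices) j : 0 < ns j.
Proof.
have : 0 < num_slices by apply: leq_ltn_trans (ltn_ord b).
by rewrite /num_slices (bigD1 j) //= muln_gt0 => /andP[].
Qed.

Definition colex_rank (x : mindex) : 'I_num_slices :=
  Ordinal (colex_bound (fun j => ltn_ord (x j))).

Definition colex_unrank (b : 'I_num_slices) : mindex :=
  [ffun j => Ordinal (ltn_pmod (b %/ colex_weight ns j) (ns_gt0 b j))].

Lemma colex_rankK : cancel colex_rank colex_unrank.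
Proof.
move=> x; apply/ffunP => j; apply: val_inj; rewrite ffunE /=.
exact: (colex_digit (fun j => ltn_ord (x j))).
Qed.

Lemma card_mindex : #|mindex| = num_slices.
Proof.
rewrite card_dep_ffun foldrE big_map big_enum /=.
by apply: eq_bigr => j _; rewrite card_ord.
Qed.

Lemma colex_unrankK : cancel colex_unrank colex_rank.
Proof.
have [|f fK Kf] := inj_card_bij (can_inj colex_rankK).
  by rewrite card_ord card_mindex.
by move=> b; rewrite -{1}(Kf b) colex_rankK Kf.
Qed.

Lemma conj_index_subproof (x : mindex) j : (ns j - x j) %% ns j < ns j.
Proof. by rewrite ltn_pmod // (leq_ltn_trans _ (ltn_ord (x j))). Qed.

(* i' = 1 if i = 1 and i' = n - i + 2 otherwise, for indices starting at 1. *)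
Definition conj_index (x : mindex) : mindex :=
  [ffun j => Ordinal (conj_index_subproof x j)].

End Colex.

Arguments num_slices {k} ns.
Arguments mindex {k} ns.

(* A tensor of size n1 x n2 x n_3 x ... x n_d is the array of its frontal
   slices: [k] is d - 2, [ns j] is n_(j+3), and all indices start at 0. *)
Definition tensor (K : Type) k (ns : 'I_k -> nat) (n1 n2 : nat) :=
  {ffun mindex ns -> 'M[K]_(n1, n2)}.

Section Tensors.
Variables (R : realType) (k : nat) (ns : 'I_k -> nat) (n1 n2 : nat).
Local Notation C := R[i].
Local Notation N := (num_slices ns).
Local Notation mindex := (mindex ns).
Local Notation rtensor := (tensor R ns n1 n2).
Local Notation ctensor := (tensor C ns n1 n2).
Implicit Types (X : rtensor) (Z : ctensor).

Definition tdot X X' : R := \sum_x mxdot (X x) (X' x).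

Definition tcomplex X : ctensor := [ffun x => map_mx (real_complex R) (X x)].

(* exp (- 2 pi i / n) *)
Definition omega (n : nat) : C :=
  cos (2 * pi / n%:R) -i* sin (2 * pi / n%:R).

Definition fft Z : ctensor :=
  [ffun y : mindex =>
     \sum_(x : mindex) (\prod_j omega (ns j) ^+ (x j * y j)%N) *: Z x].

Definition ifft Z : ctensor :=
  [ffun x : mindex =>
     N%:R^-1 *:
     \sum_(y : mindex) (\prod_j (omega (ns j))^-1 ^+ (x j * y j)%N) *: Z y].

(* The dimensions n1 N and n2 N, in the form used by [\mxblock]. *)
Definition brows : nat := \sum_(a < N) n1.
Definition bcols : nat := \sum_(a < N) n2.

Definition bdiag Z : 'M[C]_(brows, bcols) :=
  \mxblock_(a < N, b < N) (if a == b then Z (colex_unrank a) else 0).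

(* Only the diagonal blocks are read. *)
Definition bdiag_inv (K : Type) (M : 'M[K]_(brows, bcols)) :
    tensor K ns n1 n2 :=
  [ffun x : mindex =>
     submxblock (p_ := fun=> n1) (q_ := fun=> n2) M (colex_rank x)
       (colex_rank x)].

Definition xbar X : 'M[C]_(brows, bcols) := bdiag (fft (tcomplex X)).

Definition tnn X : R := N%:R^-1 * nuclear_norm (xbar X).

Definition tnn_ball : set rtensor := [set X | tnn X <= 1].

(* [Q] is a possible output of the rank-r truncated projection of [P] onto the
   ball of radius [tau]; it depends on the SVDs chosen for the slices, which
   conjugate slices are required to share up to conjugation.  Meant for
   r <= min(n1,n2). *)
Definition trunc_proj (r : nat) (tau : R) (P Q : rtensor) : Prop :=
  let Pbar := fft (tcomplex P) in
  exists (U : mindex -> 'M[C]_(n1, minn n1 n2))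
         (W : mindex -> 'M[C]_(n2, minn n1 n2)) (sg : R),
  [/\ forall x, is_svd (Pbar x) (U x) (W x),
      forall x y, Pbar y = map_mx Num.conj (Pbar x) ->
        U y = map_mx Num.conj (U x) /\ W y = map_mx Num.conj (W x),
      0 <= sg,
      N%:R^-1 * \sum_(x : mindex) \sum_(1 <= i < r.+1)
                   Num.max 0 (sigma (Pbar x) i - sg) = tau
    & tcomplex Q = ifft [ffun x : mindex =>
        \sum_(i < minn n1 n2 | (i < r)%N)
          (Num.max 0 (sigma (Pbar x) i.+1 - sg))%:C
            *: (col i (U x) *m (col i (W x)) ^t*)]].

(* In the next definitions [G] is the gradient at the optimal solution. *)

Definition slice_mult (G : rtensor) : nat :=
  \max_(x : mindex) mult_sigma1 (fft (tcomplex G) x).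

Definition nonzero_slices (G : rtensor) : nat :=
  #|[pred x : mindex | fft (tcomplex G) x != 0]|.

Definition delta (G : rtensor) (j : nat) : R :=
  sigma (xbar G) 1 -
  \big[Num.max/0]_(x : mindex) sigma (fft (tcomplex G) x) j.+1.

Definition R0 (G : rtensor) (beta : R) (m s q r : nat) : R :=
  (2 * beta * Num.sqrt N%:R)^-1 *
  Num.max
    (delta G r / (1 + Num.sqrt (m * q)%N%:R / s%:R))
    (delta G (r - m + 1) /
       ((Num.sqrt m%:R)^-1 + Num.sqrt (m * q)%N%:R / s%:R)).

Definition compl_measure (G Xstar : rtensor) : R :=
  sigma (xbar G) 1 - sigma (xbar G) (\rank (xbar Xstar)).+1.

End Tensors.

Section GrowthConstant.
Variables (R : realType) (k : nat) (ns : 'I_k -> nat) (n1 n2 : nat).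
Local Notation C := R[i].
Local Notation N := (num_slices ns).
Local Notation rows := (brows ns n1).
Local Notation cols := (bcols ns n2).
Local Notation D := (rows + cols)%N.

Definition mxflat (K : pzRingType) (M : 'M[K]_(rows + cols)) :
    'M[K]_(rows, cols) := 2%:R *: ursubmx M.

Definition mxblk (M : 'M[R]_(rows, cols)) (a b : 'I_N) : 'M[R]_(n1, n2) :=
  submxblock (p_ := fun=> n1) (q_ := fun=> n2) M a b.

(* [[A, -B], [B, A]] *)
Definition real_form (A B : 'M[R]_D) : 'M[R]_(D + D) := block_mx A (- B) B A.

Definition slice_constraints (A B : 'M[R]_D) : Prop :=
  (forall a b, a != b ->
     mxblk (mxflat A) a b = 0 /\ mxblk (mxflat B) a b = 0) /\
  (forall x : mindex ns,
     bdiag_inv (mxflat A) x = bdiag_inv (mxflat A) (conj_index x) /\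
     bdiag_inv (mxflat B) x = - bdiag_inv (mxflat B) (conj_index x)).

(* The operators are specified only where their defining data make sense, and
   results quantify over all linear operators that meet the specification.
   [Qop] and [Eop] are given by their zero sets; [Qop] and [Bop] are given on
   matrices [real_form A B], for which alone A + i B is defined, and [Bop] only
   where the inverse Fourier transform is real, since [Aop] acts on real
   tensors. *)
Definition Q_spec c (Qop : 'M[R]_(D + D) -> 'rV[R]_c) : Prop :=
  forall A B : 'M[R]_D, A^T = A -> B^T = - B ->
    Qop (real_form A B) = 0 <-> slice_constraints A B.

Definition sym_unit (i j : 'I_D) : 'M[R]_D := delta_mx i j + delta_mx j i.

Definition E_spec c (Eop : 'M[R]_(D + D) -> 'rV[R]_c) : Prop :=
  forall X : 'M[R]_(D + D), X^T = X ->
    Eop X = 0 <->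
    forall i j : 'I_D, (i < j)%N ->
      mxdot (block_mx (sym_unit i j) 0 0 (- sym_unit i j)) X = 0 /\
      mxdot (block_mx 0 (sym_unit i j) (sym_unit i j) 0) X = 0.

Definition B_spec p (Aop : tensor R ns n1 n2 -> 'rV[R]_p)
    (Bop : 'M[R]_(D + D) -> 'rV[R]_p) : Prop :=
  forall A B : 'M[R]_D, A^T = A -> B^T = - B ->
  forall Z : tensor R ns n1 n2,
    tcomplex Z = ifft (bdiag_inv (mxflat
      (\matrix_(i, j) (A i j +i* B i j)))) ->
    Bop (real_form A B) = Aop Z.

Section Operators.
Variables (a b p : nat).
Variables (Qop : 'M[R]_(D + D) -> 'rV[R]_a) (Eop : 'M[R]_(D + D) -> 'rV[R]_b).
Variable Bop : 'M[R]_(D + D) -> 'rV[R]_p.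

Definition P_op (X : 'M[R]_(D + D)) : 'rV[R]_(1 + (a + (b + p))) :=
  row_mx (\tr X)%:M (row_mx (Qop X) (row_mx (Eop X) (Bop X))).

Definition sigma_max_P : R :=
  sup [set y | exists S : 'M[R]_(D + D),
    [/\ S^T = S, enorm (@mxdot R _ _) S = 1
      & y = enorm (@mxdot R _ _) (P_op S)]].

Section PV.
Variables (rho : nat) (U : 'M[C]_(rows, rho)) (W : 'M[C]_(cols, rho)).

Definition Vtilde : 'M[C]_(rows + cols, rho) :=
  ((Num.sqrt 2)^-1)%:C *: col_mx U (- W).

Definition Tmx : 'M[R]_(D + D, rho + rho) :=
  let ReV := map_mx (@complex.Re R) Vtilde in
  let ImV := map_mx (@complex.Im R) Vtilde in
  block_mx ReV ImV ImV (- ReV).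

Definition sigma_min_PV : R :=
  inf [set y | exists S : 'M[R]_(rho + rho),
    [/\ S^T = S, enorm (@mxdot R _ _) S = 1
      & y = enorm (@mxdot R _ _) (P_op (Tmx *m S *m Tmx^T))]].

Definition growth_formula (alpha dstar : R) : R :=
  Num.min
    (dstar / (8 * N%:R) *
       (1 + 2 * sigma_max_P ^+ 2 / sigma_min_PV ^+ 2)^-1)
    (sigma_min_PV ^+ 2 * N%:R * alpha / 8).

End PV.
End Operators.
End GrowthConstant.

(* Main.v *)
Require Import Defs.
From HB Require Import structures.
From mathcomp Require Import all_boot all_order all_algebra.
From mathcomp Require Import perm spectral sesquilinear complex.
From mathcomp Require Import ring lra zify.
From mathcomp Require Import all_classical all_reals all_analysis.

Set Implicit Arguments.
Unset Strict Implicit.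
Unset Printing Implicit Defensive.

Import Order.TTheory GRing.Theory Num.Theory.
Local Open Scope classical_set_scope.
Local Open Scope ring_scope.
Local Open Scope sesquilinear_scope.

(* In the Fourier domain everything splits into frontal slices, and the
   projection of P soft-thresholds all the singular values of the slices at a
   common level t with sum max(0, sigma_i - t) = N. Keeping r components per
   slice loses nothing as soon as t dominates every sigma_(r+1), that is, as
   soon as the soft-thresholded mass at the level max sigma_(r+1) is still at
   least N.

   Write P = Xopt - G / beta + E with Xopt the solution and G the gradient
   there. First-order optimality is equality in the trace inequality for (-G,
   Xopt): every slice of Xopt has its singular vectors in the leading
   singular spaces of the slice of -G, hence Xopt - G / beta has mass N above
   the level sigma_1(G) / beta and a gap below. A Weyl inequality with
   Frobenius error bounds sigma_(r+1)(P) from above, and duality between the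
   operator and nuclear norms bounds the mass from below, so the condition
   holds when |E| is small with respect to the gap delta. The positivity of
   gamma forces the complementarity measure deltaopt > 0 and gamma <=
   deltaopt / (8 N), which also settles the first projection when gamma is at
   least beta.

   The iterates stay in this region: the accelerated method satisfies
   f(X_(l+1)) - fopt <= 2 beta |X_1 - Xopt|^2 / (l+1)^2, and quadratic growth
   turns this into a bound on the distance to Xopt; after K steps the gap in
   f has been divided by e^2. *)

(** * Complex matrices with the real trace inner product *)

Section ComplexMatrices.
Variable R : rcfType.
Local Notation C := R[i].
Local Open Scope complex_scope.

(** The radius [R0] is a maximum because the gap argument can split r + 1 = f + j in two ways:
    Weyl's inequality loses |E| / sqrt j, and its level comes from the singular values of index f +
    1. The choice j = 1, f = r produces delta(r) and the constant 1; j = m, f = r - m + 1 produces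
    delta(r - m + 1) and 1 / sqrt m. The mass estimate loses a further |E| / sqrt s, and sqrt (m q)
    / s bounds 1 / sqrt s since s <= m q. The factor 2 sqrt N in the denominator of [R0] comes from
    the gradient step, which at most doubles the distance to the solution, and from Parseval.

    The 3 in the initialization radius absorbs the momentum: inner points stay within 7/6 of sqrt (2
    beta / gamma) |X_1 - Xopt|, and 7/6 * 2/3 < 1.

    Reality is the recurring obstacle. Slices are complex while the optimization runs over real
    tensors, so every object built slice by slice has to respect conjugation before it can be
    transformed back; a slice equal to its own conjugate then requires a real SVD. *)

Definition re (z : C) : R := complex.Re z.
Definition im (z : C) : R := complex.Im z.

Lemma ReD (x y : C) : re (x + y) = re x + re y.
Proof. by case: x y => [? ?] [? ?]. Qed.

Lemma ReN (x : C) : re (- x) = - re x.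
Proof. by case: x. Qed.

Lemma Re_sum (I : Type) (r : seq I) (P : pred I) (F : I -> C) :
  re (\sum_(i <- r | P i) F i) = \sum_(i <- r | P i) re (F i).
Proof. exact: (big_morph _ ReD (erefl : re (0 : C) = 0)). Qed.

Lemma ReZl (a : R) (x : C) : re (a%:C * x) = a * re x.
Proof. by case: x => b c /=; rewrite mul0r subr0. Qed.

Lemma Re_conjM (x y : C) :
  re (x^* * y) =
    re x * re y + im x * im y.
Proof. by case: x y => [a b] [c d] /=; rewrite mulNr opprK. Qed.

(** A slice equal to its own conjugate must get an SVD with the same property; reality is therefore
    carried through the whole construction of SVDs. *)
Definition realmat m n (A : 'M[C]_(m, n)) := map_mx Num.conj A = A.

Lemma adjM m n p (A : 'M[C]_(m, n)) (B : 'M[C]_(n, p)) :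
  (A *m B)^t* = B^t* *m A^t*.
Proof. by rewrite trmx_mul map_mxM. Qed.

Lemma adjK m n (A : 'M[C]_(m, n)) : A^t*^t* = A.
Proof. exact: trmxCK. Qed.

Lemma adjB m n (A B : 'M[C]_(m, n)) : (A - B)^t* = A^t* - B^t*.
Proof. by rewrite linearB /= map_mxB. Qed.

Lemma adjZ m n (a : C) (A : 'M[C]_(m, n)) : (a *: A)^t* = Num.conj a *: A^t*.
Proof. by rewrite linearZ /= map_mxZ. Qed.

Lemma adj1 n : (1%:M : 'M[C]_n)^t* = 1%:M.
Proof. by rewrite trmx1 map_mx1. Qed.

Lemma map_conjK m n (A : 'M[C]_(m, n)) : map_mx Num.conj (map_mx Num.conj A) = A.
Proof. by apply/matrixP => i j; rewrite !mxE conjCK. Qed.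

Lemma adj_conj m n (A : 'M[C]_(m, n)) :
  (map_mx Num.conj A)^t* = map_mx Num.conj (A^t*).
Proof. by apply/matrixP => i j; rewrite !mxE. Qed.

Lemma realmat_adj m n (A : 'M[C]_(m, n)) : realmat A -> realmat (A^t*).
Proof. by move=> rA; rewrite /realmat -adj_conj rA. Qed.

Lemma realmatM m n p (A : 'M[C]_(m, n)) (B : 'M[C]_(n, p)) :
  realmat A -> realmat B -> realmat (A *m B).
Proof. by move=> rA rB; rewrite /realmat map_mxM rA rB. Qed.

Definition cdot m n (A B : 'M[C]_(m, n)) : R := re (\tr (A^t* *m B)).

Definition fsq m n (A : 'M[C]_(m, n)) : R := cdot A A.

Section Cdot.
Variables m n : nat.
Implicit Types A B D : 'M[C]_(m, n).

Lemma cdotE A B : cdot A B = \sum_i \sum_j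
  (re (A i j) * re (B i j) + im (A i j) * im (B i j)).
Proof.
rewrite /cdot /mxtrace Re_sum exchange_big /=; apply: eq_bigr => j _.
rewrite !mxE Re_sum; apply: eq_bigr => i _; rewrite !mxE; exact: Re_conjM.
Qed.

Lemma cdotC A B : cdot A B = cdot B A.
Proof.
by rewrite !cdotE; do 2!apply: eq_bigr => ? _; congr (_ + _); rewrite mulrC.
Qed.

Lemma cdotDr A B D : cdot A (B + D) = cdot A B + cdot A D.
Proof. by rewrite /cdot mulmxDr mxtraceD ReD. Qed.

Lemma cdotDl A B D : cdot (A + B) D = cdot A D + cdot B D.
Proof. by rewrite cdotC cdotDr !(cdotC D). Qed.

Lemma cdotNr A B : cdot A (- B) = - cdot A B.
Proof. by rewrite /cdot mulmxN linearN ReN. Qed.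

Lemma cdotNl A B : cdot (- A) B = - cdot A B.
Proof. by rewrite cdotC cdotNr cdotC. Qed.

Lemma cdot0l A : cdot 0 A = 0.
Proof. by rewrite /cdot trmx0 map_mx0 mul0mx linear0. Qed.

Lemma cdotZr (a : R) A B : cdot A (a%:C *: B) = a * cdot A B.
Proof. by rewrite /cdot -scalemxAr linearZ /= ReZl. Qed.

Lemma cdotZl (a : R) A B : cdot (a%:C *: A) B = a * cdot A B.
Proof. by rewrite cdotC cdotZr cdotC. Qed.

Lemma cdot_sumr (I : finType) (P : pred I) A (F : I -> 'M[C]_(m, n)) :
  cdot A (\sum_(i | P i) F i) = \sum_(i | P i) cdot A (F i).
Proof. by rewrite /cdot mulmx_sumr linear_sum Re_sum. Qed.

Lemma fsq_ge0 A : 0 <= fsq A.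
Proof.
rewrite /fsq cdotE; do 2!apply: sumr_ge0 => ? _.
by rewrite addr_ge0 // -expr2 sqr_ge0.
Qed.

Lemma fsq_eq0 A : fsq A = 0 -> A = 0.
Proof.
move=> A0; apply/matrixP => i j; rewrite mxE.
move: A0; rewrite /fsq cdotE => /eqP; rewrite psumr_eq0; last first.
  by move=> k _; apply: sumr_ge0 => l _; rewrite addr_ge0 // -expr2 sqr_ge0.
move=> /allP /(_ i (mem_index_enum i)) /=; rewrite psumr_eq0; last first.
  by move=> l _; rewrite addr_ge0 // -expr2 sqr_ge0.
move=> /allP /(_ j (mem_index_enum j)) /=.
rewrite -!expr2 paddr_eq0 ?sqr_ge0 // !sqrf_eq0 => /andP[/eqP r0 /eqP i0].
by move: r0 i0; case: (A i j) => a b /= -> ->.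
Qed.

Lemma fsqN A : fsq (- A) = fsq A.
Proof. by rewrite /fsq cdotNl cdotNr opprK. Qed.

Lemma fsqZ (a : R) A : fsq (a%:C *: A) = a ^+ 2 * fsq A.
Proof. by rewrite /fsq cdotZl cdotZr mulrA. Qed.

Lemma fsqD A B : fsq (A + B) = fsq A + 2 * cdot A B + fsq B.
Proof. by rewrite /fsq cdotDl !cdotDr (cdotC B A); ring. Qed.

(** Expansion of 0 <= |t A - B|^2. With a weight common to all slices, this form can be summed over
    slices before the weight is chosen. *)
Lemma cdot_amgm (t : R) A B : 0 < t -> cdot A B <= t / 2 * fsq A + (2 * t)^-1 * fsq B.
Proof.
move=> t0; have := fsq_ge0 (t%:C *: A - B).
rewrite fsqD fsqZ fsqN cdotNr cdotZl => h.
rewrite -subr_ge0; have -> : t / 2 * fsq A + (2 * t)^-1 * fsq B - cdot A B =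
  (2 * t)^-1 * (t ^+ 2 * fsq A + 2 * - (t * cdot A B) + fsq B).
  by field; rewrite gt_eqF.
by rewrite mulr_ge0 // invr_ge0 mulr_ge0 // ltW.
Qed.

End Cdot.

Lemma fsqE m n (A : 'M[C]_(m, n)) : \tr (A^t* *m A) = (fsq A)%:C.
Proof.
rewrite /fsq cdotE exchange_big rmorph_sum; apply: eq_bigr => j _.
rewrite !mxE rmorph_sum; apply: eq_bigr => i _; rewrite !mxE.
case: (A i j) => a b; apply/eqP; rewrite eq_complex /=.
by rewrite !mulNr opprK [b * a]mulrC subrr !eqxx.
Qed.

Lemma cdotMl m n p (A : 'M[C]_(m, n)) (B : 'M[C]_(n, p)) D :
  cdot (A *m B) D = cdot B (A^t* *m D).
Proof. by rewrite /cdot adjM mulmxA. Qed.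

Lemma cdotMr m n p (A : 'M[C]_(m, n)) (B : 'M[C]_(n, p)) D :
  cdot (A *m B) D = cdot A (D *m B^t*).
Proof. by rewrite /cdot adjM -mulmxA mxtrace_mulC mulmxA. Qed.

Lemma fsq_isoml m n p (A : 'M[C]_(m, n)) (B : 'M[C]_(n, p)) :
  A^t* *m A = 1%:M -> fsq (A *m B) = fsq B.
Proof. by move=> AA; rewrite /fsq cdotMl mulmxA AA mul1mx. Qed.

Lemma fsq_adj m n (A : 'M[C]_(m, n)) : fsq (A^t*) = fsq A.
Proof. by rewrite /fsq /cdot adjK mxtrace_mulC. Qed.

Lemma fsq_contract m n p (A : 'M[C]_(n, m)) (B : 'M[C]_(n, p)) :
  A^t* *m A = 1%:M -> fsq (A^t* *m B) <= fsq B.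
Proof.
move=> AA; have := fsq_ge0 (B - A *m (A^t* *m B)).
rewrite fsqD fsqN fsq_isoml // cdotNr cdotC cdotMl -/(fsq _) => h.
by lra.
Qed.

Lemma fsq_contractr m n p (A : 'M[C]_(n, m)) (B : 'M[C]_(p, n)) :
  A^t* *m A = 1%:M -> fsq (B *m A) <= fsq B.
Proof. by move=> AA; rewrite -fsq_adj adjM -(fsq_adj B) fsq_contract. Qed.

Lemma fsq_col m n (A : 'M[C]_(m, n)) : fsq A = \sum_j fsq (col j A).
Proof.
rewrite /fsq cdotE exchange_big /=; apply: eq_bigr => j _; rewrite cdotE.
by apply: eq_bigr => i _; rewrite big_ord1 !mxE.
Qed.

End ComplexMatrices.

(** * Singular value decomposition *)

Section SingularValueDecomposition.
Variable R : rcfType.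
Local Notation C := R[i].
Local Open Scope complex_scope.

Definition rdiag k (d : 'rV[R]_k) : 'M[C]_k := diag_mx (map_mx (real_complex R) d).

Lemma rdiag_adj k (d : 'rV[R]_k) : (rdiag d)^t* = rdiag d.
Proof.
apply/matrixP => i j; rewrite !mxE eq_sym.
by case: eqP => [->|_]; rewrite ?mulr1n ?mulr0n ?rmorph0 //; exact: conjc_real.
Qed.

Lemma rdiag_conj k (d : 'rV[R]_k) : map_mx Num.conj (rdiag d) = rdiag d.
Proof.
apply/matrixP => i j; rewrite !mxE.
by case: eqP => _; rewrite ?mulr1n ?mulr0n ?rmorph0 //; exact: conjc_real.
Qed.

Lemma conjC_real (x : R) : Num.conj (x%:C : C) = x%:C.
Proof. exact: conjc_real. Qed.

Lemma col_normE n (u : 'cV[C]_n) : u^t* *m u = (fsq u)%:C%:M.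
Proof. by rewrite [LHS]mx11_scalar -trace_mx11 fsqE. Qed.

Lemma fsq_delta n : fsq (delta_mx 0 0 : 'cV[C]_n.+1) = 1.
Proof.
suff: (fsq (delta_mx 0 0 : 'cV[C]_n.+1))%:C = 1 :> C by case.
rewrite -fsqE trmx_delta map_delta_mx mul_delta_mx trace_mx11 !mxE !eqxx.
by [].
Qed.

Lemma cdot_delta n (v : 'cV[C]_n.+1) : cdot (delta_mx 0 0) v = re (v 0 0).
Proof.
by rewrite /cdot trmx_delta map_delta_mx -rowE trace_mx11 !mxE.
Qed.

(* The reflection-like map [1 - w w^H / (w^H v)], with [w = v - e], avoids the
   choice of a phase and stays real when [v] is. *)
Lemma householder n (v : 'cV[C]_n.+1) : fsq v = 1 ->
  exists Q : 'M[C]_n.+1,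
    [/\ Q^t* *m Q = 1%:M, Q *m v = delta_mx 0 0 & realmat v -> realmat Q].
Proof.
move=> v1; set e := delta_mx 0 0; have [->|ve] := eqVneq v e.
  exists 1%:M; rewrite mul1mx trmx1 map_mx1 mulmx1; split=> // _.
  by rewrite /realmat map_mx1.
set w := v - e; set h := (w^t* *m v) 0 0.
have wv : w^t* *m v = h%:M by rewrite -mx11_scalar.
have hE : h = 1 - v 0 0.
  rewrite /h {1}/w adjB mulmxBl col_normE v1 trmx_delta map_delta_mx.
  by rewrite -rowE !mxE.
(* The identity |w|^2 = 2 Re h is what makes the map unitary; it also shows that h = 0 would force w
   = 0. *)
have fw : (fsq w)%:C = h + Num.conj h.
  rewrite /w fsqD fsqN v1 fsq_delta cdotNr cdotC cdot_delta hE.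
  case: (v 0 0) => a b; apply/eqP; rewrite eq_complex /=; apply/andP; split.
    by apply/eqP; rewrite /re /=; lra.
  by apply/eqP; lra.
have h0 : h != 0.
  apply: contraNneq ve => h0; rewrite -subr_eq0; apply/eqP/fsq_eq0.
  by move: fw; rewrite h0 rmorph0 addr0; case.
exists (1%:M - h^-1 *: (w *m w^t*)); split.
- rewrite adjB adjZ adj1 adjM adjK.
  rewrite mulmxBl mul1mx mulmxBr mulmx1 -scalemxAl -scalemxAr scalerA.
  rewrite mulmxA -(mulmxA w) col_normE fw mul_mx_scalar -scalemxAl scalerA.
  rewrite -scalerBl -addrA -opprD -scalerDl.
  rewrite -[RHS]subr0; congr (_ - _); apply/eqP; rewrite scaler_eq0.
  apply/orP; left; apply/eqP; rewrite fmorphV.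
  have hc0 : Num.conj h != 0 by rewrite fmorph_eq0.
  by field; rewrite h0 hc0.
- rewrite mulmxBl mul1mx -scalemxAl -mulmxA wv mul_mx_scalar scalerA mulVf //.
  by rewrite scale1r /w opprB addrC subrK.
- move=> rv; have rw : realmat w.
    by rewrite /realmat map_mxB rv map_delta_mx.
  have hh : Num.conj h = h.
    by have /matrixP/(_ 0 0) := realmatM (realmat_adj rw) rv; rewrite mxE.
  rewrite /realmat map_mxB map_mx1 map_mxZ fmorphV /= hh.
  by rewrite (realmatM rw (realmat_adj rw)).
Qed.

(** Gives access to the spectral theorem, through which the singular values are defined. *)
Lemma gram_normal m n (A : 'M[C]_(m, n)) : A^t* *m A \is normalmx.
Proof. by apply/normalmxP; rewrite adjM adjK. Qed.

Lemma gram_eigen m n (A : 'M[C]_(m, n)) (x : 'cV[C]_n) (l : C) :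
  A^t* *m A *m x = l *: x -> x != 0 -> l = (fsq (A *m x) / fsq x)%:C.
Proof.
move=> Hx x0; have : x^t* *m (A^t* *m A *m x) = x^t* *m (l *: x) by rewrite Hx.
rewrite -scalemxAr col_normE !mulmxA -adjM -mulmxA col_normE.
move=> /matrixP/(_ 0 0); rewrite !mxE eqxx !mulr1n => lE.
have fx0 : fsq x != 0 by apply: contra_neq x0; apply: fsq_eq0.
by rewrite rmorphM fmorphV /= lE mulfK // fmorph_eq0.
Qed.

(** If all eigenvalues vanished, A^H A and so [A] would be 0. For real [A] the conjugate of an
    eigenvector is again one, so x + conj x is a real eigenvector, or i x when that sum vanishes. *)
Lemma gram_eigen_exists m n (A : 'M[C]_(m, n)) : A != 0 ->
  exists (x : 'cV[C]_n) (l : R),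
    [/\ x != 0, 0 < l, A^t* *m A *m x = l%:C *: x & realmat A -> realmat x].
Proof.
move=> A0.
have [x [l [x0 l0 Hx]]] : exists (x : 'cV[C]_n) (l : R),
    [/\ x != 0, l != 0 & A^t* *m A *m x = l%:C *: x].
  set H := A^t* *m A; have /orthomx_spectralP := gram_normal A; rewrite -/H.
  set P := spectralmx H; set sp := spectral_diag H => HE.
  have Pu : P \in unitmx by apply: spectral_unit.
  have [sp0|] := eqVneq sp 0.
    suff : A = 0 by move/eqP; rewrite (negPf A0).
    apply: fsq_eq0; suff: (fsq A)%:C = 0 :> C by case.
    by rewrite -fsqE -/H HE sp0 [diag_mx 0]raddf0 mulmx0 mul0mx raddf0.
  move=> /rV0Pn[j spj].
  have Hj : H *m (row j P)^t* = Num.conj (sp 0 j) *: (row j P)^t*.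
    have HH : H^t* = H by rewrite /H adjM adjK.
    rewrite -[H in LHS]HH -adjM -adjZ; congr (_ ^t*).
    rewrite {1}HE !mulmxA -row_mul mulmxV // row1 -rowE row_diag_mx.
    by rewrite -scalemxAl -rowE.
  have x0 : (row j P)^t* != 0.
    rewrite map_mx_eq0 trmx_eq0; apply/eqP => r0.
    have /row_freeP[D PD] : row_free P by rewrite row_free_unit.
    have /rowP/(_ j) : row j (P *m D) = 0 by rewrite row_mul r0 mul0mx.
    by rewrite PD !mxE eqxx => /eqP; rewrite oner_eq0.
  exists ((row j P)^t*).
  have lE := gram_eigen Hj x0.
  exists (fsq (A *m (row j P)^t*) / fsq ((row j P)^t*)); split=> //.
    apply: contraNneq spj => l0; move: lE; rewrite l0 => /eqP.
    by rewrite fmorph_eq0.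
  by rewrite -lE.
have lp (y : 'cV[C]_n) : y != 0 -> A^t* *m A *m y = l%:C *: y -> 0 < l.
  move=> y0 Hy; have [] := gram_eigen Hy y0 => lE.
  by rewrite lt_neqAle eq_sym l0 lE divr_ge0 ?fsq_ge0.
have {}lp := lp _ x0 Hx.
have [rA|nrA] := eqVneq (map_mx Num.conj A) A; last first.
  by exists x, l; split=> // rA; rewrite rA eqxx in nrA.
have Hcx : A^t* *m A *m map_mx Num.conj x = l%:C *: map_mx Num.conj x.
  have := congr1 (map_mx Num.conj) Hx.
  by rewrite !map_mxM map_mxZ -adj_conj rA /= conjC_real.
have [xx|xx] := eqVneq (x + map_mx Num.conj x) 0; last first.
  exists (x + map_mx Num.conj x), l; split=> //.
    by rewrite mulmxDr Hx Hcx scalerDr.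
  by move=> _; rewrite /realmat map_mxD map_conjK addrC.
have xN : map_mx Num.conj x = - x by apply/eqP; rewrite -addr_eq0 addrC xx.
exists ('i *: x), l; split=> //.
- by rewrite scaler_eq0 negb_or x0 andbT eq_complex /= oner_eq0 andbF.
- by rewrite -scalemxAr Hx !scalerA mulrC.
- move=> _; rewrite /realmat map_mxZ xN scalerN -scaleNr.
  by congr (_ *: _); apply/eqP; rewrite eq_complex /= opprK oppr0 !eqxx.
Qed.

(** Any positive eigenvalue of A^H A serves; maximality is not asked, since a permutation sorts the
    singular values afterwards. *)
Lemma singular_triple m n (A : 'M[C]_(m.+1, n.+1)) :
  exists (u : 'cV[C]_m.+1) (v : 'cV[C]_n.+1) (s : R),
    [/\ 0 <= s, fsq u = 1 /\ fsq v = 1, A *m v = s%:C *: u,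
        A^t* *m u = s%:C *: v & realmat A -> realmat u /\ realmat v].
Proof.
have [->|A0] := eqVneq A 0.
  exists (delta_mx 0 0), (delta_mx 0 0), 0; rewrite !fsq_delta !scale0r.
  rewrite trmx0 map_mx0 !mul0mx; split=> // _.
  by rewrite /realmat !map_delta_mx.
have [x [l [x0 l0 Hx rx]]] := gram_eigen_exists A0.
have fx : 0 < fsq x.
  by rewrite lt_neqAle fsq_ge0 andbT eq_sym; apply: contra_neq x0; apply: fsq_eq0.
set c := (Num.sqrt (fsq x))^-1; set v := c%:C *: x; set s := Num.sqrt l.
have c2 : c ^+ 2 = (fsq x)^-1 by rewrite exprVn sqr_sqrtr // ltW.
have s2 : s ^+ 2 = l by rewrite sqr_sqrtr // ltW.
have s0 : 0 < s by rewrite sqrtr_gt0.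
have v1 : fsq v = 1 by rewrite fsqZ c2 mulVf // gt_eqF.
have Hv : A^t* *m A *m v = l%:C *: v by rewrite -scalemxAr Hx !scalerA mulrC.
exists (s^-1%:C *: (A *m v)), v, s; split.
- exact: ltW.
- split=> //; rewrite fsqZ /fsq cdotMl mulmxA Hv cdotZr -/(fsq v) v1 mulr1.
  by rewrite exprVn s2 mulVf // gt_eqF.
- by rewrite scalerA -rmorphM /= divff ?scale1r // gt_eqF.
- rewrite -scalemxAr mulmxA Hv scalerA -rmorphM /= -s2.
  by congr (_%:C *: _); field; rewrite gt_eqF.
- move=> rA; have rv : realmat v.
    by rewrite /realmat map_mxZ rx //= conjC_real.
  by split=> //; rewrite /realmat map_mxZ realmatM //= conjC_real.
Qed.

End SingularValueDecomposition.

(** * Existence of the decomposition by deflation, and kernels of wide matrices *)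

Section SvdExistence.
Variable R : rcfType.
Local Notation C := R[i].
Local Open Scope complex_scope.

Lemma adj_block1 p k (U : 'M[C]_(p, k)) :
  (block_mx (1%:M : 'M[_]_1) 0 0 U)^t* = block_mx 1%:M 0 0 (U^t*).
Proof. by rewrite tr_block_mx map_block_mx !trmx0 !map_mx0 trmx1 map_mx1. Qed.

Lemma block1_isometry p k (U : 'M[C]_(p, k)) : U^t* *m U = 1%:M ->
  (block_mx (1%:M : 'M[_]_1) 0 0 U)^t* *m block_mx (1%:M : 'M[_]_1) 0 0 U = 1%:M.
Proof.
move=> UU; rewrite adj_block1 mulmx_block.
by rewrite !(mulmx0, mul0mx, addr0, add0r, mul1mx) UU -scalar_mx_block.
Qed.

Lemma rdiag_row1 k (s : R) (d : 'rV[R]_k) :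
  rdiag (row_mx (s%:M : 'rV_1) d) = block_mx s%:C%:M 0 0 (rdiag d).
Proof.
rewrite /rdiag map_row_mx diag_mx_row; congr block_mx.
by apply/matrixP => i j; rewrite !mxE !ord1 eqxx !mulr1n.
Qed.

Lemma row1_ge0 k (s : R) (d : 'rV[R]_k) : 0 <= s -> (forall i, 0 <= d 0 i) ->
  forall i, 0 <= row_mx (s%:M : 'rV_1) d 0 i.
Proof.
move=> s0 d0 i; rewrite -(splitK i); case: (fintype.split i) => j /=.
  by rewrite row_mxEl mxE ord1 eqxx.
by rewrite row_mxEr.
Qed.

Lemma block1_svd m n k (U : 'M[C]_(m, k)) (W : 'M[C]_(n, k)) (D : 'M[C]_k) (a : C) :
  block_mx (a%:M : 'M[_]_1) 0 0 (U *m D *m W^t*) =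
  block_mx (1%:M : 'M[_]_1) 0 0 U *m block_mx a%:M 0 0 D
    *m (block_mx (1%:M : 'M[_]_1) 0 0 W)^t*.
Proof.
rewrite adj_block1 !mulmx_block.
by rewrite !(mulmx0, mul0mx, addr0, add0r, mul1mx, mulmx1).
Qed.

(** Deflation: unitary maps send [u] and [v] to the first axes. Since A v = s u and A^H u = s v, the
    transformed matrix is [s] followed by a smaller block, to which the induction applies. Both maps
    are real when [A] is. *)
Lemma svd_diag_exists k m n (A : 'M[C]_(m, n)) : k = minn m n ->
  exists (U : 'M[C]_(m, k)) (W : 'M[C]_(n, k)) (d : 'rV[R]_k),
    [/\ U^t* *m U = 1%:M, W^t* *m W = 1%:M, forall i, 0 <= d 0 i,
        A = U *m rdiag d *m W^t* & realmat A -> realmat U /\ realmat W].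
Proof.
elim: k m n A => [|k IH] [|m] [|n] A kE; rewrite ?min0n ?minn0 // in kE;
  try (exists 0, 0, 0; split; [by apply/matrixP => - [] | by apply/matrixP => - [] |
    by case | by apply/matrixP => - [] // ? ? [] |
    by split; apply/matrixP => ? [] ]).
- by move: kE; rewrite minnSS.
move: kE; rewrite minnSS => - [kE].
have [u [v [s [s0 [u1 v1] Av Au rA]]]] := singular_triple A.
have [Qu [QuU Que rQu]] := householder u1.
have [Qv [QvU Qve rQv]] := householder v1.
have QuU' := mulmx1C QuU; have QvU' := mulmx1C QvU.
set e := delta_mx 0 0 in Que; set e' := delta_mx 0 0 in Qve.
have [B DB] : exists B : 'M[C]_(1 + m, 1 + n), B = Qu *m A *m Qv^t*
  by exists (Qu *m A *m Qv^t*).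
have ve : Qv^t* *m e' = v by rewrite -Qve mulmxA QvU mul1mx.
have ue : Qu^t* *m e = u by rewrite -Que mulmxA QuU mul1mx.
have Be : (Qu *m A *m Qv^t*) *m e' = s%:C *: e.
  by rewrite -mulmxA ve -mulmxA Av -scalemxAr Que.
have Be' : (Qu *m A *m Qv^t*)^t* *m e = s%:C *: e'.
  by rewrite !adjM adjK -mulmxA -mulmxA ue Au -scalemxAr Qve.
have B0 i : B i 0 = s%:C * (i == 0)%:R.
  by have /matrixP/(_ i 0) := Be; rewrite -DB -colE !mxE eqxx andbT.
have B0' j : B 0 j = s%:C * (j == 0)%:R.
  have /matrixP/(_ j 0) := Be'; rewrite -DB -colE !mxE eqxx andbT => h.
  by rewrite -[LHS]conjCK h rmorphM /= conjC_real rmorph_nat.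
have lsh0 p : lshift p 0 = 0 :> 'I_(1 + p) by exact: val_inj.
have BE : B = block_mx s%:C%:M 0 0 (drsubmx B).
  rewrite -[LHS]submxK; congr block_mx; apply/matrixP => i j; rewrite !mxE.
  - by rewrite !ord1 !lsh0 B0 mulr1.
  - by rewrite !ord1 !lsh0 B0' mulr0.
  - by rewrite !ord1 !lsh0 B0 mulr0.
have AE : A = Qu^t* *m B *m Qv.
  by rewrite DB !mulmxA QuU mul1mx -mulmxA QvU mulmx1.
have rB : realmat A -> realmat (drsubmx B).
  move=> rAA; have [ru rv] := rA rAA.
  rewrite /realmat map_drsubmx; congr drsubmx; rewrite DB.
  by apply: realmatM; [apply: realmatM => //; exact: rQu | apply: realmat_adj; exact: rQv].
have [U' [W' [d' [UU WW d0 B'E r']]]] := IH _ _ (drsubmx B) kE.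
have iso p (Q : 'M[C]_p.+1) (U0 : 'M[C]_(p, k))
    (Ub := block_mx 1%:M 0 0 U0 : 'M[_]_(1 + p, 1 + k)) :
    Q *m Q^t* = 1%:M -> U0^t* *m U0 = 1%:M ->
    (Q^t* *m Ub)^t* *m (Q^t* *m Ub) = 1%:M.
  move=> QQ UU0; rewrite adjM adjK mulmxA -(mulmxA _ Q) QQ mulmx1.
  exact: block1_isometry.
exists (Qu^t* *m (block_mx 1%:M 0 0 U' : 'M[_]_(1 + m, 1 + k))),
  (Qv^t* *m (block_mx 1%:M 0 0 W' : 'M[_]_(1 + n, 1 + k))), (row_mx s%:M d').
split; [exact: iso | exact: iso | | |].
- exact: row1_ge0.
- rewrite [LHS]AE BE B'E block1_svd adjM adjK.
  by rewrite [in RHS]rdiag_row1 !mulmxA.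
- move=> rAA; have [ru rv] := rA rAA; have [rU rW] := r' (rB rAA).
  have rblk p (U0 : 'M[C]_(p, k)) : realmat U0 -> realmat (block_mx (1%:M : 'M[_]_1) 0 0 U0).
    by move=> rU0; rewrite /realmat map_block_mx !map_mx0 map_mx1 rU0.
  split; (apply: realmatM; last exact: rblk); apply: realmat_adj.
    exact: rQu.
  exact: rQv.
Qed.

(* Both sides are determinants of [[X, M], [N, 1]], up to a block-triangular
   factor. *)
Lemma char_poly_mulC (F : comNzRingType) n k (M : 'M[F]_(n, k)) (N : 'M[F]_(k, n)) :
  char_poly (M *m N) * 'X^k = 'X^n * char_poly (N *m M).
Proof.
set M' := map_mx (@polyC F) M; set N' := map_mx (@polyC F) N.
pose B := block_mx 'X%:M M' N' 1%:M.
have dB : \det B = char_poly (M *m N).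
  have := det_mulmx B (block_mx 1%:M 0 (- N') 1%:M).
  rewrite det_lblock !det1 !mulr1 => <-.
  rewrite mulmx_block !(mulmx0, mulmx1, mul0mx, add0r, addr0, mul1mx) mulmxN.
  by rewrite subrr det_ublock det1 mulr1 /char_poly /char_poly_mx map_mxM.
have := det_mulmx B (block_mx 1%:M (- M') 0 'X%:M).
rewrite det_ublock det1 mul1r det_scalar dB => <-.
rewrite mulmx_block !(mulmx0, mulmx1, mul0mx, add0r, addr0, mul1mx) !mulmxN.
rewrite mul_mx_scalar mul_scalar_mx addNr det_lblock det_scalar addrC.
by rewrite /char_poly /char_poly_mx map_mxM.
Qed.

Lemma char_poly_rdiag k (d : 'rV[R]_k) :
  char_poly (rdiag d) = \prod_i ('X - (d 0 i)%:C%:P).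
Proof.
rewrite char_poly_trig ?diag_mx_is_trig //.
by apply: eq_bigr => i _; rewrite !mxE eqxx mulr1n.
Qed.

(** The spectrum of A^H A consists of the squares of [d] up to zeros; the powers of 'X on both sides
    account for the zeros without subtracting dimensions. *)
Lemma char_poly_gram k m n (A : 'M[C]_(m, n)) U W (d : 'rV[R]_k) :
  U^t* *m U = 1%:M -> W^t* *m W = 1%:M -> A = U *m rdiag d *m W^t* ->
  char_poly (A^t* *m A) * 'X^k = 'X^n * \prod_i ('X - (d 0 i ^+ 2)%:C%:P).
Proof.
move=> UU WW ->; rewrite !adjM adjK rdiag_adj.
rewrite !mulmxA -(mulmxA _ _ U) UU mulmx1 -!mulmxA char_poly_mulC.
rewrite -!mulmxA WW mulmx1; congr (_ * _).
rewrite (_ : _ *m _ = rdiag (\row_i d 0 i ^+ 2)).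
  by rewrite char_poly_rdiag; apply: eq_bigr => i _; rewrite mxE.
apply/matrixP => i j; rewrite mul_diag_mx !mxE.
by case: eqP => [->|_]; rewrite ?mulr0 // !mulr1n -rmorphM.
Qed.

Lemma rotate_to_axis n (a : 'cV[C]_n.+1) :
  exists (Q : 'M[C]_n.+1) (c : C), Q^t* *m Q = 1%:M /\ Q *m a = c *: delta_mx 0 0.
Proof.
have [->|a0] := eqVneq a 0.
  by exists 1%:M, 0; rewrite adj1 !mulmx1 mulmx0 scale0r.
have fa : 0 < fsq a.
  by rewrite lt_neqAle fsq_ge0 andbT eq_sym; apply: contra_neq a0; apply: fsq_eq0.
set s := Num.sqrt (fsq a); have s0 : s != 0 by rewrite gt_eqF // sqrtr_gt0.
have [|Q [QQ Qa _]] := @householder _ _ (s^-1%:C *: a).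
  by rewrite fsqZ exprVn sqr_sqrtr ?ltW // mulVf // gt_eqF.
exists Q, s%:C; split=> //; rewrite -Qa -scalemxAr scalerA -rmorphM /=.
by rewrite divff // scale1r.
Qed.

Lemma col0_isometry p k (Q : 'M[C]_(p, k)) : Q^t* *m Q = 1%:M ->
  (col_mx (0 : 'M[_]_(1, k)) Q)^t* *m col_mx (0 : 'M[_]_(1, k)) Q = 1%:M.
Proof.
move=> QQ; rewrite tr_col_mx map_row_mx mul_row_col QQ trmx0 map_mx0 mul0mx.
by rewrite add0r.
Qed.

(** Induction on the number of rows: a rotation puts the first row on the first axis, so vectors
    with zero first coordinate are killed by that row, and the remaining block has one row and one
    column less. *)
Lemma kernel_isometry f j (M : 'M[C]_(f, f + j)) :
  exists Q : 'M[C]_(f + j, j), Q^t* *m Q = 1%:M /\ M *m Q = 0.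
Proof.
elim: f M => [|f IH] M.
  by exists 1%:M; rewrite adj1 mulmx1; split=> //; apply/matrixP => - [].
have [H [c [HH Ha]]] := @rotate_to_axis (f + j) ((row 0 M)^t*).
have HH' := mulmx1C HH.
pose B : 'M[C]_(1 + f, 1 + (f + j)) := M *m H^t*.
have B0 : ursubmx B = 0.
  apply/matrixP => i l; rewrite !mxE ord1.
  have /(congr1 (fun A : 'cV[C]_(f + j).+1 => (A^t*))) := Ha.
  rewrite adjM adjK -row_mul adjZ => /matrixP /(_ 0 (rshift 1 l)).
  rewrite !mxE /= rmorph0 mulr0 => h.
  have l0 : lshift f 0 = 0 :> 'I_(1 + f) by apply: val_inj.
  by rewrite l0; exact: h.
have [Q [QQ BQ]] := IH (drsubmx B).
exists (H^t* *m (col_mx 0 Q : 'M[_]_(1 + (f + j), j))); split.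
  by rewrite adjM adjK mulmxA -(mulmxA _ H) HH' mulmx1; exact: col0_isometry.
have BQ0 : B *m (col_mx 0 Q : 'M[_]_(1 + (f + j), j)) = 0.
  rewrite -[B]submxK B0 mul_block_col BQ !mulmx0 mul0mx !addr0.
  exact: col_mx0.
by rewrite mulmxA; exact: BQ0.
Qed.

End SvdExistence.

(** * Singular values read off from any decomposition *)

Section SingularValueTheory.
Variable R : realType.
Local Notation C := R[i].
Local Open Scope complex_scope.

Lemma char_poly_spectral n (H : 'M[C]_n) : H \is normalmx ->
  char_poly H = \prod_j ('X - (spectral_diag H 0 j)%:P).
Proof.
move=> /orthomx_spectralP; set P := spectralmx H; set sp := spectral_diag H => HE.
have Pu : P \in unitmx by apply: spectral_unit.
have Xn0 : 'X^n != 0 :> {poly C} by rewrite expf_neq0 // polyX_eq0.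
apply: (mulfI Xn0); rewrite mulrC HE char_poly_mulC mulmxA mulmxV // mul1mx.
congr (_ * _); rewrite char_poly_trig ?diag_mx_is_trig //.
by apply: eq_bigr => j _; rewrite !mxE eqxx mulr1n.
Qed.

Lemma sort_cat_nseq0 (s : seq R) p : all (fun x => 0 <= x) s ->
  sort >=%R (nseq p 0 ++ s) = sort >=%R s ++ nseq p 0.
Proof.
move=> s0; apply: (@sorted_eq _ >=%R).
- exact: ge_trans.
- exact: ge_anti.
- by apply: sort_sorted; exact: ge_total.
- rewrite (@sorted_pairwise _ >=%R); last exact: ge_trans.
  rewrite pairwise_cat; apply/and3P; split.
  + apply/allrelP => x y xs /nseqP[-> _].
    by move: xs; rewrite mem_sort => /(allP s0).
  + rewrite -sorted_pairwise; last exact: ge_trans.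
    by apply: sort_sorted; exact: ge_total.
  + by elim: p => //= p ->; rewrite all_nseq /= lexx orbT.
- by rewrite perm_sort perm_catC perm_cat2r perm_sym perm_sort.
Qed.

(** Unique factorization of the characteristic polynomial of A^H A identifies the multisets of
    roots. After square roots and sorting, the n - k surplus zeros come last, where [take] drops
    them. The diagonal [d] may be in any order. *)
Lemma singular_valuesE k m n (A : 'M[C]_(m, n)) U W (d : 'rV[R]_k) :
  k = minn m n -> U^t* *m U = 1%:M -> W^t* *m W = 1%:M -> (forall i, 0 <= d 0 i) ->
  A = U *m rdiag d *m W^t* ->
  singular_values A = sort >=%R [seq d 0 i | i : 'I_k].
Proof.
move=> kE UU WW d0 AE.
have kn : (k <= n)%N by rewrite kE geq_minr.
pose sp := spectral_diag (A^t* *m A).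
have : \prod_(x <- [seq sp 0 j | j : 'I_n] ++ nseq k 0) ('X - x%:P) =
       \prod_(x <- nseq n 0 ++ [seq (d 0 i ^+ 2)%:C | i : 'I_k]) ('X - x%:P).
  rewrite !big_cat /= !big_image /=.
  have X0 p : \prod_(j <- nseq p 0) ('X - j%:P) = 'X^p :> {poly C}.
    by rewrite big_nseq subr0 iter_mulr_1.
  by rewrite !X0 -char_poly_spectral ?gram_normal // (char_poly_gram UU WW AE).
move/prod_XsubC_eq/(perm_map (fun z : C => Num.sqrt (complex.Re z))).
rewrite !map_cat !map_nseq /= sqrtr0.
have mapE (T : Type) (u : 'I_n -> T) (h : T -> R) :
  [seq h x | x <- [seq u j | j : 'I_n]] = [seq h (u j) | j : 'I_n].
  by rewrite /image_mem -[LHS]map_comp.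
have -> : [seq Num.sqrt (complex.Re x) | x <- [seq (d 0 i ^+ 2)%:C | i : 'I_k]] =
    [seq d 0 i | i : 'I_k].
  rewrite /image_mem -[LHS]map_comp; apply: eq_map => i /=.
  by rewrite sqrtr_sqr ger0_norm.
rewrite mapE.
have nE : nseq n (0 : R) = nseq k 0 ++ nseq (n - k) 0 by rewrite -nseqD subnKC.
rewrite nE -catA perm_catC perm_cat2l => pS.
rewrite /singular_values -kE.
have dall : all (fun x => 0 <= x) [seq d 0 i | i : 'I_k].
  by apply/allP => _ /mapP[i _ ->].
have -> : sort >=%R [seq Num.sqrt (complex.Re (sp 0 j)) | j : 'I_n] =
    sort >=%R [seq d 0 i | i : 'I_k] ++ nseq (n - k) 0.
  apply: etrans (sort_cat_nseq0 (n - k) dall).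
  apply/perm_sortP; [exact: ge_total | exact: ge_trans | exact: ge_anti |].
  exact: pS.
by rewrite take_size_cat // size_sort size_map size_enum_ord.
Qed.

Definition svrow m n (A : 'M[C]_(m, n)) : 'rV[R]_(minn m n) :=
  \row_i sigma A i.+1.

Lemma rdiag_svrow m n (A : 'M[C]_(m, n)) :
  rdiag (svrow A) = diag_mx (\row_(i < minn m n) (sigma A i.+1)%:C).
Proof. by congr diag_mx; apply/rowP => i; rewrite !mxE. Qed.

Lemma is_svdP m n (A : 'M[C]_(m, n)) (U : 'M[C]_(m, minn m n)) W :
  is_svd A U W <->
  [/\ U^t* *m U = 1%:M, W^t* *m W = 1%:M & A = U *m rdiag (svrow A) *m W^t*].
Proof. by rewrite /is_svd rdiag_svrow. Qed.

Lemma svd_exists m n (A : 'M[C]_(m, n)) :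
  exists (U : 'M[C]_(m, minn m n)) (W : 'M[C]_(n, minn m n)),
    is_svd A U W /\ (realmat A -> realmat U /\ realmat W).
Proof.
have [U [W [d [UU WW d0 AE rA]]]] := svd_diag_exists A erefl.
have svE := singular_valuesE erefl UU WW d0 AE.
set k := minn m n in U W d UU WW d0 AE rA svE *.
pose t := [tuple d 0 i | i < k].
have : perm_eq (sort >=%R t) t by rewrite perm_sort.
move=> /tuple_permP[p pE].
have sE (i : 'I_k) : sigma A i.+1 = d 0 (p i).
  rewrite /sigma svE /= -[in LHS]/k (_ : [seq d 0 i | i : 'I_k] = t :> seq R); last exact: erefl.
  by rewrite pE /= (nth_map i) ?size_enum_ord // nth_ord_enum tnth_mktuple.
exists (\matrix_(i, j) U i (p j)), (\matrix_(i, j) W i (p j)); split; last first.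
  move=> /rA[rU rW]; split; apply/matrixP => i j; rewrite !mxE.
    by move/matrixP: rU => /(_ i (p j)); rewrite mxE.
  by move/matrixP: rW => /(_ i (p j)); rewrite mxE.
have iso q (V : 'M[C]_(q, k)) : V^t* *m V = 1%:M ->
    (\matrix_(i, j) V i (p j))^t* *m (\matrix_(i, j) V i (p j)) = 1%:M.
  move=> /matrixP VV; apply/matrixP => i j.
  have := VV (p i) (p j); rewrite !mxE (inj_eq perm_inj) => <-.
  by apply: eq_bigr => l _; rewrite !mxE.
apply/is_svdP; split; [exact: iso | exact: iso |].
rewrite [LHS]AE; apply/matrixP => i j; rewrite !mxE.
rewrite (reindex_inj (@perm_inj _ p)); apply: eq_bigr => l _.
by rewrite /rdiag !mul_mx_diag !mxE sE.
Qed.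

Section OneMatrix.
Variables (m n : nat) (A : 'M[C]_(m, n)).
Local Notation k := (minn m n).

Lemma size_singular_values : size (singular_values A) = k.
Proof.
rewrite /singular_values size_take size_sort size_map size_enum_ord.
by case: ltnP => // h; apply/eqP; rewrite eqn_leq h geq_minr.
Qed.

Lemma sigma_ge0 i : 0 <= sigma A i.
Proof.
rewrite /sigma; have [h|h] := ltnP i.-1 (size (singular_values A)); last first.
  by rewrite nth_default.
have : nth 0 (singular_values A) i.-1 \in singular_values A by rewrite mem_nth.
by move=> /mem_take; rewrite mem_sort => /mapP[j _ ->]; exact: sqrtr_ge0.
Qed.

Lemma sigma_le i j : (i <= j)%N -> sigma A j <= sigma A i.
Proof.
move=> ij; rewrite /sigma.
have [h|h] := ltnP j.-1 (size (singular_values A)); last first.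
  by rewrite (nth_default _ h) sigma_ge0.
have : sorted >=%R (singular_values A).
  by apply: take_sorted; apply: sort_sorted; exact: ge_total.
move=> sA; have ij1 : (i.-1 <= j.-1)%N by rewrite -!subn1 leq_sub2r.
have hi : (i.-1 < size (singular_values A))%N by apply: leq_ltn_trans h.
by apply: (sorted_leq_nth (@ge_trans _ R) (@lexx _ R) 0 sA); rewrite ?inE.
Qed.

Lemma singular_valuesE_sigma : singular_values A = [seq sigma A i.+1 | i : 'I_k].
Proof.
apply: (@eq_from_nth _ 0); first by rewrite size_map size_enum_ord size_singular_values.
rewrite size_singular_values => i ik.
rewrite (nth_map (Ordinal ik)) ?size_enum_ord // /sigma /=.
by rewrite (nth_enum_ord (Ordinal ik) ik).
Qed.

Lemma nuclear_normE : nuclear_norm A = \sum_(i < k) sigma A i.+1.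
Proof. by rewrite /nuclear_norm singular_valuesE_sigma big_image. Qed.

Lemma nuclear_norm_ge0 : 0 <= nuclear_norm A.
Proof. by rewrite nuclear_normE; apply: sumr_ge0 => i _; exact: sigma_ge0. Qed.

End OneMatrix.

Lemma perm_singular_values k m n (A : 'M[C]_(m, n)) U W (d : 'rV[R]_k) :
  k = minn m n -> U^t* *m U = 1%:M -> W^t* *m W = 1%:M -> (forall i, 0 <= d 0 i) ->
  A = U *m rdiag d *m W^t* ->
  perm_eq (singular_values A) [seq d 0 i | i : 'I_k].
Proof.
by move=> kE UU WW d0 AE; rewrite (singular_valuesE kE UU WW d0 AE) perm_sort.
Qed.

Lemma nuclear_norm_diag k m n (A : 'M[C]_(m, n)) U W (d : 'rV[R]_k) :
  k = minn m n -> U^t* *m U = 1%:M -> W^t* *m W = 1%:M -> (forall i, 0 <= d 0 i) ->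
  A = U *m rdiag d *m W^t* -> nuclear_norm A = \sum_i d 0 i.
Proof.
move=> kE UU WW d0 AE.
rewrite /nuclear_norm (perm_big _ (perm_singular_values kE UU WW d0 AE)) /=.
by rewrite big_image.
Qed.

Lemma sigma_conj m n (A : 'M[C]_(m, n)) i : sigma (map_mx Num.conj A) i = sigma A i.
Proof.
have [U [W [/is_svdP[UU WW AE] _]]] := svd_exists A.
rewrite /sigma; congr nth.
have iso q (V : 'M[C]_(q, minn m n)) : V^t* *m V = 1%:M ->
    (map_mx Num.conj V)^t* *m map_mx Num.conj V = 1%:M.
  by move=> VV; rewrite adj_conj -map_mxM VV map_mx1.
have sv0 j : 0 <= svrow A 0 j by rewrite mxE sigma_ge0.
rewrite (singular_valuesE erefl UU WW sv0 AE).
apply: (singular_valuesE erefl (iso _ _ UU) (iso _ _ WW) sv0).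
by rewrite {1}AE !map_mxM rdiag_conj adj_conj.
Qed.

(* Conjugate matrices get conjugate decompositions: decompose a canonical
   representative of the pair [A, conj A], choosing real factors when [A] is
   real. *)
Lemma svd_conj_choice m n :
  exists (U : 'M[C]_(m, n) -> 'M[C]_(m, minn m n)) (W : 'M[C]_(m, n) -> 'M[C]_(n, minn m n)),
    forall A, [/\ is_svd A (U A) (W A),
      U (map_mx Num.conj A) = map_mx Num.conj (U A)
      & W (map_mx Num.conj A) = map_mx Num.conj (W A)].
Proof.
have [F FP] := choice (fun A : 'M[C]_(m, n) =>
  let: ex_intro U (ex_intro W h) := svd_exists A in
  ex_intro (fun UW => is_svd A UW.1 UW.2 /\
    (realmat A -> realmat UW.1 /\ realmat UW.2)) (U, W) h).
pose cj p q (A : 'M[C]_(p, q)) := map_mx Num.conj A.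
(* [choose] depends only on the predicate, which [A] and its conjugate share, so both get the same
   representative. *)
pose rep (A : 'M[C]_(m, n)) := choose (pred2 A (cj _ _ A)) A.
have repP (A : 'M[C]_(m, n)) : rep A = A \/ rep A = cj _ _ A.
  by have /orP[/eqP|/eqP] : pred2 A (cj _ _ A) (rep A);
    [by apply: chooseP; rewrite /= eqxx | left | right].
have repC (A : 'M[C]_(m, n)) : rep (cj _ _ A) = rep A.
  rewrite /rep (@eq_choose _ _ (pred2 A (cj _ _ A))); last first.
    by move=> B; rewrite /= /cj map_conjK orbC.
  by apply: choose_id; rewrite /= eqxx ?orbT.
have svdC (A : 'M[C]_(m, n)) (U : 'M[C]_(m, minn m n)) (W : 'M[C]_(n, minn m n)) :
    is_svd A U W -> is_svd (cj _ _ A) (cj _ _ U) (cj _ _ W).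
  move=> /is_svdP[UU WW AE]; apply/is_svdP.
  rewrite /cj !adj_conj -!map_mxM UU WW !map_mx1; split=> //.
  rewrite (_ : svrow _ = svrow A); last by apply/rowP => i; rewrite !mxE sigma_conj.
  by rewrite -rdiag_conj -!map_mxM -AE.
pose G (A : 'M[C]_(m, n)) :=
  if A == rep A then F A else (cj _ _ (F (cj _ _ A)).1, cj _ _ (F (cj _ _ A)).2).
exists (fun A => (G A).1), (fun A => (G A).2) => A.
have [rA|rA] := eqVneq (cj _ _ A) A.
  have AA : A = rep A by have [->|->] := repP A.
  have [sA rF] := FP A; have [rU rW] := rF rA.
  by rewrite -/(cj _ _ A) rA /G -AA eqxx; split.
have ccK p q (B : 'M[C]_(p, q)) : cj _ _ (cj _ _ B) = B by exact: map_conjK.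
rewrite -/(cj _ _ A) /G repC; have [rE|rE] := repP A; rewrite rE ?eqxx ?(negPf rA) ?ccK.
  by have [sA _] := FP A; split.
rewrite eq_sym (negPf rA) /=.
have [sA _] := FP (cj _ _ A); split; try by rewrite -!/(cj _ _ _) ?ccK.
by have := svdC _ _ _ sA; rewrite ccK.
Qed.

End SingularValueTheory.

(** * Operator and nuclear norms *)

Section Duality.
Variable R : realType.
Local Notation C := R[i].
Local Open Scope complex_scope.

Definition nsq (z : C) : R := re z ^+ 2 + im z ^+ 2.

Lemma nsq_ge0 z : 0 <= nsq z.
Proof. by rewrite addr_ge0 ?sqr_ge0. Qed.

Lemma nsq_eq0 z : nsq z = 0 -> z = 0.
Proof.
move=> /eqP; rewrite paddr_eq0 ?sqr_ge0 // !sqrf_eq0 => /andP[/eqP + /eqP].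
by case: z => a b; rewrite /re /im /= => -> ->.
Qed.

Lemma nsqZ (a : R) z : nsq (a%:C * z) = a ^+ 2 * nsq z.
Proof. by case: z => b c; rewrite /nsq /re /im /=; ring. Qed.

Lemma nsq_real (a : R) : nsq a%:C = a ^+ 2.
Proof. by rewrite /nsq /re /im /= expr0n addr0. Qed.

Lemma nsq0 : nsq 0 = 0.
Proof. by rewrite (nsq_real 0) expr0n. Qed.

Lemma fsq_nsq m n (A : 'M[C]_(m, n)) : fsq A = \sum_i \sum_j nsq (A i j).
Proof. by rewrite /fsq cdotE. Qed.

Lemma fsq_colE n (v : 'cV[C]_n) : fsq v = \sum_i nsq (v i 0).
Proof. by rewrite fsq_nsq; apply: eq_bigr => i _; rewrite big_ord1. Qed.

Lemma rdiag_mulE k p (d : 'rV[R]_k) (X : 'M[C]_(k, p)) i j :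
  (rdiag d *m X) i j = (d 0 i)%:C * X i j.
Proof. by rewrite mul_diag_mx !mxE. Qed.

Lemma mul_rdiagE k p (d : 'rV[R]_k) (X : 'M[C]_(p, k)) i j :
  (X *m rdiag d) i j = X i j * (d 0 j)%:C.
Proof. by rewrite mul_mx_diag !mxE. Qed.

Lemma rdiagD k (d e : 'rV[R]_k) : rdiag (d + e) = rdiag d + rdiag e.
Proof. by rewrite /rdiag map_mxD raddfD. Qed.

Lemma fsq_isometry n j (V : 'M[C]_(n, j)) : V^t* *m V = 1%:M -> fsq V = j%:R.
Proof.
move=> VV; suff: (fsq V)%:C = j%:R%:C :> C by case.
by rewrite -fsqE VV mxtrace1 rmorph_nat.
Qed.

Lemma fsq_col_isometry n j (V : 'M[C]_(n, j)) i : V^t* *m V = 1%:M -> fsq (col i V) = 1.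
Proof.
move=> VV; suff: (fsq (col i V))%:C = 1%:C :> C by case.
rewrite -fsqE trace_mx11; have /matrixP/(_ i i) := VV.
rewrite !mxE eqxx => h; apply: etrans h.
by apply: eq_bigr => l _; rewrite !mxE.
Qed.

Lemma cdot_col m n (A B : 'M[C]_(m, n)) : cdot A B = \sum_j cdot (col j A) (col j B).
Proof.
rewrite cdotE exchange_big; apply: eq_bigr => j _; rewrite cdotE.
by apply: eq_bigr => i _; rewrite big_ord1 !mxE.
Qed.

Lemma col_mulmx m n p (A : 'M[C]_(m, n)) (B : 'M[C]_(n, p)) j :
  col j (A *m B) = A *m col j B.
Proof. by rewrite !colE mulmxA. Qed.

Lemma cdot_mulr_adj m n k (A : 'M[C]_(m, n)) (X : 'M[C]_(m, k)) (W : 'M[C]_(n, k)) :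
  cdot A (X *m W^t*) = cdot (A *m W) X.
Proof. by rewrite cdotC cdotMr adjK cdotC. Qed.

Lemma cdot_svd m n k (A : 'M[C]_(m, n)) U (W : 'M[C]_(n, k)) (d : 'rV[R]_k) :
  cdot A (U *m rdiag d *m W^t*) = \sum_j d 0 j * cdot (A *m col j W) (col j U).
Proof.
rewrite cdot_mulr_adj cdot_col; apply: eq_bigr => j _.
rewrite -cdotZr -col_mulmx; congr cdot.
by apply/colP => i; rewrite mxE mul_rdiagE !mxE mulrC.
Qed.

Lemma cdot_cauchy_schwarz m n (A B : 'M[C]_(m, n)) :
  cdot A B <= Num.sqrt (fsq A) * Num.sqrt (fsq B).
Proof.
have [A0|A0] := eqVneq (fsq A) 0.
  by rewrite (fsq_eq0 A0) cdot0l mulr_ge0 // sqrtr_ge0.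
have [B0|B0] := eqVneq (fsq B) 0.
  by rewrite (fsq_eq0 B0) cdotC cdot0l mulr_ge0 // sqrtr_ge0.
set a := Num.sqrt (fsq A); set b := Num.sqrt (fsq B).
have a0 : 0 < a by rewrite sqrtr_gt0 lt_neqAle eq_sym A0 fsq_ge0.
have b0 : 0 < b by rewrite sqrtr_gt0 lt_neqAle eq_sym B0 fsq_ge0.
have aE : fsq A = a ^+ 2 by rewrite sqr_sqrtr // fsq_ge0.
have bE : fsq B = b ^+ 2 by rewrite sqr_sqrtr // fsq_ge0.
(* The weight b / a makes the right-hand side equal to a b. *)
have := cdot_amgm A B (divr_gt0 b0 a0); rewrite aE bE => h.
apply: le_trans h _; rewrite le_eqVlt; apply/orP; left; apply/eqP.
by field; rewrite !gt_eqF.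
Qed.

Lemma fnorm_triangle m n (A B : 'M[C]_(m, n)) :
  Num.sqrt (fsq (A + B)) <= Num.sqrt (fsq A) + Num.sqrt (fsq B).
Proof.
rewrite -(@ler_pXn2r _ 2) ?nnegrE ?addr_ge0 ?sqrtr_ge0 //.
rewrite sqr_sqrtr ?fsq_ge0 // fsqD sqrrD !sqr_sqrtr ?fsq_ge0 //.
by rewrite lerD2r lerD2l mulr_natl lerMn2r /= cdot_cauchy_schwarz.
Qed.

(** Operator norm at most [c], tested on vectors and squared, so that no square root or ordered
    singular value enters. *)
Definition opbound m n (c : R) (A : 'M[C]_(m, n)) :=
  forall v : 'cV[C]_n, fsq (A *m v) <= c ^+ 2 * fsq v.

Lemma opbound_diag k m n (U : 'M[C]_(m, k)) (W : 'M[C]_(n, k)) (d : 'rV[R]_k) c :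
  U^t* *m U = 1%:M -> W^t* *m W = 1%:M -> (forall i, `|d 0 i| <= c) ->
  opbound c (U *m rdiag d *m W^t*).
Proof.
move=> UU WW dc v; rewrite -!mulmxA fsq_isoml //.
have c0 (i : 'I_k) : d 0 i ^+ 2 <= c ^+ 2.
  by rewrite -real_normK ?num_real // lerXn2r // nnegrE ?(le_trans _ (dc i)).
apply: le_trans (_ : c ^+ 2 * fsq (W^t* *m v) <= _); last first.
  by rewrite ler_wpM2l ?sqr_ge0 // fsq_contract.
rewrite !fsq_colE mulr_sumr; apply: ler_sum => i _.
by rewrite rdiag_mulE nsqZ ler_wpM2r ?nsq_ge0.
Qed.

Lemma opbound_sigma m n (A : 'M[C]_(m, n)) c :
  (forall i, sigma A i <= c) -> opbound c A.
Proof.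
move=> Ac; have [U [W [/is_svdP[UU WW AE] _]]] := svd_exists A.
rewrite AE; apply: opbound_diag => // i.
by rewrite mxE ger0_norm // sigma_ge0.
Qed.

Lemma cdot_opbound m n c (A : 'M[C]_(m, n)) (x : 'cV[C]_n) (y : 'cV[C]_m) :
  0 <= c -> opbound c A -> fsq x = 1 -> fsq y = 1 -> cdot (A *m x) y <= c.
Proof.
move=> c0 Ac x1 y1; apply: le_trans (cdot_cauchy_schwarz _ _) _.
rewrite y1 sqrtr1 mulr1 -(ger0_norm c0) -sqrtr_sqr ler_wsqrtr //.
by have := Ac x; rewrite x1 mulr1.
Qed.

Lemma cdot_le_nuclear m n c (A Z : 'M[C]_(m, n)) :
  0 <= c -> opbound c A -> cdot A Z <= c * nuclear_norm Z.
Proof.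
move=> c0 Ac; have [U [W [/is_svdP[UU WW ZE] _]]] := svd_exists Z.
rewrite {1}ZE cdot_svd nuclear_normE mulr_sumr; apply: ler_sum => j _.
rewrite mxE mulrC ler_wpM2r ?sigma_ge0 //.
by apply: cdot_opbound => //; exact: fsq_col_isometry.
Qed.

(** The factor U W^H attains the duality bound; the triangle inequality for the nuclear norm
    follows. *)
Lemma nuclear_norm_attained m n (Z : 'M[C]_(m, n)) :
  exists2 B : 'M[C]_(m, n), opbound 1 B & cdot B Z = nuclear_norm Z.
Proof.
have [U [W [/is_svdP[UU WW ZE] _]]] := svd_exists Z.
have r1 : rdiag (const_mx 1 : 'rV[R]_(minn m n)) = 1%:M.
  apply/matrixP => i j; rewrite !mxE.
  by case: eqP.
exists (U *m W^t*).
  rewrite -[U]mulmx1 -r1; apply: opbound_diag => // i.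
  by rewrite mxE normr1.
rewrite {1}ZE cdot_svd nuclear_normE; apply: eq_bigr => j _.
rewrite mxE (_ : _ *m col j W = col j U) -/(fsq _) ?fsq_col_isometry ?mulr1 //.
by rewrite -col_mulmx -mulmxA WW mulmx1.
Qed.

Lemma nuclear_norm_triangle m n (A B : 'M[C]_(m, n)) :
  nuclear_norm (A + B) <= nuclear_norm A + nuclear_norm B.
Proof.
have [D D1 <-] := nuclear_norm_attained (A + B).
rewrite cdotDr -[nuclear_norm A]mul1r -[nuclear_norm B]mul1r.
by apply: lerD; apply: cdot_le_nuclear.
Qed.

Lemma nuclear_normZ m n (a : R) (A : 'M[C]_(m, n)) : 0 <= a ->
  nuclear_norm (a%:C *: A) = a * nuclear_norm A.
Proof.
move=> a0; have [U [W [/is_svdP[UU WW AE] _]]] := svd_exists A.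
have d0 i : 0 <= (\row_i (a * svrow A 0 i)) 0 i by rewrite !mxE mulr_ge0 ?sigma_ge0.
rewrite (nuclear_norm_diag erefl UU WW d0).
  by rewrite nuclear_normE mulr_sumr; apply: eq_bigr => i _; rewrite !mxE.
rewrite {1}AE scalemxAl; congr (_ *m _); rewrite scalemxAr; congr (_ *m _).
apply/matrixP => i j; rewrite !mxE.
by case: eqP => _; rewrite ?mulr0 // !mulr1n rmorphM.
Qed.

(** Each singular value splits as max(0, sigma - t) + min(t, sigma). The first part is paired with
    [B] of operator norm at most 1; the second has operator norm at most [t] and is paired with the
    nuclear norm of [B]. Any test matrix [B] thus bounds the thresholded mass from below. *)
Lemma soft_threshold_bound m n (t : R) (B P : 'M[C]_(m, n)) : 0 <= t -> opbound 1 B ->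
  cdot B P <= \sum_(i < minn m n) Num.max 0 (sigma P i.+1 - t) + t * nuclear_norm B.
Proof.
move=> t0 B1; have [U [W [/is_svdP[UU WW PE] _]]] := svd_exists P.
pose ds := \row_(i < minn m n) Num.max 0 (sigma P i.+1 - t).
pose dt := \row_(i < minn m n) Num.min t (sigma P i.+1).
have dE : svrow P = ds + dt.
  apply/rowP => i; rewrite !mxE; case: (leP t (sigma P i.+1)) => h.
    by rewrite max_r ?subr_ge0 // subrK.
  by rewrite max_l ?add0r // subr_le0 ltW.
rewrite {1}PE dE rdiagD mulmxDr mulmxDl cdotDr; apply: lerD.
  rewrite cdot_svd; apply: ler_sum => j _.
  rewrite mxE -[leRHS]mulr1 ler_wpM2l ?le_max ?lexx //.
  by apply: cdot_opbound => //; exact: fsq_col_isometry.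
rewrite cdotC; apply: cdot_le_nuclear => //; apply: opbound_diag => // i.
by rewrite mxE ger0_norm ?ge_min ?lexx // le_min t0 sigma_ge0.
Qed.

Lemma sigma_le_nuclear m n (A : 'M[C]_(m, n)) i : sigma A i <= nuclear_norm A.
Proof.
have [k0|k0] := posnP (minn m n).
  by rewrite /sigma nth_default ?size_singular_values ?k0 // nuclear_norm_ge0.
apply: le_trans (_ : sigma A 1 <= _).
  by case: i => [|i]; [rewrite /sigma | exact: sigma_le].
rewrite nuclear_normE (bigD1 (Ordinal k0)) //= lerDl.
by apply: sumr_ge0 => j _; exact: sigma_ge0.
Qed.

Lemma fsq_le_nuclear m n (A : 'M[C]_(m, n)) : fsq A <= nuclear_norm A ^+ 2.
Proof.
apply: cdot_le_nuclear; first exact: nuclear_norm_ge0.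
apply: opbound_sigma => i; exact: sigma_le_nuclear.
Qed.

Section Weyl.
Variables (m n f j : nat) (A E : 'M[C]_(m, n)) (F : 'M[C]_(n, f)) (c : R).
Hypotheses (c0 : 0 <= c) (j0 : (0 < j)%N) (fj : (f + j <= minn m n)%N).
Hypothesis Ac : forall v : 'cV[C]_n, F^t* *m v = 0 -> fsq (A *m v) <= c ^+ 2 * fsq v.

(* On the intersection, of dimension at least [j], of the leading [f + j] right
   singular directions with the orthogonal complement of [F], the perturbation
   [E] has gain at least [sigma - c]. *)
Lemma weyl_frobenius :
  sigma (A + E) (f + j) <= c + Num.sqrt (fsq E) / Num.sqrt j%:R.
Proof.
set P := A + E; have [U [W [/is_svdP[UU WW PE] _]]] := svd_exists P.
pose J : 'M[C]_(minn m n, f + j) := \matrix_(a, b) (a == b :> nat)%:R.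
have JJ : J^t* *m J = 1%:M.
  apply/matrixP => a b; rewrite !mxE.
  have ak : (a < minn m n)%N by apply: leq_trans fj.
  rewrite (bigD1 (Ordinal ak)) //= !mxE eqxx rmorph1 mul1r big1 ?addr0 // => l la.
  rewrite !mxE (_ : (l == a :> nat) = false) ?rmorph0 ?mul0r //.
  by apply: contraNF la => /eqP la; apply/eqP/val_inj.
have [Q [QQ MQ]] := kernel_isometry (F^t* *m W *m J).
set V := W *m (J *m Q).
have VV : V^t* *m V = 1%:M.
  rewrite !adjM !mulmxA -(mulmxA _ _ W) WW mulmx1 -(mulmxA _ _ J) JJ mulmx1.
  exact: QQ.
have FV : F^t* *m V = 0 by rewrite /V !mulmxA.
have sj : 0 < Num.sqrt j%:R :> R by rewrite sqrtr_gt0 ltr0n.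
(* [V] consists of j orthonormal columns: each has gain at least sigma_(f+j) under [P] and at most
   [c] under [A]. Measuring all j of them in Frobenius norm is what divides the error by sqrt j. *)
have PV : sigma P (f + j) * Num.sqrt j%:R <= Num.sqrt (fsq (P *m V)).
  rewrite -(ger0_norm (sigma_ge0 P (f + j))) -sqrtr_sqr -sqrtrM ?sqr_ge0 //.
  apply: ler_wsqrtr; rewrite -(fsq_isometry VV).
  have -> : fsq (P *m V) = fsq (rdiag (svrow P) *m (J *m Q)).
    rewrite {1}PE -2!mulmxA (fsq_isoml _ UU) /V.
    by rewrite (mulmxA (W^t*)) WW mul1mx.
  have -> : fsq V = fsq (J *m Q) by rewrite /V fsq_isoml.
  rewrite !fsq_nsq mulr_sumr; apply: ler_sum => a _.
  rewrite mulr_sumr; apply: ler_sum => b _.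
  rewrite rdiag_mulE nsqZ [svrow _ _ _]mxE; have [af|af] := ltnP a (f + j).
    by rewrite ler_wpM2r ?nsq_ge0 // lerXn2r ?nnegrE ?sigma_ge0 // sigma_le.
  rewrite (_ : (J *m Q) a b = 0); last first.
    rewrite mxE big1 // => l _; rewrite mxE gtn_eqF ?mul0r //.
    exact: leq_trans (ltn_ord l) af.
  by rewrite nsq0 !mulr0 ?lexx.
have AV : Num.sqrt (fsq (A *m V)) <= c * Num.sqrt j%:R.
  rewrite -(ger0_norm c0) -sqrtr_sqr -sqrtrM ?sqr_ge0 //; apply: ler_wsqrtr.
  rewrite -(fsq_isometry VV) !(fsq_col (_ *m V)) (fsq_col V) mulr_sumr; apply: ler_sum => a _.
  rewrite col_mulmx; apply: Ac; by rewrite -col_mulmx FV; apply/colP => i; rewrite !mxE.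
have EV : Num.sqrt (fsq (E *m V)) <= Num.sqrt (fsq E).
  by apply: ler_wsqrtr; apply: fsq_contractr.
rewrite -(ler_pM2r sj) mulrDl divfK ?gt_eqF //.
apply: le_trans PV _; rewrite /P mulmxDl; apply: le_trans (fnorm_triangle _ _) _.
exact: lerD.
Qed.

End Weyl.

Section LeadingColumns.
Variables (m n : nat) (A : 'M[C]_(m, n)) (U : 'M[C]_(m, minn m n)) (W : 'M[C]_(n, minn m n)).
Hypothesis sA : is_svd A U W.

(** The product with a rectangular identity avoids carrying a proof that [f] is at most the number
    of columns of [W]; surplus columns are zero. *)
Definition lead_cols f : 'M[C]_(n, f) :=
  W *m \matrix_(a < minn m n, b < f) (a == b :> nat)%:R.

Lemma lead_cols_orth f (v : 'cV[C]_n) (i : 'I_(minn m n)) : (i < f)%N ->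
  (lead_cols f)^t* *m v = 0 -> (W^t* *m v) i 0 = 0.
Proof.
move=> fi; have JE (x : 'cV[C]_(minn m n)) :
    ((\matrix_(a < minn m n, b < f) (a == b :> nat)%:R)^t* *m x) (Ordinal fi) 0 = x i 0.
  rewrite mxE (bigD1 i) //= 2!mxE mxE eqxx rmorph1 mul1r big1 ?addr0 // => l li.
  rewrite !mxE (_ : (l == i :> nat) = false) ?rmorph0 ?mul0r //.
  by apply: contraNF li => /eqP li; apply/eqP/val_inj.
by rewrite /lead_cols adjM -mulmxA => /matrixP/(_ (Ordinal fi) 0); rewrite JE [RHS]mxE.
Qed.

Lemma lead_cols_bound f (v : 'cV[C]_n) : (lead_cols f)^t* *m v = 0 ->
  fsq (A *m v) <= sigma A f.+1 ^+ 2 * fsq v.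
Proof.
move=> Fv; have /is_svdP[UU WW AE] := sA.
rewrite {1}AE -!mulmxA fsq_isoml //.
apply: le_trans (_ : sigma A f.+1 ^+ 2 * fsq (W^t* *m v) <= _); last first.
  by rewrite ler_wpM2l ?sqr_ge0 // fsq_contract.
rewrite !fsq_colE mulr_sumr; apply: ler_sum => i _.
rewrite rdiag_mulE nsqZ [svrow _ _ _]mxE; have [fi|fi] := ltnP i f.
  by rewrite (lead_cols_orth fi Fv) nsq0 !mulr0 ?lexx.
by rewrite ler_wpM2r ?nsq_ge0 // lerXn2r ?nnegrE ?sigma_ge0 // sigma_le.
Qed.

Variables (s : R) (X : 'M[C]_(m, n)).

Definition top_row : 'rV[R]_(minn m n) := \row_i (sigma A i.+1 == s)%:R.
(** The partial isometry between the singular spaces of [A] for the value [s]. Its nuclear norm and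
    its squared Frobenius norm both equal the multiplicity of [s], which makes it the test matrix
    for the mass estimate. *)
Definition top_factor : 'M[C]_(m, n) := U *m rdiag top_row *m W^t*.

Lemma top_factor_opbound : opbound 1 top_factor.
Proof.
have /is_svdP[UU WW _] := sA; apply: opbound_diag => // i.
by rewrite mxE normr_nat; case: (_ == _).
Qed.

Lemma top_count : \sum_i top_row 0 i = (count_mem s (singular_values A))%:R.
Proof.
rewrite singular_valuesE_sigma count_map -size_filter -sum1_size big_filter.
rewrite big_enum_cond /= natr_sum [RHS]big_mkcond /=.
by apply: eq_bigr => i _; rewrite mxE; case: eqP.
Qed.

Lemma top_factor_nuclear : nuclear_norm top_factor = (count_mem s (singular_values A))%:R.
Proof.
have /is_svdP[UU WW _] := sA; rewrite -top_count.
by apply: (nuclear_norm_diag erefl UU WW) => // i; rewrite mxE ler0n.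
Qed.

Lemma top_factor_fsq : fsq top_factor = (count_mem s (singular_values A))%:R.
Proof.
have /is_svdP[UU WW _] := sA; rewrite -top_count /top_factor -mulmxA fsq_isoml //.
rewrite -fsq_adj adjM adjK fsq_isoml // fsq_adj fsq_nsq; apply: eq_bigr => i _.
rewrite (bigD1 i) //= big1 => [|l li]; last first.
  by rewrite !mxE [i == l]eq_sym (negPf li) mulr0n nsq0.
rewrite addr0 !mxE eqxx mulr1n nsq_real.
by case: (_ == _); rewrite ?expr1n ?expr0n.
Qed.

Lemma top_factor_dot : cdot top_factor A = s * (count_mem s (singular_values A))%:R.
Proof.
have /is_svdP[UU WW AE] := sA; rewrite -top_count {1}AE cdot_svd mulr_sumr.
apply: eq_bigr => j _; rewrite (_ : top_factor *m col j W = (top_row 0 j)%:C *: col j U).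
  rewrite cdotZl -/(fsq _) fsq_col_isometry // mulr1 !mxE.
  by case: eqP => [->|_]; rewrite ?mulr1 ?mulr0.
rewrite -col_mulmx /top_factor -mulmxA WW mulmx1; apply/colP => i.
by rewrite [LHS]mxE mul_rdiagE mulrC !mxE.
Qed.

Hypotheses (s0 : 0 < s) (As : forall i, sigma A i <= s).
Hypothesis AX : cdot A X = s * nuclear_norm X.

(* Equality in the trace inequality forces [A q = s p] for every singular pair
   [(p, q)] of [X], so that [q] lies in the leading right singular space. *)
Lemma trace_equality : X = X *m (W *m rdiag top_row *m W^t*) /\
  cdot top_factor X = nuclear_norm X.
Proof.
have /is_svdP[UU WW AE] := sA.
have [U' [W' [/is_svdP[UU' WW' XE] _]]] := svd_exists X.
have key (j : 'I_(minn m n)) : sigma X j.+1 != 0 ->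
    col j W' = W *m rdiag top_row *m W^t* *m col j W' /\
    top_factor *m col j W' = col j U'.
  move=> tj; set q := col j W'; set p := col j U'.
  have q1 : fsq q = 1 by apply: fsq_col_isometry.
  have p1 : fsq p = 1 by apply: fsq_col_isometry.
  have Aop : opbound s A by apply: opbound_sigma.
  have Aq : cdot (A *m q) p = s.
    (* The trace equality expanded along the singular triples of [X]: all terms are nonnegative, so
       each vanishes. *)
    have : \sum_(j < minn m n) sigma X j.+1 * (s - cdot (A *m col j W') (col j U')) = 0.
      under eq_bigr do rewrite mulrBr.
      rewrite sumrB -mulr_suml -nuclear_normE mulrC -AX {1}XE cdot_svd.
      by rewrite -sumrB big1 // => i _; rewrite mxE subrr.
    move/eqP; rewrite psumr_eq0 => [/allP/(_ j (mem_index_enum j))|i _].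
      by rewrite mulf_eq0 (negPf tj) /= subr_eq0 => /eqP.
    rewrite mulr_ge0 ?sigma_ge0 // subr_ge0; apply: cdot_opbound => //; try exact: ltW.
      exact: fsq_col_isometry.
    exact: fsq_col_isometry.
  have Aqp : A *m q = s%:C *: p.
    apply/eqP; rewrite -subr_eq0; apply/eqP/fsq_eq0/eqP; rewrite eq_le fsq_ge0 andbT.
    rewrite fsqD fsqN fsqZ p1 cdotNr cdotZr Aq.
    by have := Aop q; rewrite q1; lra.
  set b := W^t* *m q.
  have b1 : fsq b <= 1 by rewrite -q1; apply: fsq_contract.
  (* The weights |b_i|^2 have sum at most 1 and yet average the squares sigma_i^2 <= s^2 to s^2, so
     they live on the indices with sigma_i = s. *)
  have Ab : \sum_(i < minn m n) sigma A i.+1 ^+ 2 * nsq (b i 0) = s ^+ 2.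
    have : fsq (A *m q) = s ^+ 2 by rewrite Aqp fsqZ p1 mulr1.
    rewrite {1}AE -!mulmxA fsq_isoml // -/b fsq_colE => <-.
    by apply: eq_bigr => i _; rewrite rdiag_mulE nsqZ [svrow _ _ _]mxE.
  have sq_le i : sigma A i ^+ 2 <= s ^+ 2.
    by rewrite lerXn2r ?nnegrE ?sigma_ge0 // ltW.
  have b0 (i : 'I_(minn m n)) : sigma A i.+1 != s -> b i 0 = 0.
    move=> si; apply: nsq_eq0.
    have : \sum_(i < minn m n) (s ^+ 2 - sigma A i.+1 ^+ 2) * nsq (b i 0) <= 0.
      under eq_bigr do rewrite mulrBl.
      rewrite sumrB Ab -mulr_sumr -fsq_colE.
      by rewrite subr_le0 -[leRHS]mulr1 ler_wpM2l ?sqr_ge0.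
    move=> h; have : \sum_(i < minn m n) (s ^+ 2 - sigma A i.+1 ^+ 2) * nsq (b i 0) == 0.
      rewrite eq_le h; apply: sumr_ge0 => l _.
      by rewrite mulr_ge0 ?nsq_ge0 // subr_ge0.
    rewrite psumr_eq0 => [/allP/(_ i (mem_index_enum i))|l _].
      rewrite mulf_eq0 subr_eq0 eq_sym eqrXn2 ?sigma_ge0 ?ltW // (negPf si) /=.
      by move/eqP.
    by rewrite mulr_ge0 ?nsq_ge0 // subr_ge0.
  have Tb : rdiag top_row *m b = b.
    apply/colP => i; rewrite rdiag_mulE [top_row _ _]mxE; case: eqP => [_|/eqP si].
      by rewrite mul1r.
    by rewrite (b0 _ si) mulr0.
  have Db : rdiag (svrow A) *m b = s%:C *: b.
    apply/colP => i; rewrite rdiag_mulE [svrow _ _ _]mxE [RHS]mxE.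
    have [<-//|si] := eqVneq (sigma A i.+1) s.
    by rewrite (b0 _ si) !mulr0.
  have pE : p = U *m b.
    have sC : s%:C != 0 :> C by rewrite fmorph_eq0 gt_eqF.
    apply: (scalerI sC); rewrite -Aqp {1}AE -!mulmxA -/b Db.
    by rewrite -scalemxAr.
  have fb1 : fsq b = 1 by move: p1; rewrite pE (fsq_isoml _ UU).
  have qE : q = W *m b.
    apply/eqP; rewrite -subr_eq0; apply/eqP/fsq_eq0.
    rewrite fsqD fsqN fsq_isoml // cdotNr cdotC cdotMl -/b -/(fsq b) fb1 q1; ring.
  split; last by rewrite /top_factor -!mulmxA -/b Tb pE.
  by rewrite -!mulmxA -/b Tb.
split.
  set Pi := W *m rdiag top_row *m W^t*; rewrite {2}XE {1}XE -!mulmxA.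
  congr (_ *m _); apply/matrixP => j l; rewrite !rdiag_mulE [svrow _ _ _]mxE.
  have [->|tj] := eqVneq (sigma X j.+1) 0; first by rewrite !mul0r.
  have PiH : Pi^t* = Pi by rewrite !adjM adjK rdiag_adj mulmxA.
  have rE : row j (W'^t*) = (col j W')^t* by apply/rowP => x; rewrite !mxE.
  congr (_ * _); have [+ _] := key j tj => /(congr1 (fun v : 'cV[C]_n => v^t*)).
  rewrite adjM PiH -!rE -row_mul => /rowP/(_ l).
  by rewrite [LHS]mxE [RHS]mxE.
rewrite {1}XE cdot_svd nuclear_normE; apply: eq_bigr => j _; rewrite mxE.
have [->|tj] := eqVneq (sigma X j.+1) 0; first by rewrite !mul0r.
by have [_ ->] := key j tj; rewrite -/(fsq _) fsq_col_isometry // mulr1.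
Qed.

End LeadingColumns.

End Duality.

(** * Projections and the accelerated gradient method *)

Section EuclideanGeometry.
Variables (R : realType) (V : lmodType R) (dot : V -> V -> R).

Definition inner_product : Prop :=
  [/\ forall x y, dot x y = dot y x, forall x y z, dot (x + y) z = dot x z + dot y z,
      forall a x y, dot (a *: x) y = a * dot x y, forall x, 0 <= dot x x
    & forall x, dot x x = 0 -> x = 0].

Definition convex_set (S : set V) : Prop :=
  forall x y (t : R), S x -> S y -> 0 <= t <= 1 -> S (t *: x + (1 - t) *: y).

Definition convex_function (f : V -> R) : Prop :=
  forall x y (t : R), 0 <= t <= 1 ->
    f (t *: x + (1 - t) *: y) <= t * f x + (1 - t) * f y.

Hypothesis dotP : inner_product.
Local Notation norm := (enorm dot).

Lemma dotC x y : dot x y = dot y x.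
Proof. by case: dotP. Qed.

Lemma dotDl x y z : dot (x + y) z = dot x z + dot y z.
Proof. by case: dotP. Qed.

Lemma dotDr x y z : dot x (y + z) = dot x y + dot x z.
Proof. by rewrite dotC dotDl !(dotC x). Qed.

Lemma dotZl a x y : dot (a *: x) y = a * dot x y.
Proof. by case: dotP. Qed.

Lemma dotZr a x y : dot x (a *: y) = a * dot x y.
Proof. by rewrite dotC dotZl dotC. Qed.

Lemma dotNl x y : dot (- x) y = - dot x y.
Proof. by rewrite -scaleN1r dotZl mulN1r. Qed.

Lemma dotNr x y : dot x (- y) = - dot x y.
Proof. by rewrite dotC dotNl dotC. Qed.

Lemma dot0l x : dot 0 x = 0.
Proof. by rewrite -(scale0r 0) dotZl mul0r. Qed.

Definition dotE := (dotDl, dotDr, dotNl, dotNr, dotZl, dotZr).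

Lemma dot_ge0 x : 0 <= dot x x.
Proof. by case: dotP. Qed.

Lemma dot_eq0 x : dot x x = 0 -> x = 0.
Proof. by case: dotP => _ _ _ _; apply. Qed.

Lemma enorm_ge0 x : 0 <= norm x.
Proof. exact: sqrtr_ge0. Qed.

Lemma enorm_sqr x : norm x ^+ 2 = dot x x.
Proof. by rewrite sqr_sqrtr // dot_ge0. Qed.

Lemma enormZ a x : norm (a *: x) = `|a| * norm x.
Proof. by rewrite /enorm dotZl dotZr mulrA -expr2 sqrtrM ?sqr_ge0 // sqrtr_sqr. Qed.

Lemma enormN x : norm (- x) = norm x.
Proof. by rewrite /enorm dotNl dotNr opprK. Qed.

Lemma cauchy_schwarz x y : dot x y <= norm x * norm y.
Proof.
have [x0|x0] := eqVneq (norm x) 0.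
  have /dot_eq0 -> : dot x x = 0 by rewrite -enorm_sqr x0 expr0n.
  by rewrite dot0l mulr_ge0 ?enorm_ge0.
have xp : 0 < norm x by rewrite lt_neqAle eq_sym x0 enorm_ge0.
have := dot_ge0 (norm y *: x - norm x *: y).
rewrite !dotE -!enorm_sqr (dotC y x) => h.
have [y0|y0] := eqVneq (norm y) 0.
  have /dot_eq0 -> : dot y y = 0 by rewrite -enorm_sqr y0 expr0n.
  by rewrite dotC dot0l mulr_ge0 ?enorm_ge0.
have yp : 0 < norm y by rewrite lt_neqAle eq_sym y0 enorm_ge0.
have : 0 <= 2 * (norm x * norm y) * (norm x * norm y - dot x y) by lra.
by rewrite pmulr_rge0 ?subr_ge0 // !mulr_gt0.
Qed.

Lemma enorm_triangle x y : norm (x + y) <= norm x + norm y.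
Proof.
rewrite -(@ler_pXn2r _ 2) ?nnegrE ?addr_ge0 ?enorm_ge0 // enorm_sqr !dotE.
have := cauchy_schwarz x y; rewrite (dotC y x) -!enorm_sqr; lra.
Qed.

(** Replaces every passage to the limit below: the error term of the derivative, vanishing step
    lengths, and the number of subdivisions. *)
Lemma le_forall_eps (a b c : R) : 0 <= c ->
  (forall e, 0 < e -> a <= b + e * c) -> a <= b.
Proof.
move=> c0 h; rewrite leNgt; apply/negP => ba.
have := h ((a - b) / (2 * (c + 1))); set e := _ / _.
have cp : 0 < c + 1 by lra.
have e0 : 0 < e by rewrite divr_gt0 ?subr_gt0 // mulr_gt0.
move=> /(_ e0); have : e * (c + 1) = (a - b) / 2 by rewrite /e; field; rewrite gt_eqF.
have : e * c <= e * (c + 1) by rewrite ler_pM2l // lerDl.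
by lra.
Qed.

Section Projection.
Variable S : set V.

Lemma proj_variational x y : convex_set S -> is_proj dot S x y ->
  forall z, S z -> dot (x - y) (z - y) <= 0.
Proof.
move=> cS [Sy yP] z Sz.
apply: (@le_forall_eps _ _ (dot (z - y) (z - y))); first exact: dot_ge0.
move=> e e0; rewrite add0r.
have tE (t : R) : 0 < t -> t <= 1 -> dot (x - y) (z - y) <= t * dot (z - y) (z - y).
  move=> t0 t1; have t01 : 0 <= t <= 1 by rewrite (ltW t0).
  have := yP _ (cS _ _ _ Sz Sy t01); rewrite -ler_sqr ?nnegrE ?enorm_ge0 // !enorm_sqr.
  have -> : x - (t *: z + (1 - t) *: y) = (x - y) - t *: (z - y).
    rewrite scalerBl scale1r scalerBr opprD !opprB.
    by rewrite [- (t *: z) + _]addrC [RHS]addrACA !addrA.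
  move: (x - y) (z - y) => a b; rewrite !dotE (dotC b a) => h.
  have : 0 <= t * (t * dot b b - dot a b) by have := mulr_ge0 (ltW t0) (dot_ge0 b); nra.
  by rewrite pmulr_rge0 // subr_ge0.
have [e1|e1] := leP e 1; first exact: tE.
apply: le_trans (tE 1 _ _) _ => //.
by rewrite ler_wpM2r ?dot_ge0 // ltW.
Qed.

Lemma variational_proj x y : S y -> (forall z, S z -> dot (x - y) (z - y) <= 0) ->
  is_proj dot S x y.
Proof.
move=> Sy yP; split=> // z Sz; rewrite -ler_sqr ?nnegrE ?enorm_ge0 // !enorm_sqr.
have -> : x - z = (x - y) - (z - y) by rewrite opprB addrA subrK.
have := yP z Sz; have := dot_ge0 (z - y).
move: (x - y) (z - y) => a b; rewrite !dotE (dotC b a); lra.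
Qed.

Lemma proj_unique x y y' : S y -> (forall z, S z -> dot (x - y) (z - y) <= 0) ->
  is_proj dot S x y' -> y' = y.
Proof.
move=> Sy yP [Sy' y'P].
have := y'P y Sy; rewrite -ler_sqr ?nnegrE ?enorm_ge0 // !enorm_sqr.
have -> : x - y' = (x - y) - (y' - y) by rewrite opprB addrA subrK.
have := yP y' Sy'; have := dot_ge0 (y' - y).
move=> b0 ab h; apply/eqP; rewrite -subr_eq0; apply/eqP/dot_eq0/eqP.
rewrite eq_le b0 andbT; move: b0 ab h; move: (x - y) (y' - y) => a b.
rewrite !dotE (dotC b a); lra.
Qed.

End Projection.

Section Smooth.
Variables (f : V -> R) (gf : V -> V) (beta : R).
Hypotheses (b0 : 0 < beta) (cf : convex_function f).
Hypothesis (sf : smooth dot beta f gf).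

Lemma gradient_along x h (e : R) : 0 < e ->
  exists2 t : R, 0 < t <= 1 & `|f (x + t *: h) - f x - t * dot (gf x) h| <= e * t * norm h.
Proof.
move=> e0; have [gP _] := sf; have [eta eta0 gE] := gP x e e0.
(* The [+ 1] covers h = 0, and the cap at 1 lets [t] be a convex weight. *)
pose t := Num.min 1 (eta / (2 * (norm h + 1))).
have hp : 0 < norm h + 1 by rewrite ltr_wpDl ?enorm_ge0.
have t0 : 0 < t by rewrite lt_min ltr01 divr_gt0 // mulr_gt0.
exists t; first by rewrite t0 ge_min lexx.
have := gE (t *: h); rewrite enormZ (gtr0_norm t0) dotZr mulrA; apply.
apply: le_lt_trans (_ : t * (norm h + 1) < eta).
  by rewrite ler_pM2l // lerDl.
apply: le_lt_trans (_ : eta / 2 < eta); last by lra.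
have -> : eta / 2 = eta / (2 * (norm h + 1)) * (norm h + 1).
  by field; rewrite gt_eqF.
by rewrite ler_pM2r // ge_min lexx orbT.
Qed.

Lemma gradient_ineq x y : f x + dot (gf x) (y - x) <= f y.
Proof.
apply: (@le_forall_eps _ _ (norm (y - x))); first exact: enorm_ge0.
move=> e e0; have [t /andP[t0 t1]] := gradient_along x (y - x) e0.
have -> : x + t *: (y - x) = t *: y + (1 - t) *: x.
  by rewrite scalerBl scale1r scalerBr addrCA addrA.
have := cf y x (t := t); rewrite t1 ltW // => /(_ isT) c1.
rewrite ler_norml => /andP[h _].
have : 0 <= t * (f y + e * norm (y - x) - (f x + dot (gf x) (y - x))) by lra.
by rewrite pmulr_rge0 // subr_ge0.
Qed.

Lemma minimizer_gradient S x : convex_set S -> is_minimizer f S x ->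
  forall z, S z -> 0 <= dot (gf x) (z - x).
Proof.
move=> cS [Sx xP] z Sz.
apply: (@le_forall_eps _ _ (norm (z - x))); first exact: enorm_ge0.
move=> e e0; have [t /andP[t0 t1]] := gradient_along x (z - x) e0.
have -> : x + t *: (z - x) = t *: z + (1 - t) *: x.
  by rewrite scalerBl scale1r scalerBr addrCA addrA.
have := xP _ (cS _ _ t Sz Sx _); rewrite t1 ltW // => /(_ isT) c1.
rewrite ler_norml => /andP[_ h].
have : 0 <= t * (dot (gf x) (z - x) + e * norm (z - x)) by lra.
by rewrite pmulr_rge0.
Qed.

(* Summing the gradient inequality over [n] equal steps gives the quadratic
   upper bound with constant [beta / 2 * (1 + 1 / n)]. *)
Lemma descent x y : f y <= f x + dot (gf x) (y - x) + beta / 2 * norm (y - x) ^+ 2.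
Proof.
set h := y - x; set D := norm h.
have D2 : D ^+ 2 = dot h h by rewrite enorm_sqr.
have step n (i : nat) : f (x + (i%:R / n.+1%:R) *: h) <=
    f x + i%:R / n.+1%:R * dot (gf x) h +
    beta * D ^+ 2 * (i%:R * (i%:R + 1)) / (2 * n.+1%:R ^+ 2).
  have np : (0 : R) < n.+1%:R by rewrite ltr0n.
  elim: i => [|i IH]; first by rewrite !mul0r scale0r addr0 mulr0 !mul0r !addr0.
  (* Convexity at the new point [xj] bounds the increment by the slope there, which the Lipschitz
     property compares with the slope at [x]; the excess is proportional to i + 1, whence the factor
     i (i + 1) / 2 in total. *)
  set xi := x + (i%:R / n.+1%:R) *: h in IH; set xj := x + _.
  have xij : xi - xj = - (n.+1%:R^-1 *: h).
    rewrite /xi /xj opprD addrACA subrr add0r -scalerBl -[RHS]scaleNr; congr (_ *: _).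
    by rewrite -mulrBl -[i.+1%:R]natr1 opprD addNKr mulN1r.
  have := gradient_ineq xj xi; rewrite xij dotNr dotZr => gi.
  have xjx : norm (xj - x) = i.+1%:R / n.+1%:R * D.
    by rewrite /xj addrC addKr enormZ ger0_norm // divr_ge0 // ler0n.
  have lip : dot (gf xj) h <= dot (gf x) h + beta * (i.+1%:R / n.+1%:R) * D ^+ 2.
    have -> : gf xj = gf x + (gf xj - gf x) by rewrite addrC subrK.
    rewrite dotDl lerD2l; apply: le_trans (cauchy_schwarz _ _) _.
    rewrite expr2 mulrA ler_wpM2r ?enorm_ge0 //.
    by have [_ /(_ xj x)] := sf; rewrite xjx mulrA.
  have gi' : f xj <= f xi + n.+1%:R^-1 *
      (dot (gf x) h + beta * (i.+1%:R / n.+1%:R) * D ^+ 2).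
    apply: le_trans (_ : f xi + n.+1%:R^-1 * dot (gf xj) h <= _).
      by rewrite -lerBlDr.
    by rewrite lerD2l ler_pM2l // invr_gt0.
  apply: le_trans gi' _; rewrite -lerBrDr; apply: le_trans IH _.
  rewrite le_eqVlt; apply/orP; left; apply/eqP.
  by rewrite -[i.+1%:R]natr1; field; rewrite gt_eqF.
apply: (@le_forall_eps _ _ (beta / 2 * D ^+ 2)).
  by rewrite mulr_ge0 ?sqr_ge0 // divr_ge0 // ltW.
move=> e e0; pose n := Num.truncn e^-1.
have np : (0 : R) < n.+1%:R by rewrite ltr0n.
have ne : n.+1%:R^-1 <= e.
  rewrite -[leRHS]invrK lef_pV2 ?posrE ?invr_gt0 //.
  by apply/ltW/truncnS_gt.
have := step n n.+1; rewrite divff ?gt_eqF // scale1r mul1r.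
rewrite (_ : x + h = y); last by rewrite addrC subrK.
move=> st; apply: le_trans st _; rewrite -!addrA !lerD2l.
have -> : beta * D ^+ 2 * (n.+1%:R * (n.+1%:R + 1)) / (2 * n.+1%:R ^+ 2) =
    beta / 2 * D ^+ 2 + n.+1%:R^-1 * (beta / 2 * D ^+ 2).
  by field; rewrite gt_eqF.
by rewrite lerD2l ler_wpM2r // mulr_ge0 ?sqr_ge0 // divr_ge0 // ltW.
Qed.

(** * Rate of the accelerated projected gradient method *)

Section Fista.
Variables (S : set V) (xs : V) (K : nat) (X Y : nat -> V).
Hypotheses (cS : convex_set S) (xsP : is_minimizer f S xs).
Hypotheses (SX : S (X 1%N)) (XY : Y 1%N = X 1%N).
Hypothesis XP : forall l, (1 <= l <= K)%N ->
  is_proj dot S (Y l - beta^-1 *: gf (Y l)) (X l.+1).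
Hypothesis YE : forall l, (1 <= l <= K)%N ->
  Y l.+1 = X l.+1 + ((fgm_theta R l - 1) / fgm_theta R l.+1) *: (X l.+1 - X l).

(** With a = y - x and b = z - x, descent from [y] to [x], convexity between [y] and [z], and the
    variational inequality of the projection add up to beta/2 (|a|^2 - 2 <a, b>), which is the
    right-hand side. *)
Lemma prox_ineq y x z : S z -> is_proj dot S (y - beta^-1 *: gf y) x ->
  f x - f z <= beta / 2 * (norm (y - z) ^+ 2 - norm (x - z) ^+ 2).
Proof.
move=> Sz xP; have := proj_variational cS xP Sz.
have := descent y x; have := gradient_ineq y z.
rewrite !enorm_sqr.
have -> : y - beta^-1 *: gf y - x = (y - x) - beta^-1 *: gf y by rewrite addrAC.
have -> : z - y = (z - x) - (y - x) by rewrite opprB addrA subrK.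
have -> : y - z = (y - x) - (z - x) by rewrite opprB addrA subrK.
rewrite -(opprB y x) -(opprB z x); move: (y - x) (z - x) (gf y) => a b g.
rewrite !dotE (dotC b a) => h1 h2 h3.
have : beta * (dot a b - beta^-1 * dot g b) <= 0 by rewrite pmulr_rle0 //; lra.
by rewrite mulrBr mulrA divff ?gt_eqF // mul1r; lra.
Qed.

Local Notation theta := (fgm_theta R).

Lemma fgm_thetaS l : (0 < l)%N -> theta l.+1 = (1 + Num.sqrt (1 + 4 * theta l ^+ 2)) / 2.
Proof. by case: l. Qed.

Lemma fgm_theta_ge l : (0 < l)%N -> (l.+1)%:R / 2 <= theta l.
Proof.
elim: l => [//|[_ _|l /(_ isT) IH _]]; first by rewrite /fgm_theta /=; lra.
have tl : 0 <= theta l.+1 by apply: le_trans IH; rewrite divr_ge0 // ler0n.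
rewrite fgm_thetaS //.
have : 2 * theta l.+1 <= Num.sqrt (1 + 4 * theta l.+1 ^+ 2).
  rewrite -[leLHS]ger0_norm ?mulr_ge0 // -sqrtr_sqr ler_wsqrtr // exprMn; lra.
by rewrite -[l.+3%:R]natr1; lra.
Qed.

Lemma fgm_theta_ge1 l : (0 < l)%N -> 1 <= theta l.
Proof.
move=> l0; apply: le_trans (fgm_theta_ge l0).
have : (2 : R) <= l.+1%:R by rewrite ler_nat.
lra.
Qed.

(** The quadratic equation defining theta; it makes the inequalities of successive steps
    telescope. *)
Lemma fgm_theta_rec l : (0 < l)%N ->
  theta l.+1 * (theta l.+1 - 1) = theta l ^+ 2.
Proof.
move=> l0; rewrite fgm_thetaS //; set s := Num.sqrt _.
have : s ^+ 2 = 1 + 4 * theta l ^+ 2 by rewrite sqr_sqrtr // addr_ge0 // mulr_ge0 // sqr_ge0.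
by move=> sE; lra.
Qed.

Lemma fista_mem l : (1 <= l <= K.+1)%N -> S (X l).
Proof. by case: l => [//|[//|l]] /andP[_ lK]; case: (XP (l := l.+1) lK). Qed.

(** [w l] and [u l] are the vectors of the Lyapunov function before and after step [l]; the momentum
    rule is exactly w_(l+1) = u_l. *)
Let w l := theta l *: Y l - (theta l - 1) *: X l - xs.
Let u l := theta l *: X l.+1 - (theta l - 1) *: X l - xs.

Lemma fista_step l : (1 <= l <= K)%N ->
  theta l ^+ 2 * (f (X l.+1) - f xs) + beta / 2 * norm (u l) ^+ 2 <=
  theta l * (theta l - 1) * (f (X l) - f xs) + beta / 2 * norm (w l) ^+ 2.
Proof.
move=> lK; have l0 : (0 < l)%N by case/andP: lK.
have t1 := fgm_theta_ge1 l0; set t := theta l in t1 *.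
have t0 : 0 < t by apply: lt_le_trans t1.
have tn : t != 0 by rewrite gt_eqF.
(* The comparison point mixes the previous iterate with the solution, so that t (Y_l - z) is [w l]
   and t (X_(l+1) - z) is [u l]. *)
pose z := (1 - t^-1) *: X l + t^-1 *: xs.
have t01 : 0 <= 1 - t^-1 <= 1.
  by rewrite subr_ge0 invf_le1 // t1 /= lerBlDr lerDl invr_ge0 ltW.
have zE : z = (1 - t^-1) *: X l + (1 - (1 - t^-1)) *: xs by rewrite subKr.
have SXl : S (X l) by apply: fista_mem; case/andP: lK => -> /leqW ->.
have Sz : S z by rewrite zE; apply: cS => //; case: xsP.
have fz := cf (X l) xs t01; rewrite -zE subKr in fz.
have := prox_ineq Sz (XP lK).
have sc x : t *: (x - z) = t *: x - (t - 1) *: X l - xs.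
  rewrite /z scalerBr scalerDr !scalerA mulrBr mulr1 divff // scale1r.
  by rewrite opprD addrA.
have nE x : norm (t *: x - (t - 1) *: X l - xs) ^+ 2 = t ^+ 2 * norm (x - z) ^+ 2.
  by rewrite -sc enormZ exprMn ger0_norm // ltW.
rewrite /u /w -/t !nE => h.
have h2 : t ^+ 2 * (f (X l.+1) - f z) <=
   t ^+ 2 * (beta / 2 * (norm (Y l - z) ^+ 2 - norm (X l.+1 - z) ^+ 2)).
  by rewrite ler_wpM2l ?sqr_ge0.
have h3 : t ^+ 2 * f z <= t * (t - 1) * f (X l) + t * f xs.
  have -> : t * (t - 1) * f (X l) + t * f xs = t ^+ 2 * ((1 - t^-1) * f (X l) + t^-1 * f xs).
    by field.
  by rewrite ler_wpM2l ?sqr_ge0.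
by lra.
Qed.

Lemma fista_rate l : (1 <= l <= K)%N ->
  f (X l.+1) - f xs <= 2 * beta * norm (X 1%N - xs) ^+ 2 / l.+1%:R ^+ 2.
Proof.
(* The Lyapunov function does not increase. At the start theta = 1 removes the gap in [f], leaving
   only the initial distance. *)
have inv : (1 <= l <= K)%N ->
  theta l ^+ 2 * (f (X l.+1) - f xs) + beta / 2 * norm (u l) ^+ 2 <=
    beta / 2 * norm (X 1%N - xs) ^+ 2.
  elim: l => [//|[_ lK|l IH lK]]; apply: le_trans (fista_step lK) _.
    have -> : w 1 = X 1%N - xs by rewrite /w /= scale1r subrr scale0r subr0 XY.
    by rewrite /= subrr mulr0 mul0r add0r.
  have lK' : (1 <= l.+1 <= K)%N by case/andP: lK => _ /ltnW ->.
  have t0 : theta l.+2 != 0.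
    by rewrite gt_eqF // (lt_le_trans ltr01) // fgm_theta_ge1.
  have -> : w l.+2 = u l.+1.
    rewrite /w /u; congr (_ - xs).
    rewrite YE // scalerDr scalerA [_ * (_ / _)]mulrC divfK // addrAC -scalerBl subKr.
    by rewrite scalerBr addrA -scalerDl [1 + _]addrC subrK.
  by rewrite fgm_theta_rec //; exact: IH.
move=> lK; have l0 : (0 < l)%N by case/andP: lK.
have := inv lK; have := fgm_theta_ge l0; set t := theta l => tl h.
have lp : (0 : R) < l.+1%:R by rewrite ltr0n.
have fX : 0 <= f (X l.+1) - f xs.
  by rewrite subr_ge0; case: xsP => _; apply; apply: fista_mem; case/andP: lK => _.
have h2 : (l.+1%:R / 2) ^+ 2 * (f (X l.+1) - f xs) <= t ^+ 2 * (f (X l.+1) - f xs).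
  by rewrite ler_wpM2r // lerXn2r ?nnegrE ?(le_trans _ tl) // divr_ge0 // ltW.
have h3 : 0 <= beta / 2 * norm (u l) ^+ 2 by rewrite mulr_ge0 ?sqr_ge0 // divr_ge0 // ltW.
rewrite ler_pdivlMr ?exprn_gt0 //; lra.
Qed.

End Fista.
End Smooth.
End EuclideanGeometry.

(** * The discrete Fourier transform of tensors *)

Section Fourier.
Variable R : realType.
Local Notation C := R[i].
Local Open Scope complex_scope.

Lemma omegaX n l : omega R n ^+ l =
  cos (l%:R * (2 * pi / n%:R)) -i* sin (l%:R * (2 * pi / n%:R)).
Proof.
elim: l => [|l IH]; first by rewrite mul0r cos0 sin0 oppr0 expr0.
rewrite exprS IH; set t : R := 2 * pi / n%:R.
have -> : l.+1%:R * t = l%:R * t + t by rewrite -natr1 mulrDl mul1r.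
rewrite cosD sinD /omega -/t.
by apply/eqP; rewrite eq_complex /=; apply/andP; split; apply/eqP; ring.
Qed.

Lemma omega_expn n : (0 < n)%N -> omega R n ^+ n = 1.
Proof.
move=> n0; rewrite omegaX mulrC divfK ?pnatr_eq0 -?lt0n // mulr_natl.
by rewrite cos2pi sin2pi oppr0.
Qed.

(** With a = l pi / n in (0, pi), the real part is 1 - 2 sin(a)^2 < 1. *)
Lemma omega_neq1 n l : (0 < l < n)%N -> omega R n ^+ l != 1.
Proof.
move=> /andP[l0 ln]; have n0 : (0 : R) < n%:R by rewrite ltr0n (leq_trans _ ln).
rewrite omegaX eq_complex /= negb_and; apply/orP; left.
pose a : R := l%:R * (pi / n%:R).
have -> : l%:R * (2 * pi / n%:R) = a *+ 2 by rewrite /a -mulr_natl; ring.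
have sa : 0 < sin a.
  apply: sin_gt0_pi; rewrite /a mulr_gt0 ?divr_gt0 ?pi_gt0 ?ltr0n //=.
  rewrite mulrCA -[ltRHS]mulr1 ltr_pM2l ?pi_gt0 // ltr_pdivrMr // mul1r ltr_nat.
    exact: ln.
  exact: leq_trans ln.
rewrite cos_mulr2n cos2sin2 lt_eqF // -subr_gt0.
have := mulr_gt0 sa sa; rewrite -expr2 -mulr_natl; lra.
Qed.

Lemma omega_conj n : Num.conj (omega R n) = (omega R n)^-1.
Proof.
rewrite -[Num.conj _]/(_ +i* _); apply/eqP; rewrite eq_complex /=.
by rewrite sqrrN cos2Dsin2 !divr1 !opprK !eqxx.
Qed.

Lemma omega_neq0 n : omega R n != 0.
Proof.
rewrite eq_complex /= oppr_eq0; apply/negP => /andP[/eqP c0 /eqP s0].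
by have := cos2Dsin2 (2 * pi / n%:R : R); rewrite c0 s0; lra.
Qed.

Lemma omega_inj n a b : (a < n)%N -> (b < n)%N ->
  omega R n ^+ a = omega R n ^+ b -> a = b.
Proof.
wlog ab : a b / (a <= b)%N => [H|an bn h].
  have [ab|/ltnW ba] := leqP a b; first exact: H.
  by move=> an bn /esym h; apply/esym; apply: H.
apply/eqP; rewrite eqn_leq ab /= leqNgt; apply/negP => lt.
have := @omega_neq1 n (b - a); rewrite subn_gt0 lt (leq_ltn_trans (leq_subr _ _)) //.
move=> /(_ isT)/eqP; apply.
have w0 : omega R n ^+ a != 0 by rewrite expf_neq0 // omega_neq0.
by apply: (mulfI w0); rewrite -exprD subnKC // mulr1.
Qed.

Variables (k : nat) (ns : 'I_k -> nat).
Hypothesis ns0 : forall j, (0 < ns j)%N.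
Local Notation mindex := (mindex ns).
Local Notation N := (num_slices ns).

Definition chi (x y : mindex) : C := \prod_j omega R (ns j) ^+ (x j * y j)%N.

Lemma chiC x y : chi x y = chi y x.
Proof. by apply: eq_bigr => j _; rewrite mulnC. Qed.

Lemma chi_conj x y : Num.conj (chi x y) = \prod_j (omega R (ns j))^-1 ^+ (x j * y j)%N.
Proof.
by rewrite rmorph_prod; apply: eq_bigr => j _; rewrite rmorphXn /= omega_conj.
Qed.

Lemma chi_norm x y : Num.conj (chi x y) * chi x y = 1.
Proof.
rewrite chi_conj -big_split big1 //= => j _.
by rewrite -exprMn mulVf ?expr1n // omega_neq0.
Qed.

Definition shift_index (j : 'I_k) (y : mindex) : mindex :=
  [ffun l => if l == j then ordS (y l) else y l].

Lemma shift_index_inj j : injective (shift_index j).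
Proof.
move=> y y' /ffunP yy; apply/ffunP => l; have := yy l; rewrite !ffunE.
by case: ifP => // _ /ordS_inj.
Qed.

Lemma chi_shift j x y : chi x (shift_index j y) = omega R (ns j) ^+ x j * chi x y.
Proof.
rewrite /chi (bigD1 j) //= [in RHS](bigD1 j) //= ffunE eqxx mulrA; congr (_ * _).
  rewrite /= exprM expr_mod; last by rewrite -exprM mulnC exprM omega_expn // expr1n.
  by rewrite exprS -exprM.
by apply: eq_bigr => l /negPf lj; rewrite ffunE lj.
Qed.

(* Shifting one coordinate on which [x] and [x'] differ multiplies the sum by a
   factor other than 1. *)
Lemma chi_orth x x' : \sum_y Num.conj (chi x y) * chi x' y = (N * (x == x'))%:R.
Proof.
have [->|xx] := eqVneq x x'.
  under eq_bigr do rewrite chi_norm.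
  by rewrite sumr_const card_mindex muln1.
rewrite muln0; have [j xj] : exists j, x j != x' j.
  apply/existsP; apply: contraNT xx; rewrite negb_exists => /forallP h.
  by apply/eqP/ffunP => j; apply/eqP; have := h j; rewrite negbK.
set S := \sum_y _; set w := omega R (ns j).
have SE : S = Num.conj (w ^+ x j) * w ^+ x' j * S.
  rewrite {1}/S (reindex_inj (@shift_index_inj j)) mulr_sumr.
  by apply: eq_bigr => y _; rewrite !chi_shift rmorphM /= -/w; ring.
have w1 : Num.conj (w ^+ x j) * w ^+ x' j != 1.
  have w0 (m : nat) : w ^+ m != 0 by rewrite expf_neq0 // omega_neq0.
  rewrite rmorphXn /= omega_conj exprVn.
  apply: contraNneq xj => h.
  have {}h : w ^+ x' j = w ^+ x j.
    by rewrite -[LHS]mul1r -(mulfV (w0 (x j))) -mulrA h mulr1.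
  apply/eqP/val_inj; apply: (@omega_inj (ns j)); try exact: ltn_ord.
  exact/esym/h.
apply/eqP; move/eqP: SE; rewrite -subr_eq0 -{1}[S]mul1r -mulrBl mulf_eq0 subr_eq0.
by rewrite eq_sym (negPf w1).
Qed.

End Fourier.

(** * Inversion, Parseval and reality for the transform of tensors *)

Section TensorTransform.
Variables (R : realType) (k : nat) (ns : 'I_k -> nat) (n1 n2 : nat).
Local Notation C := R[i].
Local Notation N := (num_slices ns).
Local Notation mindex := (mindex ns).
Local Notation rtensor := (tensor R ns n1 n2).
Local Notation ctensor := (tensor C ns n1 n2).
Local Open Scope complex_scope.
Hypothesis ns0 : forall j, (0 < ns j)%N.

Definition hat (X : rtensor) : ctensor := fft (tcomplex X).

Lemma num_slices_gt0 : (0 < N)%N.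
Proof. by rewrite /num_slices prodn_gt0. Qed.

Lemma numC_neq0 : (N%:R : C) != 0.
Proof. by rewrite pnatr_eq0 -lt0n num_slices_gt0. Qed.

Lemma fftE (Z : ctensor) y : fft Z y = \sum_x chi R x y *: Z x.
Proof. by rewrite ffunE. Qed.

Lemma ifftE (Z : ctensor) x :
  ifft Z x = N%:R^-1 *: \sum_y Num.conj (chi R x y) *: Z y.
Proof.
by rewrite ffunE; congr (_ *: _); apply: eq_bigr => y _; rewrite chi_conj.
Qed.

Lemma fftK (Z : ctensor) : ifft (fft Z) = Z.
Proof.
apply/ffunP => x; rewrite ifftE.
under eq_bigr => y _ do rewrite fftE scaler_sumr.
rewrite exchange_big /= (bigD1 x) //= [X in _ + X]big1 => [|x' xx'].
  under eq_bigr => y _ do rewrite scalerA chi_norm scale1r.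
  by rewrite addr0 sumr_const card_mindex -[X in _ *: X]scaler_nat scalerA mulVf ?scale1r ?numC_neq0.
under eq_bigr => y _ do rewrite scalerA.
by rewrite -scaler_suml chi_orth // eq_sym (negPf xx') muln0 scale0r.
Qed.

Lemma ifftK (Z : ctensor) : fft (ifft Z) = Z.
Proof.
apply/ffunP => y; rewrite fftE.
under eq_bigr => x _ do rewrite ifftE scalerA [_ * _^-1]mulrC -scalerA scaler_sumr.
rewrite -scaler_sumr exchange_big /= (bigD1 y) //= [X in _ + X]big1 => [|y' yy'].
  under eq_bigr => x _ do rewrite scalerA mulrC chi_norm scale1r.
  by rewrite addr0 sumr_const card_mindex -[X in _ *: X]scaler_nat scalerA mulVf ?scale1r ?numC_neq0.
under eq_bigr => x _ do rewrite scalerA mulrC (chiC R x y) (chiC R x y').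
by rewrite -scaler_suml chi_orth // (negPf yy') muln0 scale0r.
Qed.

Lemma cdotZ_conj m n (z : C) (A B : 'M[C]_(m, n)) : cdot A (z *: B) = cdot (Num.conj z *: A) B.
Proof. by rewrite /cdot adjZ conjCK -scalemxAl -scalemxAr. Qed.

Lemma cdot_suml m n (I : finType) (F : I -> 'M[C]_(m, n)) B :
  cdot (\sum_i F i) B = \sum_i cdot (F i) B.
Proof. by rewrite cdotC cdot_sumr; apply: eq_bigr => i _; rewrite cdotC. Qed.

(** The adjoint of the transform is N times its inverse. *)
Lemma parseval (Z Z' : ctensor) :
  \sum_y cdot (fft Z y) (fft Z' y) = N%:R * \sum_x cdot (Z x) (Z' x).
Proof.
under eq_bigr => y _ do rewrite (fftE Z') cdot_sumr.
rewrite exchange_big mulr_sumr; apply: eq_bigr => x _ /=.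
under eq_bigr => y _ do rewrite cdotZ_conj.
rewrite -cdot_suml -cdotZl; congr cdot.
rewrite -[in RHS](fftK Z) ifftE scalerA rmorph_nat divff ?numC_neq0 // scale1r.
by [].
Qed.

Lemma cdot_real m n (A B : 'M[R]_(m, n)) :
  cdot (map_mx (real_complex R) A) (map_mx (real_complex R) B) = mxdot A B.
Proof.
rewrite cdotE; do 2!apply: eq_bigr => ? _.
by rewrite !mxE /re /im /= mulr0 addr0.
Qed.

Lemma numR_gt0 : 0 < N%:R :> R.
Proof. by rewrite ltr0n num_slices_gt0. Qed.

Lemma tdot_hat (X X' : rtensor) :
  tdot X X' = N%:R^-1 * \sum_y cdot (hat X y) (hat X' y).
Proof.
rewrite parseval mulrA mulVf ?gt_eqF ?numR_gt0 // mul1r.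
by apply: eq_bigr => x _; rewrite !ffunE cdot_real.
Qed.

Lemma tdot_inner_product : inner_product (@tdot R k ns n1 n2).
Proof.
have dotE (X X' : rtensor) : tdot X X' = \sum_x \sum_i \sum_j X x i j * X' x i j by [].
split.
- by move=> X X'; rewrite !dotE; do 3!apply: eq_bigr => ? _; rewrite mulrC.
- move=> X Y Z; rewrite !dotE -!big_split; apply: eq_bigr => x _.
  rewrite -big_split; apply: eq_bigr => i _; rewrite -big_split; apply: eq_bigr => j _.
  by rewrite !ffunE !mxE mulrDl.
- move=> a X Z; rewrite !dotE mulr_sumr; apply: eq_bigr => x _.
  rewrite mulr_sumr; apply: eq_bigr => i _; rewrite mulr_sumr; apply: eq_bigr => j _.
  by rewrite !ffunE !mxE mulrA.
- by move=> X; rewrite dotE; do 3!apply: sumr_ge0 => ? _; rewrite -expr2 sqr_ge0.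
- move=> X; rewrite dotE => X0; apply/ffunP => x; apply/matrixP => i j.
  rewrite !ffunE !mxE.
  have sq (a b c : _) : 0 <= X a b c * X a b c by rewrite -expr2 sqr_ge0.
  move/eqP: X0; rewrite psumr_eq0 => [/allP/(_ x (mem_index_enum x))/=|y _]; last first.
    by do 2!apply: sumr_ge0 => ? _.
  rewrite psumr_eq0 => [/allP/(_ i (mem_index_enum i))/=|y _]; last exact: sumr_ge0.
  rewrite psumr_eq0 => [/allP/(_ j (mem_index_enum j))/=|y _]; last exact: sq.
  by rewrite -expr2 sqrf_eq0 => /eqP.
Qed.

Lemma tcomplexD (X X' : rtensor) x : tcomplex (X + X') x = tcomplex X x + tcomplex X' x.
Proof. by rewrite !ffunE map_mxD. Qed.

Lemma tcomplexZ a (X : rtensor) x : tcomplex (a *: X) x = a%:C *: tcomplex X x.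
Proof. by rewrite !ffunE map_mxZ. Qed.

Lemma hatD (X X' : rtensor) y : hat (X + X') y = hat X y + hat X' y.
Proof.
rewrite /hat !fftE -big_split; apply: eq_bigr => x _.
by rewrite tcomplexD scalerDr.
Qed.

Lemma hatZ a (X : rtensor) y : hat (a *: X) y = a%:C *: hat X y.
Proof.
rewrite /hat !fftE scaler_sumr; apply: eq_bigr => x _.
by rewrite tcomplexZ !scalerA mulrC.
Qed.

Lemma hatN (X : rtensor) y : hat (- X) y = - hat X y.
Proof. by rewrite -scaleN1r hatZ rmorphN rmorph1 scaleN1r. Qed.

Lemma hatB (X X' : rtensor) y : hat (X - X') y = hat X y - hat X' y.
Proof. by rewrite hatD hatN. Qed.

Lemma conj_indexK : involutive (@conj_index k ns).
Proof.
move=> x; apply/ffunP => j; apply: val_inj; rewrite ffunE /= ffunE /=.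
have [->|xj] := posnP (x j); first by rewrite subn0 modnn subn0 modnn.
by rewrite (modn_small (_ : ns j - x j < ns j)%N) ?subKn ?modn_small // ?ltn_subrL ?xj ?ns0 // ltnW.
Qed.

(** [conj_index] is negation modulo each [ns j]; it inverts the character, whose values have modulus
    1. *)
Lemma chi_conj_index (x y : mindex) : chi R x (conj_index y) = Num.conj (chi R x y).
Proof.
rewrite chi_conj; apply: eq_bigr => j _; rewrite ffunE /= exprM.
rewrite expr_mod; last by rewrite -exprM mulnC exprM omega_expn // expr1n.
have w0 (m : nat) : omega R (ns j) ^+ m != 0 by rewrite expf_neq0 // omega_neq0.
rewrite -exprM; apply: (mulfI (w0 (x j * y j)%N)).
rewrite -exprD -mulnDr subnKC 1?ltnW // mulnC exprM omega_expn // expr1n.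
by rewrite -exprMn mulfV ?expr1n // omega_neq0.
Qed.

Lemma hat_conj (X : rtensor) y : hat X (conj_index y) = map_mx Num.conj (hat X y).
Proof.
rewrite /hat !fftE map_mx_sum; apply: eq_bigr => x _.
rewrite chi_conj_index map_mxZ; congr (_ *: _); rewrite ffunE.
by apply/matrixP => i j; rewrite !mxE; exact/esym/conjC_real.
Qed.

(** Reindexing the inverse transform by [conj_index] shows that it equals its own conjugate. Through
    this lemma slicewise constructions return to real tensors. *)
Lemma real_ifft (Z : ctensor) : (forall y, Z (conj_index y) = map_mx Num.conj (Z y)) ->
  exists X : rtensor, tcomplex X = ifft Z.
Proof.
move=> Zc; have rZ x : map_mx Num.conj (ifft Z x) = ifft Z x.
  rewrite ifftE map_mxZ fmorphV rmorph_nat map_mx_sum; congr (_ *: _).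
  rewrite [RHS](reindex_inj (inv_inj conj_indexK)) /=.
  by apply: eq_bigr => y _; rewrite map_mxZ /= conjCK chi_conj_index Zc conjCK.
move: (ifft Z) rZ => A rA; exists [ffun x => map_mx (@complex.Re R) (A x)].
apply/ffunP => x; rewrite !ffunE; apply/matrixP => i j.
move/matrixP/(_ i j): (rA x); rewrite !mxE.
case: (A x i j) => a b /eqP; rewrite eq_complex /= => /andP[_ /eqP h].
by apply/eqP; rewrite eq_complex /= eqxx /=; apply/eqP; lra.
Qed.

End TensorTransform.

(** * Singular values of block diagonal matrices *)

Section BlockDiagonal.
Variable R : realType.
Local Notation C := R[i].
Local Open Scope complex_scope.

Lemma mem_sigma m n (A : 'M[C]_(m, n)) i : (i < minn m n)%N ->
  sigma A i.+1 \in singular_values A.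
Proof. by move=> ik; rewrite /sigma /= mem_nth // size_singular_values. Qed.

Lemma singular_value_le m n (A : 'M[C]_(m, n)) v :
  v \in singular_values A -> v <= sigma A 1.
Proof.
rewrite singular_valuesE_sigma => /mapP[i _ ->]; exact: sigma_le.
Qed.

Lemma count_sigma m n (A : 'M[C]_(m, n)) (p : pred R) :
  count p (singular_values A) = (\sum_(i < minn m n) p (sigma A i.+1))%N.
Proof.
rewrite -sum1_count big_mkcond singular_valuesE_sigma big_image /=.
by apply: eq_bigr => i _; case: (p _).
Qed.

Lemma sum_ltn p l : (\sum_(i < p) ((i < l)%N : nat) = minn p l)%N.
Proof.
elim: p => [|p IH]; first by rewrite big_ord0 min0n.
by rewrite big_ord_recr /= IH; lia.
Qed.

(** Singular values of a block diagonal matrix and of its blocks are compared through counts, which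
    add up over the blocks; this leads back from a count to an ordered singular value. *)
Lemma count_le_sigma m n (A : 'M[C]_(m, n)) (c : R) l :
  (l < count (fun v => (c <= v)%R) (singular_values A))%N -> c <= sigma A l.+1.
Proof.
rewrite count_sigma leNgt => lc; apply/negP => sc; move: lc; rewrite ltnNge.
apply/negP; rewrite negbK.
rewrite (eq_bigr (fun i : 'I_(minn m n) => ((i < l)%N && (c <= sigma A i.+1) : nat))); last first.
  move=> i _; case: ltnP => //= li; rewrite leNgt (le_lt_trans _ sc) //.
  exact: sigma_le.
apply: leq_trans (_ : (\sum_(i < minn m n) ((i < l)%N : nat) <= l)%N).
  by apply: leq_sum => i _; case: (i < l)%N => //; case: (_ <= _).
by rewrite sum_ltn geq_minr.
Qed.

Definition block_diag N m n (Z : 'I_N -> 'M[C]_(m, n)) :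
    'M[C]_(\sum_(a < N) m, \sum_(a < N) n) :=
  \mxblock_(a < N, b < N) (if a == b then Z a else 0).

Lemma block_diagE N m n (Z : 'I_N -> 'M[C]_(m, n)) s t : block_diag Z s t =
  if tagnat.sig1 s == tagnat.sig1 t then Z (tagnat.sig1 s) (tagnat.sig2 s) (tagnat.sig2 t) else 0.
Proof. by rewrite mxE; case: eqP => // _; rewrite mxE. Qed.

Lemma block_diagM N m n p (Z : 'I_N -> 'M[C]_(m, n)) (Z' : 'I_N -> 'M[C]_(n, p)) :
  block_diag Z *m block_diag Z' = block_diag (fun a => Z a *m Z' a).
Proof.
rewrite mul_mxblock; apply: eq_mxblock => a b.
rewrite (bigD1 a) //= eqxx big1 ?addr0 => [|c /negPf ca].
  by case: eqP => // _; rewrite mulmx0.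
by rewrite eq_sym ca mul0mx.
Qed.

Lemma block_diag_adj N m n (Z : 'I_N -> 'M[C]_(m, n)) :
  (block_diag Z)^t* = block_diag (fun a => (Z a)^t*).
Proof.
apply/matrixP => s t; rewrite 2!mxE !block_diagE eq_sym.
by case: eqP => [<-|_]; rewrite ?rmorph0 // !mxE.
Qed.

Lemma sum_ord_eq N (n : nat) (s t : 'I_(\sum_(a < N) n)) : (s == t) =
  (tagnat.sig1 s == tagnat.sig1 t) && (tagnat.sig2 s == tagnat.sig2 t :> nat).
Proof.
apply/eqP/andP => [->//|[/eqP e1 /eqP e2]]; apply: val_inj.
by rewrite /= (tagnat.rect s) (tagnat.rect t) e1 e2.
Qed.

Lemma block_diag1 N n : block_diag (fun a : 'I_N => (1%:M : 'M[C]_n)) = 1%:M.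
Proof.
apply/matrixP => s t; rewrite block_diagE !mxE sum_ord_eq.
by case: eqP.
Qed.

Lemma rdiag_mxrow N n (d : 'I_N -> 'rV[R]_n) :
  rdiag (\mxrow_a d a) = block_diag (fun a => rdiag (d a)).
Proof.
apply/matrixP => s t; rewrite block_diagE !mxE sum_ord_eq.
by case: eqP.
Qed.

Lemma sum_mxrow N n (d : 'I_N -> 'rV[R]_n) (S : Type) (idx : S)
    (op : Monoid.com_law idx) (g : R -> S) :
  \big[op/idx]_s g ((\mxrow_a d a) 0 s) = \big[op/idx]_a \big[op/idx]_i g (d a 0 i).
Proof.
rewrite (reindex tagnat.rank); last exact: tagnat.rank_bij_on.
rewrite (sig_big_dep (fun=> true) (fun _ _ => true) (fun a (i : 'I_n) => g (d a 0 i))) /=.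
apply: eq_bigr => -[a i] _ /=; rewrite tagnat.rankE /=.
by have /rowP/(_ i) := mxrowK (fun a => d a) a; rewrite mxE => <-.
Qed.

Section SvdBlock.
Variables (N m n : nat) (Z : 'I_N -> 'M[C]_(m, n)).

(** The diagonal concatenates the singular values of the blocks, hence is not sorted globally. *)
Lemma block_diag_svd : exists U W,
  [/\ U^t* *m U = 1%:M, W^t* *m W = 1%:M
    & block_diag Z = U *m rdiag (\mxrow_a svrow (Z a)) *m W^t*].
Proof.
have [F FP] := choice (fun a => let: ex_intro U (ex_intro W h) := svd_exists (Z a) in
  ex_intro (fun UW => is_svd (Z a) UW.1 UW.2) (U, W) h.1).
exists (block_diag (fun a => (F a).1)), (block_diag (fun a => (F a).2)).
rewrite !block_diag_adj !block_diagM rdiag_mxrow !block_diagM; split.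
- rewrite -block_diag1; congr block_diag; apply/funext => a.
  by have /is_svdP[-> _ _] := FP a.
- rewrite -block_diag1; congr block_diag; apply/funext => a.
  by have /is_svdP[_ -> _] := FP a.
- congr block_diag; apply/funext => a.
  by have /is_svdP[_ _] := FP a.
Qed.

Lemma block_diag_size : (\sum_(a < N) minn m n = minn (\sum_(a < N) m) (\sum_(a < N) n))%N.
Proof. by rewrite !sum_nat_const card_ord minnMr. Qed.

Lemma mxrow_sv_ge0 s : 0 <= (\mxrow_a svrow (Z a)) 0 s.
Proof. by rewrite !mxE sigma_ge0. Qed.

Lemma count_block_diag (p : pred R) :
  count p (singular_values (block_diag Z)) =
  (\sum_a count p (singular_values (Z a)))%N.
Proof.
have [U [W [UU WW ZE]]] := block_diag_svd.
have := perm_singular_values block_diag_size UU WW mxrow_sv_ge0 ZE.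
move/seq.permP => ->; rewrite -sum1_count big_mkcond big_image /=.
rewrite (eq_bigr (fun s => nat_of_bool (p ((\mxrow_a svrow (Z a)) 0 s)))); last first.
  by move=> s _; case: (p _).
rewrite (sum_mxrow _ _ (fun v => p v : nat)); apply: eq_bigr => a _; rewrite count_sigma.
by apply: eq_bigr => i _; rewrite mxE.
Qed.

Lemma nuclear_block_diag : nuclear_norm (block_diag Z) = \sum_a nuclear_norm (Z a).
Proof.
have [U [W [UU WW ZE]]] := block_diag_svd.
rewrite (nuclear_norm_diag block_diag_size UU WW mxrow_sv_ge0 ZE).
rewrite (sum_mxrow _ _ id); apply: eq_bigr => a _; rewrite nuclear_normE.
by apply: eq_bigr => i _; rewrite mxE.
Qed.

End SvdBlock.

Lemma rank_rdiag k (d : 'rV[R]_k) : (\rank (rdiag d) <= \sum_i (d 0 i != 0)%R)%N.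
Proof.
have -> : rdiag d = \sum_i (d 0 i)%:C *: delta_mx i i.
  apply/matrixP => i j; rewrite summxE (bigD1 i) //= big1 => [|l li].
    by rewrite !mxE eqxx andTb addr0 eq_sym; case: eqP => _; rewrite ?mulr1 ?mulr0 ?mulr1n ?mulr0n.
  by rewrite !mxE eq_sym (negPf li) mulr0.
elim/big_ind2: _ => [|A a B b ha hb|i _]; first by rewrite mxrank0.
  by apply: leq_trans (mxrank_add _ _) _; apply: leq_add.
have [->|di] := eqVneq (d 0 i) 0; first by rewrite scale0r mxrank0.
by apply: leq_trans (mxrank_scale _ _) _; rewrite mxrank_delta.
Qed.

Lemma rank_block_diag N m n k (Z : 'I_N -> 'M[C]_(m, n)) (W : 'I_N -> 'M[C]_(n, k))
    (d : 'I_N -> 'rV[R]_k) :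
  (forall a, Z a = Z a *m (W a *m rdiag (d a) *m (W a)^t*)) ->
  (\rank (block_diag Z) <= \sum_a \sum_i (d a 0 i != 0)%R)%N.
Proof.
move=> ZE; rewrite (_ : block_diag Z =
  block_diag (fun a => Z a *m W a) *m rdiag (\mxrow_a d a) *m block_diag (fun a => (W a)^t*)).
  apply: leq_trans (mxrankM_maxl _ _) _; apply: leq_trans (mxrankM_maxr _ _) _.
  apply: leq_trans (rank_rdiag _) _.
  by rewrite (sum_mxrow d _ (fun x => nat_of_bool (x != 0))).
rewrite rdiag_mxrow !block_diagM; congr block_diag; apply/funext => a.
by rewrite {1}ZE !mulmxA.
Qed.

Variables (k : nat) (ns : 'I_k -> nat) (n1 n2 : nat).
Local Notation N := (num_slices ns).
Local Notation mindex := (mindex ns).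
Local Notation rtensor := (tensor R ns n1 n2).

Lemma colex_unrank_bij : bijective (@colex_unrank k ns).
Proof. exact: Bijective (@colex_unrankK k ns) (@colex_rankK k ns). Qed.

Lemma sum_colex (S : Type) (idx : S) (op : Monoid.com_law idx) (g : mindex -> S) :
  \big[op/idx]_(a < N) g (colex_unrank a) = \big[op/idx]_x g x.
Proof. by rewrite [RHS](reindex _ (onW_bij _ colex_unrank_bij)). Qed.

Lemma count_xbar (X : rtensor) (p : pred R) :
  count p (singular_values (xbar X)) =
  (\sum_x count p (singular_values (hat X x)))%N.
Proof. rewrite (count_block_diag (fun a => hat X (colex_unrank a))).
exact: (sum_colex _ (fun x => count p (singular_values (hat X x)))).
 Qed.

Lemma tnnE (X : rtensor) : tnn X = N%:R^-1 * \sum_x nuclear_norm (hat X x).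
Proof.
rewrite /tnn; congr (_ * _).
rewrite (nuclear_block_diag (fun a => hat X (colex_unrank a))).
by rewrite (sum_colex _ (fun x => nuclear_norm (hat X x))).
Qed.

Lemma rank_xbar p (X : rtensor) (W : mindex -> 'M[C]_(n2, p)) (d : mindex -> 'rV[R]_p) :
  (forall x, hat X x = hat X x *m (W x *m rdiag (d x) *m (W x)^t*)) ->
  (\rank (xbar X) <= \sum_x \sum_i (d x 0 i != 0)%R)%N.
Proof.
move=> h; rewrite -(sum_colex _ (fun x => \sum_i (d x 0 i != 0)%R)%N).
apply: (@rank_block_diag _ _ _ _ (fun a => hat X (colex_unrank a))
  (fun a => W (colex_unrank a)) (fun a => d (colex_unrank a))) => a.
exact: h.
Qed.

End BlockDiagonal.

(** * Projection onto the nuclear norm ball *)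

Section TruncatedProjection.
Import numFieldNormedType.Exports.
Variables (R : realType) (k : nat) (ns : 'I_k -> nat) (n1 n2 : nat).
Local Notation C := R[i].
Local Notation N := (num_slices ns).
Local Notation mindex := (mindex ns).
Local Notation rtensor := (tensor R ns n1 n2).
Local Open Scope complex_scope.
Hypothesis ns0 : forall j, (0 < ns j)%N.
Local Notation ball := (@tnn_ball R k ns n1 n2).
Local Notation dot := (@tdot R k ns n1 n2).
Local Notation kk := (minn n1 n2).
Implicit Types P Q Z : rtensor.

Definition spectral_map m n (h : R -> R) (A : 'M[C]_(m, n)) U W : 'M[C]_(m, n) :=
  U *m rdiag (\row_(i < minn m n) h (sigma A i.+1)) *m W^t*.

(** One choice of SVDs serves all functions [h]. Conjugate slices have conjugate factors and equal
    singular values, so the modified slices transform back to a real tensor. *)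
Lemma spectral_calculus P :
  exists (U : mindex -> 'M[C]_(n1, kk)) (W : mindex -> 'M[C]_(n2, kk)),
  [/\ forall x, is_svd (hat P x) (U x) (W x),
      forall x y, hat P y = map_mx Num.conj (hat P x) ->
        U y = map_mx Num.conj (U x) /\ W y = map_mx Num.conj (W x)
    & forall h, exists Q, forall x, hat Q x = spectral_map h (hat P x) (U x) (W x)].
Proof.
have [U [W UW]] := @svd_conj_choice R n1 n2.
exists (fun x => U (hat P x)), (fun x => W (hat P x)); split.
- by move=> x; have [] := UW (hat P x).
- by move=> x y ->; have [_ -> ->] := UW (hat P x).
move=> h; pose Zt : tensor C ns n1 n2 :=
  [ffun x => spectral_map h (hat P x) (U (hat P x)) (W (hat P x))].
have ZtE x : Zt x = spectral_map h (hat P x) (U (hat P x)) (W (hat P x)).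
  exact: ffunE.
have [|Q QE] := @real_ifft R k ns n1 n2 ns0 Zt.
  move=> y; rewrite !ZtE hat_conj // /spectral_map.
  have [_ -> ->] := UW (hat P y); rewrite !map_mxM adj_conj rdiag_conj.
  rewrite (_ : \row_i _ = \row_i h (sigma (hat P y) i.+1)) //.
  by apply/rowP => i; rewrite !mxE sigma_conj.
by exists Q => x; rewrite {1}/hat QE ifftK.
Qed.

Lemma cdot_spectral m n k' (U : 'M[C]_(m, k')) (W : 'M[C]_(n, k')) (d e : 'rV[R]_k') :
  U^t* *m U = 1%:M -> W^t* *m W = 1%:M ->
  cdot (U *m rdiag d *m W^t*) (U *m rdiag e *m W^t*) = \sum_i d 0 i * e 0 i.
Proof.
move=> UU WW; rewrite cdot_svd; apply: eq_bigr => j _.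
rewrite (_ : _ *m col j W = (d 0 j)%:C *: col j U).
  by rewrite cdotZl -/(fsq _) fsq_col_isometry // mulr1 mulrC.
rewrite -col_mulmx -mulmxA WW mulmx1; apply/colP => i.
by rewrite [LHS]mxE mul_rdiagE mulrC !mxE.
Qed.

Definition soft (s v : R) := Num.max 0 (v - s).

Lemma soft_ge0 s v : 0 <= soft s v.
Proof. by rewrite le_max lexx. Qed.

Lemma soft_eq0 s v : v <= s -> soft s v = 0.
Proof. by move=> vs; rewrite /soft max_l // subr_le0. Qed.

Lemma soft_mono s t v : s <= t -> soft t v <= soft s v.
Proof. by move=> st; rewrite /soft ge_max !le_max lexx /= lerB ?orbT. Qed.

Definition soft_sum P s := \sum_x \sum_(i < kk) soft s (sigma (hat P x) i.+1).

Lemma soft_sum_continuous P : continuous (soft_sum P).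
Proof.
have sumc (I : Type) (r : seq I) (f : I -> R -> R) :
    (forall i, continuous (f i)) -> continuous (fun t => \sum_(i <- r) f i t).
  move=> h; elim: r => [|i r IH].
    under eq_fun do rewrite big_nil.
    by move=> t; exact: cvg_cst.
  under eq_fun do rewrite big_cons.
  by move=> t; apply: cvgD; [exact: h | exact: IH].
apply: (sumc) => x; apply: (sumc) => i; move: (sigma _ _) => s.
have -> : (fun t : R => soft t s) = (fun t => ((s - t) + `|s - t|) / 2).
  apply/funext => t; rewrite /soft.
  by case: (leP 0 (s - t)) => h; [rewrite ger0_norm // | rewrite ltr0_norm //]; lra.
move=> t; apply: cvgM; last exact: cvg_cst.
have h : (s - x) @[x --> t] --> s - t by apply: cvgB; [exact: cvg_cst | exact: cvg_id].
by apply: cvgD => //; exact: cvg_norm.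
Qed.

(** Intermediate value theorem: the mass is continuous and vanishes at [M], which exceeds all
    singular values of all slices. *)
Lemma soft_sum_hits P t : N%:R <= soft_sum P t -> exists2 s, t <= s & soft_sum P s = N%:R.
Proof.
move=> Nt; pose M := Num.max t (\sum_x sigma (hat P x) 1).
have tM : t <= M by rewrite le_max lexx.
have M0 : soft_sum P M = 0.
  rewrite /soft_sum big1 // => x _; rewrite big1 // => i _; apply: soft_eq0.
  rewrite le_max; apply/orP; right; apply: le_trans (_ : sigma (hat P x) 1 <= _).
    exact: sigma_le.
  rewrite (bigD1 x) //= lerDl; apply: sumr_ge0 => y _; exact: sigma_ge0.
have [||s st sE] := @IVT R (soft_sum P) t M N%:R tM.
- exact/continuous_subspaceT/soft_sum_continuous.
- by rewrite M0 ge_min le_max Nt ler0n orbT.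
by exists s => //; move: st; rewrite in_itv /= => /andP[].
Qed.

Section Shrink.
Variables (P Q : rtensor) (U : mindex -> 'M[C]_(n1, kk)) (W : mindex -> 'M[C]_(n2, kk)) (s : R).
Hypotheses (sP : forall x, is_svd (hat P x) (U x) (W x)) (s0 : 0 <= s).
Hypothesis QE : forall x, hat Q x = spectral_map (soft s) (hat P x) (U x) (W x).
Hypothesis PN : soft_sum P s = N%:R.

Lemma nuclear_shrink x : nuclear_norm (hat Q x) = \sum_(i < kk) soft s (sigma (hat P x) i.+1).
Proof.
have /is_svdP[UU WW _] := sP x.
rewrite QE (nuclear_norm_diag erefl UU WW _ erefl) => [|i]; last by rewrite mxE soft_ge0.
by apply: eq_bigr => i _; rewrite mxE.
Qed.

Lemma shrink_residual x : hat (P - Q) x =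
  U x *m rdiag (\row_i Num.min s (sigma (hat P x) i.+1)) *m (W x)^t*.
Proof.
have /is_svdP[_ _ PE] := sP x.
rewrite hatB QE {1}PE -mulmxBl -mulmxBr; congr (_ *m _ *m _).
rewrite /rdiag -raddfB; congr diag_mx; apply/rowP => i; rewrite !mxE -rmorphB /soft.
by congr (_%:C); case: (leP s (sigma (hat P x) i.+1)) => h;
  [rewrite max_r ?subr_ge0 // subKr | rewrite max_l ?subr0 // subr_le0 ltW].
Qed.

Lemma shrink_in_ball : ball Q.
Proof.
rewrite /tnn_ball /= tnnE; under eq_bigr do rewrite nuclear_shrink.
by rewrite -/(soft_sum P s) PN mulVf // gt_eqF // numR_gt0.
Qed.

(** The slices of the residual have singular values min(s, sigma_i), so duality gives <P - Q, Z> <=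
    s. Wherever [Q] has a nonzero singular value the residual has the value [s], and the total mass
    N gives <P - Q, Q> >= s. *)
Lemma shrink_variational Z : ball Z -> dot (P - Q) (Z - Q) <= 0.
Proof.
move=> Zb; have ip := @tdot_inner_product R k ns n1 n2.
have N0 : 0 <= (N%:R : R)^-1 by rewrite invr_ge0 ltW // numR_gt0.
rewrite (dotDr ip) (dotNr ip) subr_le0; apply: le_trans (_ : s <= _).
  apply: le_trans (_ : s * tnn Z <= _); last by rewrite -[leRHS]mulr1 ler_wpM2l.
  rewrite tdot_hat // tnnE mulrCA ler_wpM2l // mulr_sumr; apply: ler_sum => x _.
  apply: cdot_le_nuclear => //; rewrite shrink_residual.
  have /is_svdP[UU WW _] := sP x; apply: opbound_diag => // i.
  by rewrite mxE ger0_norm ?ge_min ?lexx // le_min s0 sigma_ge0.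
rewrite tdot_hat //; have -> : s = N%:R^-1 * (s * N%:R).
  by rewrite mulrCA mulVf ?mulr1 // gt_eqF // numR_gt0.
rewrite ler_wpM2l // -PN mulr_sumr; apply: ler_sum => x _.
have /is_svdP[UU WW _] := sP x.
rewrite shrink_residual QE cdot_spectral // mulr_sumr; apply: ler_sum => i _.
rewrite !mxE /soft; case: (leP s (sigma (hat P x) i.+1)) => h //.
by rewrite max_l ?mulr0 // subr_le0 ltW.
Qed.

End Shrink.

Definition gap_condition r P := exists2 t, 0 <= t &
  (forall x, sigma (hat P x) r.+1 <= t) /\ N%:R <= soft_sum P t.

Lemma sum_below r P x s : (r <= kk)%N -> sigma (hat P x) r.+1 <= s ->
  \sum_(i < kk) soft s (sigma (hat P x) i.+1) = \sum_(i < r) soft s (sigma (hat P x) i.+1).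
Proof.
move=> rk st.
rewrite (big_ord_widen kk (fun i => soft s (sigma (hat P x) i.+1)) rk).
rewrite [LHS](bigID (fun i : 'I_kk => (i < r)%N)) /= [X in _ + X]big1 ?addr0 // => i.
rewrite -leqNgt => ri; apply: soft_eq0; apply: le_trans st; exact: sigma_le.
Qed.

Lemma svd_sumE m n k' (U : 'M[C]_(m, k')) (W : 'M[C]_(n, k')) (d : 'rV[R]_k') :
  U *m rdiag d *m W^t* = \sum_i (d 0 i)%:C *: (col i U *m (col i W)^t*).
Proof.
apply/matrixP => a b; rewrite !mxE summxE; apply: eq_bigr => j _.
by rewrite mul_rdiagE !mxE big_ord1 !mxE mulrA [_ * U _ _]mulrC.
Qed.

Lemma trunc_sumE r P U W s x : (forall x, sigma (hat P x) r.+1 <= s) ->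
  \sum_(i < kk | (i < r)%N)
     (Num.max 0 (sigma (hat P x) i.+1 - s))%:C *: (col i (U x) *m (col i (W x))^t*) =
  spectral_map (soft s) (hat P x) (U x) (W x).
Proof.
move=> st; rewrite /spectral_map svd_sumE [RHS](bigID (fun i : 'I_kk => (i < r)%N)) /=.
rewrite [X in _ + X]big1 ?addr0 => [|i].
  by apply: eq_bigr => i _; rewrite mxE.
rewrite -leqNgt => ri; rewrite mxE soft_eq0 ?scale0r //.
by apply: le_trans (st x); exact: sigma_le.
Qed.

Section Gap.
Variables (r : nat) (P : rtensor).
Hypotheses (rk : (r < kk)%N) (gap : gap_condition r P).

Lemma trunc_shrink Q : trunc_proj r 1 P Q -> exists U W s,
  [/\ forall x, is_svd (hat P x) (U x) (W x), 0 <= s, soft_sum P s = N%:R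
    & forall x, hat Q x = spectral_map (soft s) (hat P x) (U x) (W x)].
Proof.
move=> [U [W [s [sP _ s0 sN QE]]]]; exists U, W, s.
have {}sN : \sum_x \sum_(i < r) soft s (sigma (hat P x) i.+1) = N%:R.
  move/(congr1 (fun v => N%:R * v)): sN; rewrite mulrA mulfV ?gt_eqF ?numR_gt0 //.
  rewrite mul1r mulr1 => <-; apply: eq_bigr => x _.
  by rewrite big_add1 big_mkord.
have [t t0 [tr tN]] := gap.
(* Only the truncated mass is known to be N at [s]. If s < t, it would dominate the mass at [t],
   which is at least N, so all thresholded terms would agree; as thresholding decreases strictly
   where it is positive, the mass at [t] would be 0. *)
have ts : t <= s.
  rewrite leNgt; apply/negP => st.
  have tE : soft_sum P t = \sum_x \sum_(i < r) soft t (sigma (hat P x) i.+1).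
    by apply: eq_bigr => x _; apply: sum_below => //; exact: ltnW.
  have le_term x (i : 'I_r) : 0 <= soft s (sigma (hat P x) i.+1) - soft t (sigma (hat P x) i.+1).
    by rewrite subr_ge0 soft_mono // ltW.
  have : \sum_x \sum_(i < r) (soft s (sigma (hat P x) i.+1) - soft t (sigma (hat P x) i.+1)) = 0.
    apply/eqP; rewrite eq_le; apply/andP; split; last first.
      by apply: sumr_ge0 => x _; apply: sumr_ge0.
    under eq_bigr do rewrite sumrB.
    by rewrite sumrB sN -tE subr_le0.
  move/eqP; rewrite psumr_eq0 => [/allP xz|x _]; last exact: sumr_ge0.
  have : soft_sum P t = 0.
    rewrite tE big1 // => x _; rewrite big1 // => i _; apply: soft_eq0.
    have := xz x (mem_index_enum x); rewrite /= psumr_eq0 // => /allP /(_ i (mem_index_enum i)) /=.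
    rewrite subr_eq0 /soft => /eqP h; rewrite leNgt; apply/negP => ti; move: h.
    rewrite !max_r ?subr_ge0 ?ltW // ?(lt_trans st) //; lra.
  by move=> h; move: tN; rewrite h leNgt numR_gt0.
have sr x : sigma (hat P x) r.+1 <= s by apply: le_trans (tr x) ts.
split=> //.
  by rewrite -sN; apply: eq_bigr => x _; apply: sum_below => //; exact: ltnW.
by move=> x; rewrite /hat QE ifftK // ffunE -/(hat P) trunc_sumE.
Qed.

Lemma trunc_variational Q : trunc_proj r 1 P Q ->
  ball Q /\ forall Z, ball Z -> dot (P - Q) (Z - Q) <= 0.
Proof.
move=> /trunc_shrink[U [W [s [sP s0 sN QE]]]]; split.
  exact: shrink_in_ball sP QE sN.
exact: shrink_variational sP s0 QE sN.
Qed.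

Lemma trunc_exists : exists Q, trunc_proj r 1 P Q.
Proof.
have [t t0 [tr tN]] := gap; have [s ts sN] := soft_sum_hits tN.
have [U [W [sP cUW hP]]] := spectral_calculus P; have [Q QE] := hP (soft s).
have sr x : sigma (hat P x) r.+1 <= s by apply: le_trans (tr x) ts.
exists Q, U, W, s; split=> //; first exact: le_trans ts.
  rewrite (_ : \sum_x _ = N%:R) ?mulVf ?gt_eqF ?numR_gt0 // -sN.
  apply: eq_bigr => x _; rewrite big_add1 big_mkord -/(hat P) (sum_below _ (sr x)) //.
  exact: ltnW.
rewrite -[LHS](fftK ns0); congr ifft; apply/ffunP => x.
by apply: etrans (QE x) _; rewrite [RHS]ffunE -/(hat P) trunc_sumE.
Qed.

(** From right to left, some truncated output exists and is a projection, and projections are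
    unique. *)
Lemma trunc_projE Q : trunc_proj r 1 P Q <-> is_proj dot ball P Q.
Proof.
have ip := @tdot_inner_product R k ns n1 n2; split=> [/trunc_variational[Qb Qv]|Qp].
  exact: variational_proj.
have [Q' tQ'] := trunc_exists; have [Qb Qv] := trunc_variational tQ'.
by rewrite (proj_unique ip Qb Qv Qp).
Qed.

End Gap.

Lemma tnn_triangle (X Y : rtensor) : tnn (X + Y) <= tnn X + tnn Y.
Proof.
rewrite !tnnE -mulrDr ler_wpM2l ?invr_ge0 ?(ltW (numR_gt0 R ns0)) // -big_split.
by apply: ler_sum => x _; rewrite hatD; exact: nuclear_norm_triangle.
Qed.

Lemma tnnZ a (X : rtensor) : 0 <= a -> tnn (a *: X) = a * tnn X.
Proof.
move=> a0; rewrite !tnnE mulrCA; congr (_ * _); rewrite mulr_sumr.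
by apply: eq_bigr => x _; rewrite hatZ nuclear_normZ.
Qed.

Lemma ball_convex : convex_set ball.
Proof.
move=> X Y t Xb Yb /andP[t0 t1]; have t1' : 0 <= 1 - t by rewrite subr_ge0.
apply: le_trans (tnn_triangle _ _) _; rewrite !tnnZ //.
apply: le_trans (_ : t * 1 + (1 - t) * 1 <= _); last by rewrite !mulr1 subrKC.
exact: (lerD (ler_wpM2l t0 (Xb : tnn X <= 1)) (ler_wpM2l t1' (Yb : tnn Y <= 1))).
Qed.

Lemma sum_fsq_hat X : \sum_x fsq (hat X x) = N%:R * enorm dot X ^+ 2.
Proof.
have ip := @tdot_inner_product R k ns n1 n2.
by rewrite enorm_sqr // tdot_hat // mulrA mulfV ?mul1r // gt_eqF // numR_gt0.
Qed.

(** By Parseval N |X|^2 is the sum of the squared Frobenius norms of the slices, at most the square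
    of the sum of their nuclear norms, hence at most N^2. *)
Lemma ball_enorm X : ball X -> enorm dot X <= Num.sqrt N%:R.
Proof.
have ip := @tdot_inner_product R k ns n1 n2; have N0 := numR_gt0 R ns0.
rewrite /tnn_ball /= tnnE mulrC ler_pdivrMr // mul1r => Xb.
apply: ler_wsqrtr; rewrite -(ler_pM2l N0) -enorm_sqr // -sum_fsq_hat -expr2.
apply: le_trans (_ : (\sum_x nuclear_norm (hat X x)) ^+ 2 <= _); last first.
  by rewrite lerXn2r // nnegrE ?(ltW N0) //; apply: sumr_ge0 => x _; exact: nuclear_norm_ge0.
rewrite expr2 mulr_suml; apply: ler_sum => x _.
apply: le_trans (fsq_le_nuclear _) _; rewrite expr2 ler_wpM2l ?nuclear_norm_ge0 //.
by rewrite (bigD1 x) //= lerDl; apply: sumr_ge0 => y _; exact: nuclear_norm_ge0.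
Qed.

End TruncatedProjection.

(** * Structure of the optimal solution *)

Section Optimality.
Variables (R : realType) (k : nat) (ns : 'I_k -> nat) (n1 n2 : nat).
Local Notation C := R[i].
Local Notation N := (num_slices ns).
Local Notation mindex := (mindex ns).
Local Notation rtensor := (tensor R ns n1 n2).
Local Open Scope complex_scope.
Hypothesis ns0 : forall j, (0 < ns j)%N.
Local Notation ball := (@tnn_ball R k ns n1 n2).
Local Notation dot := (@tdot R k ns n1 n2).
Local Notation kk := (minn n1 n2).

Lemma is_svdN m n (A : 'M[C]_(m, n)) (U : 'M[C]_(m, minn m n)) W :
  is_svd A U W -> singular_values (- A) = singular_values A /\ is_svd (- A) (- U) W.
Proof.
move=> /is_svdP[UU WW AE].
have NUU : (- U)^t* *m (- U) = 1%:M.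
  by rewrite -scaleN1r adjZ -scalemxAl -scalemxAr scalerA rmorphN rmorph1 mulrNN mulr1 scale1r.
have NE : - A = - U *m rdiag (svrow A) *m W^t* by rewrite {1}AE !mulNmx.
have sv0 j : 0 <= svrow A 0 j by rewrite mxE sigma_ge0.
have svE : singular_values (- A) = singular_values A.
  by rewrite (singular_valuesE erefl NUU WW sv0 NE) (singular_valuesE erefl UU WW sv0 AE).
split=> //; apply/is_svdP; split=> //; rewrite (_ : svrow (- A) = svrow A) //.
by apply/rowP => i; rewrite !mxE /sigma svE.
Qed.

Lemma singular_valuesN m n (A : 'M[C]_(m, n)) : singular_values (- A) = singular_values A.
Proof. by have [U [W [/is_svdN[]]]] := svd_exists A. Qed.

Lemma sigmaN m n (A : 'M[C]_(m, n)) i : sigma (- A) i = sigma A i.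
Proof. by rewrite /sigma singular_valuesN. Qed.

Variables (G Xs : rtensor).
Let s1 := sigma (xbar G) 1.
Hypotheses (k0 : (0 < kk)%N) (s1_gt0 : 0 < s1).
Hypotheses (Xb : ball Xs) (Xopt : forall Z, ball Z -> 0 <= dot G (Z - Xs)).

Definition top_mult x := count_mem (sigma (xbar G) 1) (singular_values (hat G x)).
Definition total_mult := (\sum_x top_mult x)%N.
Local Notation cnt := top_mult.
Local Notation S := total_mult.

Lemma mem_xbar x v : v \in singular_values (hat G x) -> v \in singular_values (xbar G).
Proof.
rewrite -!has_pred1 !has_count count_xbar => vx.
by apply: leq_trans vx _; rewrite (bigD1 x) //= leq_addr.
Qed.

Lemma sigma_hat_le x i : sigma (hat G x) i <= s1.
Proof.
apply: le_trans (_ : sigma (hat G x) 1 <= s1).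
  by case: i => [|i]; [rewrite /sigma | exact: sigma_le].
by apply/singular_value_le/(@mem_xbar x)/mem_sigma.
Qed.

Lemma total_multE : S = mult_sigma1 (xbar G).
Proof. by rewrite /mult_sigma1 count_xbar. Qed.

Lemma total_mult_gt0 : (0 < S)%N.
Proof.
rewrite total_multE /mult_sigma1 -has_count has_pred1; apply: mem_sigma.
rewrite /brows /bcols !sum_nat_const card_ord -minnMr muln_gt0 k0 andbT.
exact: num_slices_gt0.
Qed.

Lemma hatNG x : hat (- G) x = - hat G x.
Proof. exact: hatN. Qed.

Lemma top_multN x : count_mem s1 (singular_values (hat (- G) x)) = cnt x.
Proof. by rewrite hatNG singular_valuesN. Qed.

(** The mass N is spread evenly over all [S] top singular pairs of all slices of [- G]. The weight N
    / S then depends on the singular value alone, so the result is a real tensor. *)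
Lemma dual_attained : exists2 Z, ball Z & dot (- G) Z = s1.
Proof.
have N0 := numR_gt0 R ns0; have S0 : 0 < S%:R :> R by rewrite ltr0n total_mult_gt0.
have [U [W [sP _ hP]]] := spectral_calculus ns0 (- G).
pose h v : R := N%:R / S%:R * (v == s1)%:R.
have [Z ZE] := hP h.
have sumh x : \sum_(i < kk) h (sigma (hat (- G) x) i.+1) = N%:R / S%:R * (cnt x)%:R.
  rewrite -mulr_sumr -(top_multN x) -(top_count (hat (- G) x) s1); congr (_ * _).
  by apply: eq_bigr => i _; rewrite mxE.
have h0 v : 0 <= h v by rewrite mulr_ge0 ?ler0n // divr_ge0 ?ler0n.
have SE : \sum_x (cnt x)%:R = S%:R :> R by rewrite /total_mult natr_sum.
exists Z.
  rewrite /tnn_ball /= tnnE.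
  rewrite (eq_bigr (fun x => N%:R / S%:R * (cnt x)%:R)) => [|x _].
    rewrite -mulr_sumr SE divfK ?gt_eqF // mulVf // gt_eqF //.
  have /is_svdP[UU WW _] := sP x.
  rewrite ZE (nuclear_norm_diag erefl UU WW _ erefl) => [|i]; last by rewrite mxE.
  by rewrite -sumh; apply: eq_bigr => i _; rewrite mxE.
rewrite tdot_hat // (eq_bigr (fun x => s1 * (N%:R / S%:R * (cnt x)%:R))) => [|x _].
  rewrite -!mulr_sumr SE divfK ?gt_eqF // mulrCA mulVf ?mulr1 // gt_eqF //.
have /is_svdP[UU WW GE] := sP x.
rewrite ZE {1}GE cdot_spectral // -sumh mulr_sumr.
apply: eq_bigr => i _; rewrite !mxE /h.
by case: eqP => [->|_]; rewrite ?mulr0.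
Qed.

(** Optimality against the maximizer and duality squeeze <- G, Xs> between s1 and s1 * [tnn Xs] <=
    s1; the nonnegative defects of the slices then vanish one by one. *)
Lemma optimal_dual : tnn Xs = 1 /\
  forall x, cdot (hat (- G) x) (hat Xs x) = s1 * nuclear_norm (hat Xs x).
Proof.
have ip := @tdot_inner_product R k ns n1 n2; have N0 := numR_gt0 R ns0.
have [Z Zb ZE] := dual_attained.
have ge : s1 <= dot (- G) Xs.
  have := Xopt Zb; rewrite -ZE (dotDr ip) !(dotNl ip) (dotNr ip); lra.
have term x : 0 <= s1 * nuclear_norm (hat Xs x) - cdot (hat (- G) x) (hat Xs x).
  rewrite subr_ge0; apply: cdot_le_nuclear; first exact: ltW.
  apply: opbound_sigma => i; rewrite hatNG sigmaN; exact: sigma_hat_le.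
have le : dot (- G) Xs <= s1 * tnn Xs.
  rewrite tdot_hat // tnnE mulrCA ler_pM2l ?invr_gt0 // mulr_sumr.
  by apply: ler_sum => x _; rewrite -subr_ge0.
have Xb1 : tnn Xs <= 1 := Xb.
have X1 : tnn Xs = 1.
  apply/eqP; rewrite eq_le Xb1 /= -(ler_pM2l s1_gt0) mulr1.
  exact: le_trans ge le.
split=> // x; apply/esym/eqP; rewrite -subr_eq0.
have : \sum_x (s1 * nuclear_norm (hat Xs x) - cdot (hat (- G) x) (hat Xs x)) == 0.
  rewrite eq_le; apply/andP; split; last by apply: sumr_ge0.
  rewrite sumrB subr_le0 -mulr_sumr.
  have h1 : \sum_x nuclear_norm (hat Xs x) = N%:R.
    by move: X1; rewrite tnnE => /(congr1 (fun v => N%:R * v));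
      rewrite mulrA mulfV ?gt_eqF // mul1r mulr1.
  have h2 : \sum_x cdot (hat (- G) x) (hat Xs x) = N%:R * dot (- G) Xs.
    by rewrite tdot_hat // mulrA mulfV ?gt_eqF // mul1r.
  by rewrite h1 h2 mulrC ler_pM2l.
by rewrite psumr_eq0 // => /allP /(_ x (mem_index_enum x)).
Qed.

Lemma top_index_lt x (i : 'I_kk) : sigma (hat (- G) x) i.+1 = s1 -> (i < cnt x)%N.
Proof.
move=> si; rewrite -top_multN count_sigma.
rewrite -[leqLHS](minn_idPr (ltn_ord i)) -sum_ltn.
apply: leq_sum => j _; case: ltnP => //= ji.
suff -> : sigma (hat (- G) x) j.+1 == s1 by [].
rewrite eq_le hatNG sigmaN sigma_hat_le /= -(sigmaN (hat G x)) -hatNG -si.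
exact: sigma_le.
Qed.

Section KeyLemma.
Variables (beta : R) (P : rtensor).
Hypothesis b0 : 0 < beta.
Let E := P - (Xs - beta^-1 *: G).
Let eps := Num.sqrt (N%:R * enorm dot E ^+ 2).
Variables (r f j : nat) (c0 : R).
Hypotheses (rk : (r < kk)%N) (j0 : (0 < j)%N) (fj : (f + j = r.+1)%N).
Hypotheses (cf : forall x, (cnt x <= f)%N) (c00 : 0 <= c0).
Hypothesis sc : forall x, sigma (hat G x) f.+1 <= c0.
Hypothesis small : eps * ((Num.sqrt j%:R)^-1 + (Num.sqrt S%:R)^-1) <= (s1 - c0) / beta.

Lemma hat_decomp x : hat P x = hat Xs x + beta^-1%:C *: hat (- G) x + hat E x.
Proof.
have -> : P = Xs + beta^-1 *: (- G) + E.
  by rewrite /E scalerN addrC subrK.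
by rewrite !hatD hatZ.
Qed.

(** Weyl with f + j = r + 1 bounds sigma_(r+1) of the slices by t = c0 / beta + eps / sqrt j.
    Testing with the partial isometries of [- G] gives mass at least N + S (s1 / beta - t) - eps
    sqrt S, and [small] says that this is at least N. *)
Lemma gap_condition_of_close : gap_condition r P.
Proof.
have N0 := numR_gt0 R ns0; have S0 : 0 < S%:R :> R by rewrite ltr0n total_mult_gt0.
have [X1 AX] := optimal_dual.
have nucX : \sum_x nuclear_norm (hat Xs x) = N%:R.
  by move: X1; rewrite tnnE => /(congr1 (fun v => N%:R * v));
      rewrite mulrA mulfV ?gt_eqF // mul1r mulr1.
have eps0 : 0 <= eps by exact: sqrtr_ge0.
have epsE : \sum_x fsq (hat E x) = eps ^+ 2.
  by rewrite sum_fsq_hat // /eps [RHS]sqr_sqrtr // mulr_ge0 ?sqr_ge0 // ltW.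
have [U [W [sG _ _]]] := spectral_calculus ns0 (- G).
have As x i : sigma (hat (- G) x) i <= s1 by rewrite hatNG sigmaN sigma_hat_le.
have TE x := trace_equality (sG x) s1_gt0 (As x) (AX x).
pose t := c0 / beta + eps / Num.sqrt j%:R.
have t0 : 0 <= t by rewrite addr_ge0 // divr_ge0 ?sqrtr_ge0 // ltW.
exists t => //; split.
  move=> x; rewrite -fj hat_decomp.
  have wf := @weyl_frobenius R n1 n2 f j (hat Xs x + beta^-1%:C *: hat (- G) x) (hat E x)
    (lead_cols (W x) f) (c0 / beta).
  apply: le_trans (wf _ j0 _ _) _.
  - by rewrite divr_ge0 // ltW.
  - by rewrite fj.
  (* The slice of [Xs] factors through the top right singular space, spanned by at most [f] leading
     directions, so it vanishes on [v]; only the gradient part acts there, with gain at most c0 /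
     beta. *)
  - move=> v Fv; rewrite mulmxDl.
    have -> : hat Xs x *m v = 0.
      have [-> _] := TE x; rewrite -!mulmxA (_ : rdiag _ *m _ = 0) ?mulmx0 //.
      apply/colP => i; rewrite rdiag_mulE mxE [RHS]mxE.
      case: eqP => [si|_]; last by rewrite mul0r.
      rewrite (lead_cols_orth _ Fv) ?mulr0 //.
      by apply: leq_trans (cf x); apply: top_index_lt.
    rewrite add0r -scalemxAl fsqZ.
    have -> : (c0 / beta) ^+ 2 * fsq v = beta^-1 ^+ 2 * (c0 ^+ 2 * fsq v) by ring.
    rewrite ler_wpM2l ?sqr_ge0 //.
    apply: le_trans (lead_cols_bound (sG x) Fv) _.
    rewrite ler_wpM2r ?fsq_ge0 // lerXn2r ?nnegrE ?sigma_ge0 //.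
    by rewrite hatNG sigmaN.
  - rewrite lerD2l ler_wpM2r ?invr_ge0 ?sqrtr_ge0 // /eps ler_wsqrtr //.
    rewrite -sum_fsq_hat // (bigD1 x) //= lerDl; apply: sumr_ge0 => y _; exact: fsq_ge0.
pose B x := top_factor (hat (- G) x) (U x) (W x) s1.
have low : \sum_x (cdot (B x) (hat P x) - t * (cnt x)%:R) <= soft_sum P t.
  apply: ler_sum => x _; rewrite lerBlDr -(top_multN x) -(top_factor_nuclear (sG x) s1).
  apply: soft_threshold_bound => //; exact: top_factor_opbound.
apply: le_trans low.
have SE : \sum_x (cnt x)%:R = S%:R :> R by rewrite /total_mult natr_sum.
rewrite sumrB -mulr_sumr SE.
rewrite (eq_bigr (fun x =>
  nuclear_norm (hat Xs x) + s1 / beta * (cnt x)%:R - cdot (B x) (- hat E x))); last first.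
  move=> x _; rewrite hat_decomp !cdotDr cdotZr cdotNr opprK.
  have [_ ->] := TE x; rewrite (top_factor_dot (sG x)) top_multN; congr (_ + _ + _).
  by rewrite mulrA [_ * s1]mulrC.
rewrite sumrB big_split /= nucX -mulr_sumr SE.
(* Cauchy-Schwarz over all slices at once, with weight eps / sqrt S; eps = 0 is treated apart
   because the weight must be positive. *)
have cs : \sum_x cdot (B x) (- hat E x) <= eps * Num.sqrt S%:R.
  have fB : \sum_x fsq (B x) = S%:R.
    by rewrite -SE; apply: eq_bigr => x _; rewrite (top_factor_fsq (sG x)) top_multN.
  have sS : 0 < Num.sqrt S%:R :> R by rewrite sqrtr_gt0.
  have sS2 : Num.sqrt S%:R ^+ 2 = S%:R :> R by rewrite sqr_sqrtr // ltW.
  have [e0|e0] := eqVneq eps 0.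
    rewrite e0 mul0r big1 // => x _.
    suff -> : hat E x = 0 by rewrite oppr0 cdotC cdot0l.
    apply: fsq_eq0; move/eqP: epsE; rewrite e0 expr0n psumr_eq0 => [|y _]; last exact: fsq_ge0.
    by move=> /allP /(_ x (mem_index_enum x)) /eqP.
  have ep : 0 < eps by rewrite lt_neqAle eq_sym e0.
  apply: le_trans (_ : \sum_x (eps / Num.sqrt S%:R / 2 * fsq (B x) +
      (2 * (eps / Num.sqrt S%:R))^-1 * fsq (hat E x)) <= _).
    apply: ler_sum => x _; rewrite -(fsqN (hat E x)); apply: cdot_amgm.
    exact: divr_gt0.
  rewrite big_split /= -!mulr_sumr fB epsE.
  rewrite le_eqVlt; apply/orP; left; apply/eqP.
  move: (Num.sqrt S%:R) sS sS2 => a a0 <-.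
  by field; rewrite !gt_eqF.
have sS : 0 < Num.sqrt S%:R :> R by rewrite sqrtr_gt0.
have key : eps * Num.sqrt S%:R + t * S%:R <= s1 / beta * S%:R.
  have -> : eps * Num.sqrt S%:R + t * S%:R = S%:R *
    (eps * ((Num.sqrt j%:R)^-1 + (Num.sqrt S%:R)^-1) + c0 / beta).
    have sS2 : S%:R = Num.sqrt S%:R ^+ 2 :> R by rewrite sqr_sqrtr // ltW.
    have sj : 0 < Num.sqrt j%:R :> R by rewrite sqrtr_gt0 ltr0n.
    rewrite /t; move: (Num.sqrt S%:R) (Num.sqrt j%:R) sS sj sS2 => a b a0 b0' ->.
    by field; rewrite !gt_eqF.
  rewrite [leRHS]mulrC ler_pM2l // -lerBrDr; apply: le_trans small _.
  by rewrite mulrBl.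
by lra.
Qed.

End KeyLemma.

(** Each slice of [Xs] factors through the top right singular space of the slice of [- G], of
    dimension [top_mult G x]. *)
Lemma top_rank_le : (\rank (xbar Xs) <= S)%N.
Proof.
have [X1 AX] := optimal_dual.
have [U [W [sG _ _]]] := spectral_calculus ns0 (- G).
have As x i : sigma (hat (- G) x) i <= s1 by rewrite hatNG sigmaN sigma_hat_le.
have TE x := trace_equality (sG x) s1_gt0 (As x) (AX x).
apply: leq_trans (@rank_xbar R k ns n1 n2 kk Xs W (fun x => top_row (hat (- G) x) s1) _) _.
  by move=> x; have [] := TE x.
apply: leq_sum => x _; rewrite -top_multN count_sigma; apply: leq_sum => i _.
rewrite mxE /= -/s1; case: (sigma _ _ == s1); last by rewrite mulr0n eqxx.
by case: (_ != _).
Qed.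

End Optimality.

(** * From the radius to the gap condition *)

Section GapRadius.
Variables (R : realType) (k : nat) (ns : 'I_k -> nat) (n1 n2 : nat).
Local Notation C := R[i].
Local Notation N := (num_slices ns).
Local Notation rtensor := (tensor R ns n1 n2).
Hypothesis ns0 : forall j, (0 < ns j)%N.
Local Notation ball := (@tnn_ball R k ns n1 n2).
Local Notation dot := (@tdot R k ns n1 n2).
Local Notation kk := (minn n1 n2).
Variables (G Xs : rtensor).
Let s1 := sigma (xbar G) 1.
Hypotheses (k0 : (0 < kk)%N) (s1_gt0 : 0 < s1).
Hypotheses (Xb : ball Xs) (Xopt : forall Z, ball Z -> 0 <= dot G (Z - Xs)).
Let cnt := top_mult G.
Let S := total_mult G.
Let m := slice_mult G.
Let q := nonzero_slices G.

Let S_gt0 : (0 < S)%N.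
Proof. exact: total_mult_gt0. Qed.

Lemma top_mult_gt0 x : (0 < cnt x)%N -> sigma (hat G x) 1 = s1.
Proof.
rewrite -has_count has_pred1 => /singular_value_le h.
by apply/eqP; rewrite eq_le h sigma_hat_le.
Qed.

Lemma top_mult_le x : (cnt x <= m)%N.
Proof.
have [->//|cx] := posnP (cnt x).
apply: leq_trans (leq_bigmax x); rewrite /mult_sigma1 -/(hat G) (top_mult_gt0 cx).
exact: leqnn.
Qed.

Lemma slice_mult_gt0 : (0 < m)%N.
Proof.
rewrite lt0n; apply: contraTneq S_gt0 => m0; rewrite -leqNgt leqn0.
rewrite sum_nat_eq0; apply/forallP => x; rewrite -leqn0 -m0; exact: top_mult_le.
Qed.

(** A zero slice contributes nothing because [s1] is positive; each other slice contributes at most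
    [m]. *)
Lemma total_mult_le : (S <= m * q)%N.
Proof.
rewrite /S /total_mult (bigID (fun x => hat G x != 0)) /= [X in (_ + X)%N]big1 ?addn0.
  rewrite /q /nonzero_slices mulnC -sum_nat_const; apply: leq_sum => x _.
  exact: top_mult_le.
move=> x; rewrite negbK => /eqP Gx; apply/eqP; rewrite -leqn0 leqNgt; apply/negP => cx.
move: s1_gt0; rewrite -(top_mult_gt0 cx) Gx lt_neqAle eq_sym => /andP[/eqP + _]; apply.
apply/eqP; rewrite eq_le sigma_ge0 andbT; apply: le_trans (sigma_le_nuclear _ _) _.
by rewrite -(scale0r (0 : 'M[C]_(n1, n2))) (@nuclear_normZ R n1 n2 0) // mul0r.
Qed.

Lemma inv_sqrt_total_mult :
  (Num.sqrt S%:R)^-1 <= Num.sqrt (m * q)%N%:R / S%:R :> R.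
Proof.
have S0 : 0 < S%:R :> R by rewrite ltr0n.
have -> : S%:R = Num.sqrt S%:R ^+ 2 :> R by rewrite sqr_sqrtr // ltW.
have h : Num.sqrt S%:R <= Num.sqrt (m * q)%N%:R :> R.
  by rewrite ler_wsqrtr // ler_nat total_mult_le.
rewrite sqrtr_sqr ger0_norm ?sqrtr_ge0 //.
have a0 : 0 < Num.sqrt S%:R :> R by rewrite sqrtr_gt0.
rewrite ler_pdivlMr ?exprn_gt0 // expr2 mulrA mulVf ?gt_eqF // mul1r.
exact: h.
Qed.

Let top_of f := \big[Num.max/0]_x sigma (hat G x) f.+1.

Lemma top_of_ge0 f : 0 <= top_of f.
Proof. exact: bigmax_ge_id. Qed.

Lemma sigma_le_top_of f x : sigma (hat G x) f.+1 <= top_of f.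
Proof. exact: le_bigmax. Qed.

Lemma deltaE f : delta G f = s1 - top_of f.
Proof. by []. Qed.

Lemma delta_ge0 f : 0 <= delta G f.
Proof.
rewrite deltaE subr_ge0; apply: bigmax_le => [|x _]; first exact: ltW.
exact: sigma_hat_le.
Qed.

Section AtPoint.
Variables (beta : R) (r : nat) (P : rtensor).
Hypotheses (b0 : 0 < beta) (mr : (m <= r)%N) (rk : (r < kk)%N).
Let eps := Num.sqrt (N%:R * enorm dot (P - (Xs - beta^-1 *: G)) ^+ 2).

Lemma gap_one : eps * (1 + (Num.sqrt S%:R)^-1) <= delta G r / beta -> gap_condition r P.
Proof.
move=> h; apply: (@gap_condition_of_close R k ns n1 n2 ns0 G Xs k0 s1_gt0 Xb Xopt
  beta P b0 r r 1 (top_of r)) => //.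
- by rewrite addn1.
- by move=> x; apply: leq_trans mr; exact: top_mult_le.
- exact: top_of_ge0.
- exact: sigma_le_top_of.
- by rewrite sqrtr1 invr1; exact: h.
Qed.

(** The split f = r - m + 1, j = m asks that no slice have more than [f] singular values equal to
    [s1]. If one does, delta(r - m + 1) vanishes, the hypothesis forces [eps] = 0, and the split f =
    r, j = 1 applies. *)
Lemma gap_mult : eps * ((Num.sqrt m%:R)^-1 + (Num.sqrt S%:R)^-1) <= delta G (r - m + 1) / beta ->
  gap_condition r P.
Proof.
move=> h; have m0 := slice_mult_gt0.
have a0 : 0 < Num.sqrt S%:R :> R by rewrite sqrtr_gt0 ltr0n.
have c0 : 0 < Num.sqrt m%:R :> R by rewrite sqrtr_gt0 ltr0n.
have [/forallP cf|] := boolP [forall x, (cnt x <= r - m + 1)%N].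
  apply: (@gap_condition_of_close R k ns n1 n2 ns0 G Xs k0 s1_gt0 Xb Xopt
    beta P b0 r (r - m + 1) m (top_of (r - m + 1))) => //.
  - by rewrite addnAC subnK // addn1.
  - exact: top_of_ge0.
  - exact: sigma_le_top_of.
rewrite negb_forall => /existsP[x]; rewrite -ltnNge => cx.
have s1x : s1 <= sigma (hat G x) (r - m + 1).+1.
  apply: count_le_sigma; apply: leq_trans cx _.
  by apply: sub_count => v /= /eqP ->.
have d0 : delta G (r - m + 1) <= 0.
  by rewrite deltaE subr_le0; apply: le_trans s1x (sigma_le_top_of _ _).
have e0 : eps = 0.
  apply/eqP; rewrite eq_le sqrtr_ge0 andbT.
  have : eps * ((Num.sqrt m%:R)^-1 + (Num.sqrt S%:R)^-1) <= 0.
    by apply: le_trans h _; rewrite pmulr_lle0 // invr_gt0.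
  by rewrite pmulr_lle0 // addr_gt0 // invr_gt0.
by apply: gap_one; rewrite e0 mul0r divr_ge0 ?delta_ge0 // ltW.
Qed.

Lemma gap_of_radius D : eps <= 2 * Num.sqrt N%:R * D -> D <= R0 G beta m S q r ->
  gap_condition r P.
Proof.
move=> eD DR; have N0 := numR_gt0 R ns0.
have sN : 0 < Num.sqrt N%:R :> R by rewrite sqrtr_gt0.
have a0 : 0 < Num.sqrt S%:R :> R by rewrite sqrtr_gt0 ltr0n.
have c0 : 0 < Num.sqrt m%:R :> R by rewrite sqrtr_gt0 ltr0n slice_mult_gt0.
have is0 := inv_sqrt_total_mult; move: DR; rewrite /R0.
set w := Num.sqrt (m * q)%N%:R / S%:R in is0 *.
have iS : 0 < (Num.sqrt S%:R)^-1 :> R by rewrite invr_gt0.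
have im : 0 < (Num.sqrt m%:R)^-1 :> R by rewrite invr_gt0.
have e0 : 0 <= eps by exact: sqrtr_ge0.
have bound (a d : R) : 0 < a -> D <= (2 * beta * Num.sqrt N%:R)^-1 * (d / a) ->
    eps * a <= d / beta.
  move=> ap h; rewrite -ler_pdivlMr //; apply: le_trans eD _.
  have -> : d / beta / a = 2 * Num.sqrt N%:R * ((2 * beta * Num.sqrt N%:R)^-1 * (d / a)).
    by field; rewrite !gt_eqF.
  by rewrite ler_wpM2l // mulr_ge0 // ltW.
rewrite maxEle; case: ifP => _ DR.
  apply: gap_mult; apply: le_trans (bound _ _ _ DR); last
    by rewrite ltr_pwDl // (le_trans _ is0) // ltW.
  by rewrite ler_wpM2l // lerD2l.
apply: gap_one; apply: le_trans (bound _ _ _ DR); last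
    by rewrite ltr_pwDl // (le_trans _ is0) // ltW.
by rewrite ler_wpM2l // lerD2l.
Qed.

(** Let c be sigma_(r+1) of some slice. That slice has at least r + 1 values >= c, more than its
    multiplicity of [s1], and the others have at least theirs. In total this exceeds [S], hence the
    rank of [Xs], so c is at most the value of index rank + 1. *)
Lemma compl_measure_le_delta : 0 < compl_measure G Xs -> compl_measure G Xs <= delta G r.
Proof.
move=> d0; rewrite deltaE /compl_measure -/s1 lerD2l lerN2.
apply: bigmax_le => [|x _]; first exact: sigma_ge0.
rewrite leNgt; apply/negP => lt.
suff : sigma (hat G x) r.+1 <= sigma (xbar G) (\rank (xbar Xs)).+1 by rewrite leNgt lt.
have rk' := top_rank_le ns0 k0 s1_gt0 Xb Xopt.
apply: count_le_sigma; rewrite count_xbar; apply: leq_ltn_trans rk' _.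
have ge y : (cnt y <= count (fun v => (sigma (hat G x) r.+1 <= v)%R) (singular_values (hat G y)))%N.
  by apply: sub_count => v /= /eqP ->; exact: sigma_hat_le.
rewrite /total_mult (bigD1 x) //= [ltnRHS](bigD1 x) //= -addSn; apply: leq_add; last first.
  by apply: leq_sum => y _; exact: ge.
apply: leq_trans (_ : (r.+1 <= _)%N); first by rewrite ltnS (leq_trans (top_mult_le x)).
rewrite count_sigma -[leqLHS](minn_idPr rk) -sum_ltn; apply: leq_sum => i _.
by case: ltnP => //= ir; rewrite sigma_le.
Qed.

(** The bound 2 sqrt N on distances within the ball gives eps <= 4 N, and 1 + 1 / sqrt S <= 2; the
    product is the 8 N of the growth formula. *)
Lemma gap_large D : eps <= 2 * Num.sqrt N%:R * D -> D <= 2 * Num.sqrt N%:R ->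
  0 < compl_measure G Xs -> 8 * N%:R * beta <= compl_measure G Xs -> gap_condition r P.
Proof.
move=> eD DN d0 dN; have N0 := numR_gt0 R ns0.
have sN : 0 < Num.sqrt N%:R :> R by rewrite sqrtr_gt0.
have sN2 : Num.sqrt N%:R ^+ 2 = N%:R :> R by rewrite sqr_sqrtr // ltW.
have e4 : eps <= 4 * N%:R.
  apply: le_trans eD _; apply: le_trans (_ : 2 * Num.sqrt N%:R * (2 * Num.sqrt N%:R) <= _).
    by rewrite ler_wpM2l // mulr_ge0 // ltW.
  have -> : 2 * Num.sqrt N%:R * (2 * Num.sqrt N%:R) = 4 * Num.sqrt N%:R ^+ 2 :> R by ring.
  by rewrite sN2.
apply: gap_one; rewrite ler_pdivlMr //.
apply: le_trans (compl_measure_le_delta d0); apply: le_trans dN.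
rewrite ler_pM2r //; apply: le_trans (_ : 4 * N%:R * 2 <= _); last by lra.
have iS : (Num.sqrt S%:R)^-1 <= 1 :> R.
  rewrite invf_le1 ?sqrtr_gt0 ?ltr0n //.
  by rewrite -[leLHS]sqrtr1 ler_wsqrtr // ler1n.
have iS0 : 0 <= (Num.sqrt S%:R)^-1 :> R by rewrite invr_ge0 sqrtr_ge0.
have e0 : 0 <= eps by exact: sqrtr_ge0.
by apply: ler_pM => //; lra.
Qed.

End AtPoint.
End GapRadius.

Lemma fgm_theta_step (R : realType) l : (0 < l)%N -> fgm_theta R l + 1 / 2 <= fgm_theta R l.+1.
Proof.
move=> l0; have t1 := fgm_theta_ge1 R l0; rewrite fgm_thetaS //.
have : 2 * fgm_theta R l <= Num.sqrt (1 + 4 * fgm_theta R l ^+ 2).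
  rewrite -[leLHS]ger0_norm ?mulr_ge0 ?(le_trans _ t1) // -sqrtr_sqr ler_wsqrtr // exprMn; lra.
lra.
Qed.

(** The inverted factor lies in (0, 1] for all [x] and [y], also for y = 0 since a quotient by zero
    is 0. *)
Lemma growth_formula_le (R : realType) (x y d dstar N : R) :
  0 < N -> 0 < Num.min (dstar / (8 * N) * (1 + 2 * x ^+ 2 / y ^+ 2)^-1) d ->
  0 < dstar /\ 8 * N * Num.min (dstar / (8 * N) * (1 + 2 * x ^+ 2 / y ^+ 2)^-1) d <= dstar.
Proof.
move=> N0; set v := (1 + _)^-1; rewrite lt_min => /andP[h _].
have v1 : 1 <= 1 + 2 * x ^+ 2 / y ^+ 2.
  by rewrite lerDl divr_ge0 ?sqr_ge0 // mulr_ge0 // sqr_ge0.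
have v0 : 0 < v by rewrite invr_gt0 (lt_le_trans ltr01).
have v2 : v <= 1 by rewrite invf_le1 // (lt_le_trans ltr01).
have d0 : 0 < dstar.
  by move: h; rewrite pmulr_lgt0 // pmulr_lgt0 // invr_gt0 mulr_gt0.
split=> //; apply: le_trans (_ : 8 * N * (dstar / (8 * N) * v) <= _).
  by rewrite ler_wpM2l ?ge_min ?lexx // mulr_ge0 // ltW.
have -> : 8 * N * (dstar / (8 * N) * v) = dstar * v by field; rewrite gt_eqF.
by rewrite -[leRHS]mulr1 ler_wpM2l // ltW.
Qed.

(** * The restarted method *)

Section RestartedMethod.
Variables (R : realType) (V : lmodType R) (dot : V -> V -> R).
Hypothesis ip : inner_product dot.
Local Notation norm := (enorm dot).
Variables (f : V -> R) (gf : V -> V) (beta gamma : R) (S : set V) (xs : V) (K : nat).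
Variables (Xo : nat -> V) (X Y : nat -> nat -> V).
Hypotheses (b0 : 0 < beta) (g0 : 0 < gamma) (cf : convex_function f) (sf : smooth dot beta f gf).
Hypotheses (cS : convex_set S) (xsP : is_minimizer f S xs) (qg : quadratic_growth dot f S xs gamma).
Local Notation kappa := (Num.sqrt (2 * beta) * expR 1 / Num.sqrt gamma).
Hypothesis Kk : kappa <= K%:R.
Hypotheses (run : restarted_fgm (is_proj dot S) gf beta K Xo X Y) (X1 : S (Xo 1%N)).

Let sg0 : 0 < Num.sqrt gamma. Proof. by rewrite sqrtr_gt0. Qed.
Let sb0 : 0 < Num.sqrt beta. Proof. by rewrite sqrtr_gt0. Qed.
Let s20 : 0 < Num.sqrt 2 :> R. Proof. by rewrite sqrtr_gt0. Qed.
Let sg2 : Num.sqrt gamma ^+ 2 = gamma. Proof. by rewrite sqr_sqrtr // ltW. Qed.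
Let sb2 : Num.sqrt beta ^+ 2 = beta. Proof. by rewrite sqr_sqrtr // ltW. Qed.
Let s22 : Num.sqrt 2 ^+ 2 = 2 :> R. Proof. by rewrite sqr_sqrtr. Qed.
Let sM (a : R) : Num.sqrt (2 * a) = Num.sqrt 2 * Num.sqrt a. Proof. by rewrite sqrtrM. Qed.

Lemma kappa_gt0 : 0 < kappa.
Proof. by rewrite divr_gt0 // mulr_gt0 ?expR_gt0 // sqrtr_gt0 mulr_gt0. Qed.

Lemma steps_gt0 : (0 < K)%N.
Proof. by rewrite -(ltr0n R); apply: lt_le_trans kappa_gt0 Kk. Qed.

Lemma inner_rate t l : (1 <= t)%N -> S (Xo t) -> (1 <= l <= K)%N ->
  S (X t l.+1) /\ f (X t l.+1) - f xs <= 2 * beta * norm (Xo t - xs) ^+ 2 / l.+1%:R ^+ 2.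
Proof.
move=> t0 St lK; have [XE YE st _] := run t0.
have S1 : S (X t 1%N) by rewrite XE.
have XY : Y t 1%N = X t 1%N by rewrite XE YE.
have XP l' (l'K : (1 <= l' <= K)%N) := (st l' l'K).1.
have YP l' (l'K : (1 <= l' <= K)%N) := (st l' l'K).2.
split; first by case: (XP l lK).
by have := fista_rate ip b0 cf sf cS xsP S1 XY XP YP lK; rewrite XE.
Qed.

(** Since kappa^2 = 2 beta e^2 / gamma, the rate after K >= kappa steps is at most gamma e^-2 times
    the squared initial distance. Quadratic growth at the old iterate turns this into the decrease
    of [f], and at the new one into that of the distance. *)
Lemma outer_step t : (1 <= t)%N -> S (Xo t) ->
  [/\ S (Xo t.+1), f (Xo t.+1) - f xs <= expR (- 2) * (f (Xo t) - f xs)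
    & norm (Xo t.+1 - xs) <= norm (Xo t - xs)].
Proof.
move=> t0 St; have [_ _ _ XE] := run t0.
have KK : (1 <= K <= K)%N by rewrite steps_gt0 leqnn.
have [SX rate] := inner_rate t0 St KK; rewrite -XE in SX rate.
have Kp : 0 < K.+1%:R :> R by rewrite ltr0n.
have e0 : 0 < expR 1 :> R by exact: expR_gt0.
have e2 : expR (- 2) = (expR 1 ^+ 2)^-1 :> R.
  by rewrite expRN -expRM_natl mulr1.
have ratio : 2 * beta / K.+1%:R ^+ 2 <= gamma * expR (- 2).
  have h : kappa ^+ 2 <= K.+1%:R ^+ 2.
    rewrite lerXn2r ?nnegrE ?(ltW kappa_gt0) ?(ltW Kp) //.
    by apply: le_trans Kk _; rewrite ler_nat.
  have kE : kappa ^+ 2 = 2 * beta * expR 1 ^+ 2 / gamma.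
    by rewrite sM !exprMn exprVn s22 sb2 sg2.
  rewrite e2 ler_pdivrMr ?exprn_gt0 //.
  apply: le_trans (_ : gamma / expR 1 ^+ 2 * kappa ^+ 2 <= _); last first.
    by rewrite ler_wpM2l // divr_ge0 ?sqr_ge0 // ltW.
  rewrite kE le_eqVlt; apply/orP; left; apply/eqP; field.
  by rewrite !gt_eqF.
have dt := qg St; have dt1 := qg SX.
have n0 : 0 <= norm (Xo t - xs) ^+ 2 by exact: sqr_ge0.
have rate2 : f (Xo t.+1) - f xs <= gamma * expR (- 2) * norm (Xo t - xs) ^+ 2.
  apply: le_trans rate _; rewrite mulrAC ler_wpM2r //.
have em0 : 0 < expR (- 2) :> R by exact: expR_gt0.
split=> //.
  apply: le_trans rate2 _; rewrite mulrAC mulrC ler_pM2l //.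
have em1 : expR (- 2) <= 1 :> R by rewrite -[leRHS]expR0 ler_expR; lra.
rewrite -(@ler_pXn2r _ 2) ?nnegrE ?enorm_ge0 //.
rewrite -(ler_pM2l g0); apply: le_trans dt1 _; apply: le_trans rate2 _.
by rewrite mulrAC -[leRHS]mulr1 ler_wpM2l // mulr_ge0 // ltW.
Qed.

Lemma outer_mem t : (1 <= t)%N -> S (Xo t) /\ norm (Xo t - xs) <= norm (Xo 1%N - xs).
Proof.
elim: t => [//|[_ _|t IH _]]; first by split.
have [St dt] := IH isT; have [S' _ d'] := outer_step (isT : (1 <= t.+1)%N) St.
by split=> //; apply: le_trans d' dt.
Qed.

Lemma inner_dist t l : (1 <= t)%N -> (1 <= l <= K)%N ->
  norm (X t l.+1 - xs) <= Num.sqrt 2 * Num.sqrt beta / Num.sqrt gamma * norm (Xo 1%N - xs) / l.+1%:R.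
Proof.
move=> t0 lK; have [St dt] := outer_mem t0; have [SX rate] := inner_rate t0 St lK.
have lp : 0 < l.+1%:R :> R by rewrite ltr0n.
have r0 : 0 <= Num.sqrt 2 * Num.sqrt beta / Num.sqrt gamma :> R.
  by rewrite divr_ge0 ?mulr_ge0 // sqrtr_ge0.
apply: le_trans (_ : Num.sqrt 2 * Num.sqrt beta / Num.sqrt gamma * norm (Xo t - xs) / l.+1%:R <= _).
  have rn : 0 <= Num.sqrt 2 * Num.sqrt beta / Num.sqrt gamma * norm (Xo t - xs) / l.+1%:R.
    by apply: divr_ge0; [apply: mulr_ge0 => //; exact: enorm_ge0 | exact: ltW].
  rewrite -(@ler_pXn2r _ 2) ?nnegrE ?enorm_ge0 //.
  rewrite -(ler_pM2l g0); apply: le_trans (qg SX) _; apply: le_trans rate _.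
  rewrite !exprMn !exprVn s22 sb2 sg2 le_eqVlt; apply/orP; left; apply/eqP; field.
  by rewrite !gt_eqF.
by rewrite ler_wpM2r ?invr_ge0 ?(ltW lp) // ler_wpM2l.
Qed.

(** The first momentum coefficient is 0 as theta_1 = 1. Afterwards it is at most 1 and the last two
    points are within A / 3 and A / 2 of the solution, so 2/3 + 1/2 = 7/6. *)
Lemma inner_extrapolation t l : (1 <= t)%N -> (1 <= l < K)%N ->
  norm (Y t l.+1 - xs) <=
    7 / 6 * (Num.sqrt 2 * Num.sqrt beta / Num.sqrt gamma * norm (Xo 1%N - xs)).
Proof.
move=> t0 /andP[l0 lK]; have lK' : (1 <= l <= K)%N by rewrite l0 ltnW.
have [_ _ st _] := run t0; have [_ ->] := st l lK'.
have := inner_dist t0 lK'; set A := _ / _ * norm _ => dl.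
have A0 : 0 <= A.
  by rewrite mulr_ge0 ?enorm_ge0 // divr_ge0 ?mulr_ge0 // sqrtr_ge0.
case: l l0 lK lK' dl => [//|[|l]] _ lK lK' dl.
  rewrite /fgm_theta /= subrr mul0r scale0r addr0.
  by apply: le_trans dl _; lra.
have lK2 : (1 <= l.+1 <= K)%N by case/andP: lK' => _ /ltnW ->.
have dl1 := inner_dist t0 lK2; rewrite -/A in dl1.
set c := (fgm_theta R l.+2 - 1) / fgm_theta R l.+3.
have th1 := fgm_theta_ge1 R (isT : (0 < l.+2)%N).
have th2 := fgm_theta_step R (isT : (0 < l.+2)%N).
have c0 : 0 <= c by rewrite divr_ge0 ?subr_ge0 //; lra.
have c1 : c <= 1 by rewrite ler_pdivrMr; lra.
have -> : X t l.+3 + c *: (X t l.+3 - X t l.+2) - xs =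
    (1 + c) *: (X t l.+3 - xs) - c *: (X t l.+2 - xs).
  rewrite [in RHS]scalerDl scale1r -[in RHS]addrA -[in RHS]scalerBr.
  by rewrite [in RHS]opprB [in RHS]addrA [in RHS]subrK addrAC.
apply: le_trans (enorm_triangle ip _ _) _; rewrite enormN // !enormZ //.
rewrite !ger0_norm ?addr_ge0 //.
have n2 := enorm_ge0 dot (X t l.+2 - xs); have n3 := enorm_ge0 dot (X t l.+3 - xs).
have h3 : norm (X t l.+3 - xs) <= A / 3.
  apply: le_trans dl _; rewrite ler_wpM2l // lef_pV2 ?posrE ?ltr0n // ler_nat //.
have h2 : norm (X t l.+2 - xs) <= A / 2.
  apply: le_trans dl1 _; rewrite ler_wpM2l // lef_pV2 ?posrE ?ltr0n // ler_nat //.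
have : (1 + c) * norm (X t l.+3 - xs) <= 2 * norm (X t l.+3 - xs) by rewrite ler_wpM2r //; lra.
have : c * norm (X t l.+2 - xs) <= 1 * norm (X t l.+2 - xs) by rewrite ler_wpM2r.
lra.
Qed.

Lemma linear_rate : 1 <= kappa -> forall t, (1 <= t)%N ->
  f (Xo t) - f xs <=
    expR (- (Num.sqrt (2 * gamma) / (Num.sqrt beta * expR 1)) * t.-1%:R) * (f (Xo 1%N) - f xs).
Proof.
move=> k1 t; set c := _ / _.
have e0 : 0 < expR 1 :> R by exact: expR_gt0.
(* An epoch divides the gap by e^2. As c kappa = 2, the condition kappa >= 1 means c <= 2, so that
   e^-2 <= e^-c. *)
have cE : c * kappa = 2.
  rewrite /c !sM; rewrite -[RHS]s22; field.
  by rewrite !gt_eqF.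
have cp : 0 <= c.
  by apply: divr_ge0; [exact: sqrtr_ge0 | apply: mulr_ge0; [exact: sqrtr_ge0 | exact: ltW]].
have c2 : c <= 2.
  by rewrite -cE -[leLHS]mulr1; apply: ler_wpM2l.
elim: t => [//|[_ _|t IH _]]; first by rewrite mulr0 expR0 mul1r.
have [St _] := outer_mem (isT : (1 <= t.+1)%N).
have [_ h _] := outer_step (isT : (1 <= t.+1)%N) St.
apply: le_trans h _; have {}IH := IH isT.
have f0 : 0 <= f (Xo t.+1) - f xs by rewrite subr_ge0; case: xsP => _; apply.
apply: le_trans (_ : expR (- c) * (f (Xo t.+1) - f xs) <= _).
  by rewrite ler_wpM2r // ler_expR lerN2.
rewrite /=; have -> : - c * t.+1%:R = - c + - c * t%:R by rewrite -natr1; ring.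
by rewrite expRD -mulrA ler_pM2l ?expR_gt0.
Qed.

(** As long as the runs agree they project the same points, so the two relations are compared only
    along the exact run. *)
Lemma run_unique (proj : V -> V -> Prop) Xo' X' Y' :
  (forall t l, (1 <= t)%N -> (1 <= l <= K)%N -> forall z,
     proj (Y t l - beta^-1 *: gf (Y t l)) z -> is_proj dot S (Y t l - beta^-1 *: gf (Y t l)) z) ->
  restarted_fgm proj gf beta K Xo' X' Y' -> Xo' 1%N = Xo 1%N ->
  forall t, (1 <= t)%N -> Xo' t = Xo t.
Proof.
move=> pp run' X1'; elim=> [//|[//|t IH _]].
have t0 : (1 <= t.+1)%N by [].
have [XE YE st ->] := run t0; have [XE' YE' st' ->] := run' _ t0.
suff h l : (l <= K)%N -> X' t.+1 l.+1 = X t.+1 l.+1 /\ Y' t.+1 l.+1 = Y t.+1 l.+1.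
  by have [] := h K (leqnn K).
elim: l => [_|l IHl lK]; first by rewrite XE XE' YE YE' IH.
have [eX eY] := IHl (ltnW lK); have lK' : (1 <= l.+1 <= K)%N by [].
have [pX ->] := st _ lK'; have [+ ->] := st' _ lK'.
rewrite eY => /(pp _ _ t0 lK') pX'.
have [Sx _] := pX.
have eX' := proj_unique ip Sx (proj_variational ip cS pX) pX'.
by rewrite eX' eX.
Qed.

End RestartedMethod.

(** The linear map may have a kernel, so [f] inherits convexity but not strong convexity. *)
Lemma composite_convex (R : realType) (V : lmodType R) (dot : V -> V -> R) (p : nat)
    (alpha : R) (g : 'rV[R]_p -> R) (A : {linear V -> 'rV[R]_p}) (c : V) (f : V -> R) :
  inner_product dot -> 0 < alpha -> strongly_convex (@mxdot R 1 p) alpha g ->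
  (forall x, f x = g (A x) + dot c x) -> convex_function f.
Proof.
move=> ip a0 gc fE x y t t01; rewrite !fE linearD !linearZ /=.
have := gc (A x) (A y) t t01.
have h : 0 <= alpha / 2 * (t * (1 - t)) * enorm (@mxdot R 1 p) (A x - A y) ^+ 2.
  have a2 : 0 <= alpha / 2 by rewrite divr_ge0 // ltW.
  case/andP: t01 => t0 t1; apply: mulr_ge0; last exact: sqr_ge0.
  by apply: mulr_ge0 => //; apply: mulr_ge0; rewrite ?subr_ge0.
by rewrite (dotDr ip) !(dotZr ip); lra.
Qed.

(** Replaceability takes two forms: the relations agree at every point that the exact run projects,
    and every truncated run, whatever SVDs it picks, has the same outer iterates. The rate is stated
    for kappa >= 1, where K >= kappa and the factor e^-2 per epoch yield the exponent. *)
Theorem theorem8 (R : realType) (d n1 n2 : nat) (ns : 'I_(d - 2) -> nat)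
    (hd : (3 <= d)%N) (hn1 : (0 < n1)%N) (hn2 : (0 < n2)%N)
    (hns : forall j, (0 < ns j)%N)
    (* the objective *)
    (p : nat) (alpha beta : R) (halpha : 0 < alpha) (hbeta : 0 < beta)
    (g : 'rV[R]_p -> R) (gradg : 'rV[R]_p -> 'rV[R]_p)
    (hg_sc : strongly_convex (@mxdot R 1 p) alpha g)
    (hg_sm : smooth (@mxdot R 1 p) beta g gradg)
    (Aop : {linear tensor R ns n1 n2 -> 'rV[R]_p})
    (Cost : tensor R ns n1 n2)
    (f : tensor R ns n1 n2 -> R)
    (hf : forall X, f X = g (Aop X) + tdot Cost X)
    (gradf : tensor R ns n1 n2 -> tensor R ns n1 n2)
    (hf_sm : smooth (@tdot R _ ns n1 n2) beta f gradf)
    (* the optimal solution *)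
    (Xstar : tensor R ns n1 n2)
    (hopt : is_minimizer f (@tnn_ball R _ ns n1 n2) Xstar)
    (huniq : forall X, is_minimizer f (@tnn_ball R _ ns n1 n2) X -> X = Xstar)
    (hsc : strict_complementarity (@tdot R _ ns n1 n2) gradf
             (@tnn_ball R _ ns n1 n2) Xstar)
    (* the quadratic growth constant *)
    (a b : nat)
    (Qop : {linear 'M[R]_((brows ns n1 + bcols ns n2) +
                          (brows ns n1 + bcols ns n2)) -> 'rV[R]_a})
    (Eop : {linear 'M[R]_((brows ns n1 + bcols ns n2) +
                          (brows ns n1 + bcols ns n2)) -> 'rV[R]_b})
    (Bop : {linear 'M[R]_((brows ns n1 + bcols ns n2) +
                          (brows ns n1 + bcols ns n2)) -> 'rV[R]_p})
    (hQ : Q_spec Qop) (hE : E_spec Eop) (hB : B_spec Aop Bop)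
    (U : 'M[R[i]]_(brows ns n1, \rank (xbar Xstar)))
    (W : 'M[R[i]]_(bcols ns n2, \rank (xbar Xstar)))
    (hsvd : is_svd (xbar Xstar) U W)
    (gamma : R) (hgamma : 0 < gamma)
    (hqg : quadratic_growth (@tdot R _ ns n1 n2) f (@tnn_ball R _ ns n1 n2)
             Xstar gamma)
    (hgammaE : gamma = growth_formula Qop Eop Bop U W alpha
                         (compl_measure (gradf Xstar) Xstar))
    (* the method *)
    (K : nat)
    (hK : K%:Z = Num.ceil (Num.sqrt (2 * beta) * expR 1 / Num.sqrt gamma))
    (Xo : nat -> tensor R ns n1 n2) (X Y : nat -> nat -> tensor R ns n1 n2)
    (hrun : restarted_fgm
              (is_proj (@tdot R _ ns n1 n2) (@tnn_ball R _ ns n1 n2))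
              gradf beta K Xo X Y)
    (m s q r : nat)
    (hm : m = slice_mult (gradf Xstar))
    (hs : s = mult_sigma1 (xbar (gradf Xstar)))
    (hq : q = nonzero_slices (gradf Xstar))
    (hr : (m <= r < minn n1 n2)%N)
    (hX1 : (@tnn_ball R _ ns n1 n2) (Xo 1%N))
    (hinit : enorm (@tdot R _ ns n1 n2) (Xo 1%N - Xstar) <=
       Num.sqrt 2 * Num.min gamma (Num.sqrt gamma) / (3 * Num.sqrt beta) *
       R0 (gradf Xstar) beta m s q r) :
  [/\ forall t l, (1 <= t)%N -> (1 <= l <= K)%N -> forall Z,
        trunc_proj r 1 (Y t l - beta^-1 *: gradf (Y t l)) Z <->
        is_proj (@tdot R _ ns n1 n2) (@tnn_ball R _ ns n1 n2)
          (Y t l - beta^-1 *: gradf (Y t l)) Z,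
      forall (Xo' : nat -> tensor R ns n1 n2)
             (X' Y' : nat -> nat -> tensor R ns n1 n2),
        restarted_fgm (@trunc_proj R _ ns n1 n2 r 1) gradf beta K Xo' X' Y' ->
        Xo' 1%N = Xo 1%N -> forall t, (1 <= t)%N -> Xo' t = Xo t
    & 1 <= Num.sqrt (2 * beta) * expR 1 / Num.sqrt gamma ->
      forall t, (1 <= t)%N ->
        f (Xo t) - f Xstar <=
          expR (- (Num.sqrt (2 * gamma) / (Num.sqrt beta * expR 1)) * t.-1%:R) *
          (f (Xo 1%N) - f Xstar)].
Proof.
have ip := @tdot_inner_product R _ ns n1 n2.
have cB := @ball_convex R _ ns n1 n2 hns.
have k0 : (0 < minn n1 n2)%N by rewrite leq_min hn1 hn2.
have N0 := numR_gt0 R hns; set N := num_slices ns in N0.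
have cf : convex_function f := composite_convex ip halpha hg_sc hf.
set G := gradf Xstar in hgammaE hm hs hq hinit.
have [Xb _] := hopt.
have Xopt := minimizer_gradient ip hf_sm cB hopt; rewrite -/G in Xopt.
have [d0 dN] : 0 < compl_measure G Xstar /\ 8 * N%:R * gamma <= compl_measure G Xstar.
  by move: hgamma; rewrite hgammaE; apply: growth_formula_le.
have s0 : 0 < sigma (xbar G) 1.
  by apply: lt_le_trans d0 _; rewrite /compl_measure gerBl sigma_ge0.
have sE : s = total_mult G by rewrite hs -total_multE.
have Kk : Num.sqrt (2 * beta) * expR 1 / Num.sqrt gamma <= K%:R.
  have := Num.Theory.ceil_ge (Num.sqrt (2 * beta) * expR 1 / Num.sqrt gamma).
  by rewrite -hK.
have mem t := outer_mem ip hbeta hgamma cf hf_sm cB hopt hqg Kk hrun hX1 (t := t).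
have K0 := steps_gt0 hbeta hgamma Kk.
have sg0 : 0 < Num.sqrt gamma by rewrite sqrtr_gt0.
have sb0 : 0 < Num.sqrt beta by rewrite sqrtr_gt0.
have s20 : 0 < Num.sqrt 2 :> R by rewrite sqrtr_gt0.
have s22 : Num.sqrt 2 ^+ 2 = 2 :> R by rewrite sqr_sqrtr.
set D := enorm _ (Xo 1%N - Xstar) in hinit mem.
set rad := R0 G beta m s q r in hinit.
have D0 : 0 <= D by exact: sqrtr_ge0.
have coef0 : 0 < Num.sqrt 2 * Num.min gamma (Num.sqrt gamma) / (3 * Num.sqrt beta) :> R.
  by rewrite divr_gt0 ?mulr_gt0 // lt_min hgamma.
have rad0 : 0 <= rad by rewrite -(pmulr_rge0 _ coef0); apply: le_trans hinit.
have hinit' : D <= Num.sqrt 2 * Num.sqrt gamma / (3 * Num.sqrt beta) * rad.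
  apply: le_trans hinit _; rewrite ler_wpM2r // ler_wpM2r ?invr_ge0 ?mulr_ge0 ?(ltW sb0) //.
  by rewrite ler_wpM2l ?(ltW s20) // ge_min lexx orbT.
case/andP: hr => mr rk; rewrite hm in mr.
have gap t l : (1 <= t)%N -> (1 <= l <= K)%N ->
    gap_condition r (Y t l - beta^-1 *: gradf (Y t l)).
  move=> t0 lK; set P := Y t l - _.
  (* The gradient is beta-Lipschitz, so a step of length 1 / beta at most doubles the distance; this
     is the 2 in [R0]. *)
  have EP : Num.sqrt (N%:R * enorm (@tdot R _ ns n1 n2) (P - (Xstar - beta^-1 *: G)) ^+ 2) <=
      2 * Num.sqrt N%:R * enorm (@tdot R _ ns n1 n2) (Y t l - Xstar).
    rewrite sqrtrM ?(ltW N0) // sqrtr_sqr ger0_norm ?enorm_ge0 //.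
    rewrite [2 * _]mulrC -mulrA ler_wpM2l ?sqrtr_ge0 //.
    have -> : P - (Xstar - beta^-1 *: G) =
        (Y t l - Xstar) - beta^-1 *: (gradf (Y t l) - G).
      by rewrite /P scalerBr !opprD !opprK addrACA.
    apply: le_trans (enorm_triangle ip _ _) _; rewrite enormN // enormZ //.
    rewrite gtr0_norm ?invr_gt0 //.
    have [_ /(_ (Y t l) Xstar)] := hf_sm; rewrite -/G => lip.
    have : beta^-1 * enorm (@tdot R _ ns n1 n2) (gradf (Y t l) - G) <=
        enorm (@tdot R _ ns n1 n2) (Y t l - Xstar).
      by rewrite ler_pdivrMl.
    lra.
  have near : enorm (@tdot R _ ns n1 n2) (Y t l - Xstar) <= rad ->
      gap_condition r P.
    move=> h; apply: (gap_of_radius hns k0 s0 Xb Xopt hbeta mr rk EP).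
    by apply: le_trans h _; rewrite /rad sE hm hq lexx.
  case: l lK P EP near => [//|[|l]] lK P EP near.
    have [_ YE _ _] := hrun t t0; have [Xt dt] := mem t t0.
    rewrite YE in EP near.
    (* The first inner point is the outer iterate. For gamma < beta the coefficient of [R0] in the
       initialization is below 1; otherwise it may exceed 1, and the lower bound on the
       complementarity measure takes over. *)
    have [gb|bg] := ltP gamma beta.
      apply: near; apply: le_trans dt _; apply: le_trans hinit' _.
      rewrite -[leRHS]mul1r ler_wpM2r // ler_pdivrMr ?mulr_gt0 // mul1r.
      have s2 : Num.sqrt 2 <= 2 :> R.
        rewrite -[leRHS]s22 expr2 ler_peMl ?(ltW s20) //.
        by rewrite -[leLHS]sqrtr1 ler_wsqrtr // ler1n.
      have gb' : Num.sqrt gamma <= Num.sqrt beta by rewrite ler_wsqrtr // ltW.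
      apply: le_trans (_ : 2 * Num.sqrt beta <= _); last by lra.
      by apply: ler_pM; rewrite ?(ltW s20) ?(ltW sg0).
    apply: (gap_large hns k0 s0 Xb Xopt hbeta mr rk EP _ d0).
      apply: le_trans (enorm_triangle ip _ _) _; rewrite enormN //.
      by rewrite mulr2n mulrDl mul1r; apply: lerD; apply: ball_enorm.
    by apply: le_trans dN; rewrite ler_wpM2l // mulr_ge0 // ltW.
  apply: near; have lK' : (1 <= l.+1 < K)%N by case/andP: lK.
  have := inner_extrapolation ip hbeta hgamma cf hf_sm cB hopt hqg Kk hrun hX1 t0 lK'.
  rewrite -/D => h; apply: le_trans h _.
  (* The growth factor sqrt (2 beta / gamma) cancels against the initialization coefficient up to
     2/3, and 7/6 * 2/3 = 7/9. *)
  have : Num.sqrt 2 * Num.sqrt beta / Num.sqrt gamma * D <= 2 / 3 * rad.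
    apply: le_trans (_ : Num.sqrt 2 * Num.sqrt beta / Num.sqrt gamma *
      (Num.sqrt 2 * Num.sqrt gamma / (3 * Num.sqrt beta) * rad) <= _).
      by rewrite ler_wpM2l // divr_ge0 ?mulr_ge0 // ltW.
    rewrite -[X in X / 3 * rad]s22 le_eqVlt; apply/orP; left; apply/eqP; field.
    by rewrite !gt_eqF.
  lra.
have proj_iff t l : (1 <= t)%N -> (1 <= l <= K)%N -> forall Z,
    trunc_proj r 1 (Y t l - beta^-1 *: gradf (Y t l)) Z <->
    is_proj (@tdot R _ ns n1 n2) (@tnn_ball R _ ns n1 n2)
      (Y t l - beta^-1 *: gradf (Y t l)) Z.
  by move=> t0 lK Z; apply: trunc_projE => //; exact: gap.
split=> //.
- move=> Xo' X' Y' run' X1'; apply: (run_unique ip cB hrun _ run' X1').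
  by move=> t l t0 lK Z /(proj_iff t l t0 lK).
- move=> k1; exact: (linear_rate ip hbeta hgamma cf hf_sm cB hopt hqg Kk hrun hX1 k1).
Qed.
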